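(* Let $R$ and $S$ be differential graded algebras (DGAs) over a commutative ring $\mathbb{K}$ and let $\phi:R\to S$ be a morphism of DGAs. Then the following conditions are equivalent: (1) The canonical map $S\otimes^{L}_{R}S\to S$ is an isomorphism. (2) For all DG left $S$-modules $M$ the canonical map $S\otimes^{L}_{R}M\to M$ is an isomorphism. (3) For all DG right $S$-modules $M$ and all DG left $S$-modules $N$ the canonical map $M\otimes^{L}_{R}N\to M\otimes^{L}_{S}N$ is an isomorphism. (4) For all DG left $S$-modules $M$ the canonical map $M\to \mathrm{RHom}_{R}(S,M)$ is an isomorphism. (5) For all DG left $S$-modules $M$ and $M'$ the canonical map $\mathrm{RHom}_{S}(M,M')\to \mathrm{RHom}_{R}(M,M')$ is an isomorphism. (6) The induced functor $\mathcal{D}(\phi):\mathcal{D}(S)\to\mathcal{D}(R)$ is a full embedding of derived categories (that is, it is fully faithful). Here $S$-modules are regarded as $R$-modules via $\phi$ where appropriate.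
   Context: All DGAs are over a fixed commutative ground ring $\mathbb{K}$, are $\mathbb{Z}$-graded, and have differential of degree $-1$ satisfying $\partial(rs)=\partial(r)s+(-1)^{|r|}r\partial(s)$. For a DGA $R$, $\mathcal{D}(R)$ is the derived category of DG left $R$-modules (the homotopy category with quasi-isomorphisms inverted). $\mathrm{RHom}$ and $\otimes^{L}$ are the total derived functors of Hom and tensor product of DG modules, computed by K-projective, K-injective or K-flat resolutions. A morphism of DGAs $\phi:R\to S$ makes every DG left (right) $S$-module a DG left (right) $R$-module; in particular $S$ is a DG $R$-$S$-bimodule, a DG $S$-$R$-bimodule and a DG $R$-$R$-bimodule. $\mathcal{D}(\phi):\mathcal{D}(S)\to\mathcal{D}(R)$ is the restriction of scalars functor, which is identified with ${}_{R}S_{S}\otimes^{L}_{S}-$. Canonical maps: those in (1) and (2) are the maps induced by multiplication (in (2), the action $s\otimes m\mapsto sm$; equivalently the counit of the adjunction between $S\otimes^{L}_{R}-$ and restriction of scalars); the map in (3) is the natural map induced by $M\otimes_{R}N\to M\otimes_{S}N$; the map in (4) is the unit of the adjunction between ${}_{R}S_{S}\otimes^{L}_{S}-:\mathcal{D}(S)\to\mathcal{D}(R)$ and $\mathrm{RHom}_{R}({}_{R}S_{S},-):\mathcal{D}(R)\to\mathcal{D}(S)$ (the derived version of $m\mapsto(s\mapsto sm)$, up to the usual sign); the map in (5) is the one induced by restriction of scalars. Isomorphism means isomorphism in the relevant derived category (equivalently, the map induces isomorphisms on homology). *)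

(* Defs.v *)
Set Warnings "-notation-overridden,-ambiguous-paths".
From HB Require Import structures.
From mathcomp Require Import all_boot all_order all_algebra.
From mathcomp Require Import boolp.
From mathcomp Require Import zify ring.

Set Warnings "-redundant-canonical-projection".
Set Implicit Arguments.
Unset Strict Implicit.
Unset Printing Implicit Defensive.

Import GRing.Theory.
Local Open Scope ring_scope.
Local Open Scope quotient_scope.

(* Pitfall: the degree of a homogeneous element is part of its type.  To avoid
   transports along equations such as (i - 1) + j = (i + j) - 1, every operation
   takes its target degree as a separate index, with a proof that it is the
   right one.  Since int has decidable equality these proofs are unique. *)

(* (-1)^i for i in int, without assuming that K has inverses. *)
Definition ksgn (K : pzRingType) (i : int) : K := (-1) ^+ `|i|%N.

Lemma ksgnD (K : pzRingType) i j : ksgn K (i + j) = ksgn K i * ksgn K j.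
Proof.
rewrite /ksgn -exprD -signr_odd -[RHS]signr_odd; congr (_ ^+ nat_of_bool _).
by apply/idP/idP; lia.
Qed.

Lemma ksgn1 (K : pzRingType) : ksgn K 1 = -1.
Proof. by rewrite /ksgn expr1. Qed.

Lemma ksgnN (K : pzRingType) i : ksgn K (- i) = ksgn K i.
Proof. by rewrite /ksgn abszN. Qed.

Lemma ksgnK (K : pzRingType) i : ksgn K i * ksgn K i = 1.
Proof. by rewrite /ksgn -exprD addnn -mul2n exprM sqrrN expr1n expr1n. Qed.

Lemma deg_up (n m i j : int) : m + 1 = n -> i + m = j -> i + n = j + 1.
Proof. by lia. Qed.
Lemma deg_down (n m i j : int) : m + 1 = n -> i + m = j -> (i - 1) + n = j.
Proof. by lia. Qed.
Lemma deg_pred (i : int) : i - 1 + 1 = i.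
Proof. by lia. Qed.

Record cplx (K : comPzRingType) := Cplx {
  cx_deg :> int -> lmodType K;
  cx_d : forall i j, j + 1 = i -> {linear cx_deg i -> cx_deg j};
  cx_dd : forall i j k (hij : j + 1 = i) (hjk : k + 1 = j) x,
    cx_d hjk (cx_d hij x) = 0 }.
Arguments cx_d {K} c {i j} _.

Record cmap (K : comPzRingType) (C D : cplx K) := CMap {
  cm_fun :> forall i, {linear C i -> D i};
  cm_d : forall i j (h : j + 1 = i) x,
    cm_fun j (cx_d C h x) = cx_d D h (cm_fun i x) }.
Arguments cm_fun {K C D} c {i}.

Definition cycle (K : comPzRingType) (C : cplx K) i (x : C i) : Prop :=
  forall j (h : j + 1 = i), cx_d C h x = 0.

Definition boundary (K : comPzRingType) (C : cplx K) i (x : C i) : Prop :=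
  exists (k : int) (h : i + 1 = k) (y : C k), cx_d C h y = x.

Definition acyclic (K : comPzRingType) (C : cplx K) : Prop :=
  forall i (x : C i), cycle x -> boundary x.

(* H_i(f), the map induced on cycles modulo boundaries, is injective and
   surjective for every i. *)
Definition quasi_iso (K : comPzRingType) (C D : cplx K) (f : cmap C D) : Prop :=
  forall i,
    (forall x : C i, cycle x -> boundary (f i x) -> boundary x) /\
    (forall y : D i, cycle y ->
       exists x : C i, cycle x /\ boundary (f i x - y)).

Record dga (K : comPzRingType) := Dga {
  dga_cx :> cplx K;
  dga_mul : forall i j k, i + j = k -> dga_cx i -> dga_cx j -> dga_cx k;
  dga_one : dga_cx 0;
  dga_mul_linl : forall i j k (h : i + j = k) s,
    linear (fun r => dga_mul h r s);
  dga_mul_linr : forall i j k (h : i + j = k) r, linear (dga_mul h r);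
  dga_mulA : forall a b c ab bc abc (h1 : a + b = ab) (h2 : ab + c = abc)
      (h3 : b + c = bc) (h4 : a + bc = abc) r s t,
    dga_mul h4 r (dga_mul h3 s t) = dga_mul h2 (dga_mul h1 r s) t;
  dga_mul1l : forall i (h : 0 + i = i) r, dga_mul h dga_one r = r;
  dga_mul1r : forall i (h : i + 0 = i) r, dga_mul h r dga_one = r;
  dga_leibniz : forall i j k i' j' k' (h : i + j = k)
      (hi : i' + 1 = i) (hj : j' + 1 = j) (hk : k' + 1 = k)
      (h1 : i' + j = k') (h2 : i + j' = k') r s,
    cx_d dga_cx hk (dga_mul h r s) =
      dga_mul h1 (cx_d dga_cx hi r) s
      + ksgn K i *: dga_mul h2 r (cx_d dga_cx hj s) }.
Arguments dga_mul {K} d {i j k} _ _ _.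
Arguments dga_one {K} d.

Record dga_hom (K : comPzRingType) (R S : dga K) := DgaHom {
  dgh_map :> cmap R S;
  dgh_mul : forall i j k (h : i + j = k) (r : R i) (s : R j),
    dgh_map k (dga_mul R h r s) = dga_mul S h (dgh_map i r) (dgh_map j s);
  dgh_one : dgh_map 0 (dga_one R) = dga_one S }.

Record ldgmod (K : comPzRingType) (R : dga K) := LDgMod {
  ldg_cx :> cplx K;
  lact : forall i j k, i + j = k -> R i -> ldg_cx j -> ldg_cx k;
  lact_linl : forall i j k (h : i + j = k) x, linear (fun r => lact h r x);
  lact_linr : forall i j k (h : i + j = k) r, linear (lact h r);
  lactA : forall a b c ab bc abc (h1 : a + b = ab) (h2 : ab + c = abc)
      (h3 : b + c = bc) (h4 : a + bc = abc) r s x,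
    lact h4 r (lact h3 s x) = lact h2 (dga_mul R h1 r s) x;
  lact1 : forall i (h : 0 + i = i) x, lact h (dga_one R) x = x;
  lact_leibniz : forall i j k i' j' k' (h : i + j = k)
      (hi : i' + 1 = i) (hj : j' + 1 = j) (hk : k' + 1 = k)
      (h1 : i' + j = k') (h2 : i + j' = k') r x,
    cx_d ldg_cx hk (lact h r x) =
      lact h1 (cx_d R hi r) x + ksgn K i *: lact h2 r (cx_d ldg_cx hj x) }.
Arguments lact {K R} l {i j k} _ _ _.

Record rdgmod (K : comPzRingType) (R : dga K) := RDgMod {
  rdg_cx :> cplx K;
  ract : forall i j k, i + j = k -> rdg_cx i -> R j -> rdg_cx k;
  ract_linl : forall i j k (h : i + j = k) r, linear (fun x => ract h x r);
  ract_linr : forall i j k (h : i + j = k) x, linear (ract h x);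
  ractA : forall a b c ab bc abc (h1 : a + b = ab) (h2 : ab + c = abc)
      (h3 : b + c = bc) (h4 : a + bc = abc) x r s,
    ract h4 x (dga_mul R h3 r s) = ract h2 (ract h1 x r) s;
  ract1 : forall i (h : i + 0 = i) x, ract h x (dga_one R) = x;
  ract_leibniz : forall i j k i' j' k' (h : i + j = k)
      (hi : i' + 1 = i) (hj : j' + 1 = j) (hk : k' + 1 = k)
      (h1 : i' + j = k') (h2 : i + j' = k') x r,
    cx_d rdg_cx hk (ract h x r) =
      ract h1 (cx_d rdg_cx hi x) r + ksgn K i *: ract h2 x (cx_d R hj r) }.
Arguments ract {K R} r {i j k} _ _ _ : rename.

Definition lregular (K : comPzRingType) (R : dga K) : ldgmod R :=
  @LDgMod K R R (@dga_mul K R) (@dga_mul_linl K R) (@dga_mul_linr K R)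
    (@dga_mulA K R) (@dga_mul1l K R) (@dga_leibniz K R).

Definition rregular (K : comPzRingType) (R : dga K) : rdgmod R :=
  @RDgMod K R R (@dga_mul K R) (@dga_mul_linl K R) (@dga_mul_linr K R)
    (@dga_mulA K R) (@dga_mul1r K R) (@dga_leibniz K R).

Section Restriction.
Variables (K : comPzRingType) (R S : dga K) (phi : dga_hom R S).

Definition lres (M : ldgmod S) : ldgmod R.
Proof.
refine (@LDgMod K R M (fun i j k h r x => lact M h (phi i r) x) _ _ _ _ _).
- by move=> i j k h x a r s /=; rewrite linearP lact_linl.
- by move=> i j k h r; apply: lact_linr.
- by move=> * /=; rewrite dgh_mul; apply: lactA.
- by move=> * /=; rewrite dgh_one lact1.
- by move=> * /=; rewrite cm_d; apply: lact_leibniz.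
Defined.

Definition rres (M : rdgmod S) : rdgmod R.
Proof.
refine (@RDgMod K R M (fun i j k h x r => ract M h x (phi j r)) _ _ _ _ _).
- by move=> i j k h r; apply: ract_linl.
- by move=> i j k h x a r s /=; rewrite linearP ract_linr.
- by move=> * /=; rewrite dgh_mul; apply: ractA.
- by move=> * /=; rewrite dgh_one ract1.
- by move=> * /=; rewrite cm_d; apply: ract_leibniz.
Defined.

End Restriction.

Record ldg_hom (K : comPzRingType) (R : dga K) (M N : ldgmod R) := LDgHom {
  lh_map :> cmap M N;
  lh_act : forall i j k (h : i + j = k) (r : R i) (x : M j),
    lh_map k (lact M h r x) = lact N h r (lh_map j x) }.

Definition lh_id (K : comPzRingType) (R : dga K) (M : ldgmod R) : ldg_hom M M :=
  @LDgHom K R M M (@CMap K M M (fun i => idfun) (fun _ _ _ _ => erefl))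
    (fun _ _ _ _ _ _ => erefl).

Definition cmap_comp (K : comPzRingType) (C D E : cplx K)
  (g : cmap D E) (f : cmap C D) : cmap C E.
Proof.
refine (@CMap K C E (fun i => g i \o f i) _).
by move=> i j h x /=; rewrite !cm_d.
Defined.

Definition lh_comp (K : comPzRingType) (R : dga K) (M N P : ldgmod R)
  (g : ldg_hom N P) (f : ldg_hom M N) : ldg_hom M P.
Proof.
refine (@LDgHom K R M P (cmap_comp g f) _).
by move=> i j k h r x /=; rewrite !lh_act.
Defined.

Definition lh_res (K : comPzRingType) (R S : dga K) (phi : dga_hom R S)
    (M N : ldgmod S) (f : ldg_hom M N) : ldg_hom (lres phi M) (lres phi N) :=
  @LDgHom K R (lres phi M) (lres phi N) (lh_map f)
    (fun i j k h r x => lh_act f h (phi i r) x).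

Section Hom.
Variables (K : comPzRingType) (R : dga K) (M N : ldgmod R).

Record ghom (n : int) := GHom {
  gh_fun : forall i j, i + n = j -> M i -> N j;
  gh_lin : forall i j (h : i + n = j), linear (gh_fun h);
  gh_act : forall p i j k l (h1 : p + i = k) (h2 : i + n = j) (h3 : k + n = l)
      (h4 : p + j = l) (r : R p) (x : M i),
    gh_fun h3 (lact M h1 r x) = ksgn K (n * p) *: lact N h4 r (gh_fun h2 x) }.

Arguments gh_fun {n} g {i j} _ _.

HB.instance Definition _ n := gen_eqMixin (ghom n).
HB.instance Definition _ n := gen_choiceMixin (ghom n).

Lemma ghomP n (f g : ghom n) :
  (forall i j (h : i + n = j) x, gh_fun f h x = gh_fun g h x) -> f = g.
Proof.
case: f g => [f f1 f2] [g g1 g2] /= fg.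
have {}fg : f = g.
  do 4![apply: functional_extensionality_dep => ?]; exact: fg.
by subst g; congr GHom; apply: Prop_irrelevance.
Qed.

Lemma lact0r (L : ldgmod R) i j k (h : i + j = k) r : lact L h r 0 = 0.
Proof.
by have := lact_linr h r (-1) (0 : L j) 0; rewrite scaler0 addr0 scaleN1r addNr.
Qed.
Lemma lactZr (L : ldgmod R) i j k (h : i + j = k) r a x :
  lact L h r (a *: x) = a *: lact L h r x.
Proof. by have := lact_linr h r a x 0; rewrite lact0r !addr0. Qed.
Lemma lactDr (L : ldgmod R) i j k (h : i + j = k) r x y :
  lact L h r (x + y) = lact L h r x + lact L h r y.
Proof. by have := lact_linr h r 1 x y; rewrite !scale1r. Qed.
Lemma lactBr (L : ldgmod R) i j k (h : i + j = k) r x y :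
  lact L h r (x - y) = lact L h r x - lact L h r y.
Proof. by rewrite lactDr -scaleN1r lactZr scaleN1r. Qed.
Lemma lact0l (L : ldgmod R) i j k (h : i + j = k) x : lact L h 0 x = 0.
Proof.
by have := lact_linl h x (-1) (0 : R i) 0; rewrite scaler0 addr0 scaleN1r addNr.
Qed.
Lemma lactZl (L : ldgmod R) i j k (h : i + j = k) r a x :
  lact L h (a *: r) x = a *: lact L h r x.
Proof. by have := lact_linl h x a r 0; rewrite lact0l !addr0. Qed.

Lemma gh0 n (f : ghom n) i j (h : i + n = j) : gh_fun f h 0 = 0.
Proof.
by have := gh_lin f h (-1) 0 0; rewrite scaler0 addr0 scaleN1r addNr.
Qed.
Lemma ghZ n (f : ghom n) i j (h : i + n = j) a x :
  gh_fun f h (a *: x) = a *: gh_fun f h x.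
Proof. by have := gh_lin f h a x 0; rewrite gh0 !addr0. Qed.
Lemma ghD n (f : ghom n) i j (h : i + n = j) x y :
  gh_fun f h (x + y) = gh_fun f h x + gh_fun f h y.
Proof. by have := gh_lin f h 1 x y; rewrite !scale1r. Qed.

Definition ghom_zero n : ghom n.
Proof.
refine (@GHom n (fun _ _ _ _ => 0) _ _).
- by move=> i j h a x y; rewrite scaler0 addr0.
- by move=> * /=; rewrite lact0r scaler0.
Defined.

Definition ghom_add n (f g : ghom n) : ghom n.
Proof.
refine (@GHom n (fun _ _ h x => gh_fun f h x + gh_fun g h x) _ _).
- by move=> i j h a x y; rewrite !ghD !ghZ scalerDr addrACA.
- move=> p i j k l h1 h2 h3 h4 r x.
  by rewrite (gh_act f h1 h2 h3 h4) (gh_act g h1 h2 h3 h4) lactDr scalerDr.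
Defined.

Definition ghom_scale n (a : K) (f : ghom n) : ghom n.
Proof.
refine (@GHom n (fun _ _ h x => a *: gh_fun f h x) _ _).
- by move=> i j h b x y; rewrite ghD ghZ scalerDr !scalerA mulrC.
- move=> p i j k l h1 h2 h3 h4 r x.
  by rewrite (gh_act f h1 h2 h3 h4) lactZr !scalerA mulrC.
Defined.

Lemma ghom_addA n : associative (@ghom_add n).
Proof. by move=> f g e; apply: ghomP => * /=; rewrite addrA. Qed.
Lemma ghom_addC n : commutative (@ghom_add n).
Proof. by move=> f g; apply: ghomP => * /=; rewrite addrC. Qed.
Lemma ghom_add0 n : left_id (@ghom_zero n) (@ghom_add n).
Proof. by move=> f; apply: ghomP => * /=; rewrite add0r. Qed.
Lemma ghom_addN n :
  left_inverse (@ghom_zero n) (@ghom_scale n (-1)) (@ghom_add n).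
Proof. by move=> f; apply: ghomP => * /=; rewrite scaleN1r addNr. Qed.

HB.instance Definition _ n := GRing.isZmodule.Build (ghom n)
  (@ghom_addA n) (@ghom_addC n) (@ghom_add0 n) (@ghom_addN n).

Lemma ghom_scaleA n a b (f : ghom n) :
  ghom_scale a (ghom_scale b f) = ghom_scale (a * b) f.
Proof. by apply: ghomP => * /=; rewrite scalerA. Qed.
Lemma ghom_scale1 n : left_id 1 (@ghom_scale n).
Proof. by move=> f; apply: ghomP => * /=; rewrite scale1r. Qed.
Lemma ghom_scaleDr n : right_distributive (@ghom_scale n) +%R.
Proof. by move=> a f g; apply: ghomP => * /=; rewrite scalerDr. Qed.
Lemma ghom_scaleDl n (f : ghom n) :
  {morph (@ghom_scale n)^~ f : a b / a + b >-> a + b}.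
Proof. by move=> a b; apply: ghomP => * /=; rewrite scalerDl. Qed.

HB.instance Definition _ n := GRing.Zmodule_isLmodule.Build K (ghom n)
  (@ghom_scaleA n) (@ghom_scale1 n) (@ghom_scaleDr n) (@ghom_scaleDl n).

(* D f = d o f - (-1)^|f| f o d *)
Definition ghom_d_fun n m (hm : m + 1 = n) (f : ghom n) : ghom m.
Proof.
refine (@GHom m (fun i j h x =>
  cx_d N erefl (gh_fun f (deg_up hm h) x)
  - ksgn K n *: gh_fun f (deg_down hm h) (cx_d M (deg_pred i) x)) _ _).
- move=> i j h a x y.
  rewrite ghD ghZ !linearP ghD ghZ scalerDr scalerBr !scalerA opprD addrACA.
  by rewrite (mulrC a).
- move=> p i j k l h1 h2 h3 h4 r x.
  have h5 : p + (j + 1) = l + 1 by lia.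
  rewrite (gh_act f h1 (deg_up hm h2) (deg_up hm h3) h5) linearZ /=.
  have h6 : p - 1 + (j + 1) = l by lia.
  rewrite (lact_leibniz h5 (deg_pred p) erefl erefl h6 h4).
  have h7 : p - 1 + i = k - 1 by lia.
  have h8 : p + (i - 1) = k - 1 by lia.
  rewrite (lact_leibniz h1 (deg_pred p) (deg_pred i) (deg_pred k) h7 h8).
  rewrite ghD ghZ (gh_act f h7 (deg_up hm h2) _ h6).
  rewrite (gh_act f h8 (deg_down hm h2) _ h4).
  rewrite lactBr !lactZr !scalerBr !scalerDr !scalerA.
  have -> : ksgn K n * ksgn K (n * (p - 1)) = ksgn K (n * p).
    by rewrite mulrBr mulr1 ksgnD ksgnN mulrCA ksgnK mulr1.
  have np : n * p = m * p + p by rewrite -hm; ring.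
  have -> : ksgn K (n * p) * ksgn K p = ksgn K (m * p).
    by rewrite np ksgnD -mulrA ksgnK mulr1.
  have -> : ksgn K n * ksgn K p * ksgn K (n * p) = ksgn K (m * p) * ksgn K n.
    by rewrite np ksgnD mulrACA ksgnK mulr1 mulrC.
  by rewrite opprD addrACA subrr add0r.
Defined.

Lemma ghom_d_linear n m (hm : m + 1 = n) : linear (ghom_d_fun hm).
Proof.
move=> a f g; apply: ghomP => i j h x /=.
rewrite linearP scalerBr scalerDr opprD addrACA; congr (_ + _ + (_ - _)).
by rewrite !scalerA mulrC.
Qed.

HB.instance Definition _ n m (hm : m + 1 = n) :=
  GRing.isLinear.Build K (ghom n) (ghom m) *:%R (ghom_d_fun hm)
    (ghom_d_linear hm).

Definition ghom_d n m (hm : m + 1 = n) : {linear ghom n -> ghom m} :=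
  ghom_d_fun hm.

Lemma ghom_dd n m l (hm : m + 1 = n) (hl : l + 1 = m) f :
  ghom_d hl (ghom_d hm f) = 0.
Proof.
apply: ghomP => i j h x /=.
rewrite linearB /= linearZ /= !cx_dd gh0 scaler0 subr0 sub0r.
have -> : ksgn K n = - ksgn K m by rewrite -hm ksgnD ksgn1 mulrN1.
rewrite scaleNr opprK.
rewrite (eq_irrelevance (deg_down _ (deg_up _ _)) (deg_up hm (deg_down hl h))).
by rewrite subrr.
Qed.

Definition hom_cx : cplx K := @Cplx K ghom ghom_d ghom_dd.

End Hom.
Arguments gh_fun {K R M N n} g {i j} _ _.

(* The tensor product M (x)_R N, by generators and relations: in degree n, formal
   K-linear combinations of symbols x (x) y with |x| + |y| = n, modulo
   K-bilinearity and x r (x) y = x (x) r y. *)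
Section Tensor.
Variables (K : comPzRingType) (R : dga K) (M : rdgmod R) (N : ldgmod R).

Inductive tterm (n : int) : Type :=
| TZero
| TAdd (s t : tterm n)
| TScale (a : K) (t : tterm n)
| TPure i j (h : i + j = n) (x : M i) (y : N j).
Arguments TZero {n}.

Inductive trel (n : int) : tterm n -> tterm n -> Prop :=
| trel_refl t : trel t t
| trel_sym s t : trel s t -> trel t s
| trel_trans s t u : trel s t -> trel t u -> trel s u
| trel_add s s' t t' : trel s s' -> trel t t' -> trel (TAdd s t) (TAdd s' t')
| trel_scale a t t' : trel t t' -> trel (TScale a t) (TScale a t')
| trel_addA s t u : trel (TAdd s (TAdd t u)) (TAdd (TAdd s t) u)
| trel_addC s t : trel (TAdd s t) (TAdd t s)
| trel_add0 t : trel (TAdd TZero t) t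
| trel_addN t : trel (TAdd (TScale (-1) t) t) TZero
| trel_scaleA a b t : trel (TScale a (TScale b t)) (TScale (a * b) t)
| trel_scale1 t : trel (TScale 1 t) t
| trel_scaleDr a s t :
    trel (TScale a (TAdd s t)) (TAdd (TScale a s) (TScale a t))
| trel_scaleDl a b t : trel (TScale (a + b) t) (TAdd (TScale a t) (TScale b t))
| trel_linl i j (h : i + j = n) a x x' (y : N j) :
    trel (TPure h (a *: x + x') y) (TAdd (TScale a (TPure h x y)) (TPure h x' y))
| trel_linr i j (h : i + j = n) a (x : M i) y y' :
    trel (TPure h x (a *: y + y')) (TAdd (TScale a (TPure h x y)) (TPure h x y'))
| trel_bal i p j ip pj (h1 : i + p = ip) (h2 : ip + j = n) (h3 : p + j = pj)
    (h4 : i + pj = n) (x : M i) (r : R p) (y : N j) :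
    trel (TPure h2 (ract M h1 x r) y) (TPure h4 x (lact N h3 r y)).

HB.instance Definition _ n := gen_eqMixin (tterm n).
HB.instance Definition _ n := gen_choiceMixin (tterm n).

Definition trelb n : rel (tterm n) := fun s t => `[< trel s t >].

Lemma trelb_refl n : reflexive (@trelb n).
Proof. by move=> t; apply/asboolP; apply: trel_refl. Qed.
Lemma trelb_sym n : symmetric (@trelb n).
Proof. by move=> s t; apply/asboolP/asboolP; apply: trel_sym. Qed.
Lemma trelb_trans n : transitive (@trelb n).
Proof. by move=> t s u /asboolP st /asboolP tu; apply/asboolP/(trel_trans st tu). Qed.

Canonical trel_equiv n :=
  EquivRel (@trelb n) (@trelb_refl n) (@trelb_sym n) (@trelb_trans n).

Definition tens n := {eq_quot (trel_equiv n)}.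
HB.instance Definition _ n := Choice.on (tens n).
HB.instance Definition _ n := EqQuotient.on (tens n).

Definition tcl n (t : tterm n) : tens n := \pi_(tens n) t.

Lemma tclP n (s t : tterm n) : trel s t <-> tcl s = tcl t.
Proof.
split=> [st|/eqmodP/asboolP //].
by apply/eqmodP/asboolP.
Qed.

Lemma tclK n (x : tens n) : tcl (repr x) = x.
Proof. exact: reprK. Qed.

Lemma tensW n (P : tens n -> Prop) : (forall t, P (tcl t)) -> forall x, P x.
Proof. by move=> Pt x; rewrite -(tclK x). Qed.

Lemma repr_tcl n (t : tterm n) : trel (repr (tcl t)) t.
Proof. by apply/tclP; rewrite tclK. Qed.

Definition tens_add n (x y : tens n) : tens n := tcl (TAdd (repr x) (repr y)).
Definition tens_scale n a (x : tens n) : tens n := tcl (TScale a (repr x)).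

Lemma tcl_add n (s t : tterm n) : tcl (TAdd s t) = tens_add (tcl s) (tcl t).
Proof. by apply/tclP/trel_sym/trel_add; apply: repr_tcl. Qed.
Lemma tcl_scale n a (t : tterm n) : tcl (TScale a t) = tens_scale a (tcl t).
Proof. by apply/tclP/trel_sym/trel_scale; apply: repr_tcl. Qed.

Lemma tens_addA n : associative (@tens_add n).
Proof.
elim/tensW=> s; elim/tensW=> t; elim/tensW=> u.
by rewrite -!tcl_add; apply/tclP/trel_addA.
Qed.
Lemma tens_addC n : commutative (@tens_add n).
Proof.
by elim/tensW=> s; elim/tensW=> t; rewrite -!tcl_add; apply/tclP/trel_addC.
Qed.
Lemma tens_add0 n : left_id (tcl TZero) (@tens_add n).
Proof. by elim/tensW=> s; rewrite -tcl_add; apply/tclP/trel_add0. Qed.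
Lemma tens_addN n :
  left_inverse (tcl TZero) (@tens_scale n (-1)) (@tens_add n).
Proof. by elim/tensW=> s; rewrite -tcl_scale -tcl_add; apply/tclP/trel_addN. Qed.

HB.instance Definition _ n := GRing.isZmodule.Build (tens n)
  (@tens_addA n) (@tens_addC n) (@tens_add0 n) (@tens_addN n).

Lemma tens_scaleA n a b (x : tens n) :
  tens_scale a (tens_scale b x) = tens_scale (a * b) x.
Proof. by elim/tensW: x => t; rewrite -!tcl_scale; apply/tclP/trel_scaleA. Qed.
Lemma tens_scale1 n : left_id 1 (@tens_scale n).
Proof. by elim/tensW=> t; rewrite -!tcl_scale; apply/tclP/trel_scale1. Qed.
Lemma tens_scaleDr n : right_distributive (@tens_scale n) +%R.
Proof.
move=> a; elim/tensW=> s; elim/tensW=> t.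
rewrite /+%R /= -tcl_add -!tcl_scale -tcl_add; exact/tclP/trel_scaleDr.
Qed.
Lemma tens_scaleDl n (x : tens n) :
  {morph (@tens_scale n)^~ x : a b / a + b >-> a + b}.
Proof.
elim/tensW: x => t a b.
by rewrite -!tcl_scale [RHS]/+%R /= -tcl_add; apply/tclP/trel_scaleDl.
Qed.

HB.instance Definition _ n := GRing.Zmodule_isLmodule.Build K (tens n)
  (@tens_scaleA n) (@tens_scale1 n) (@tens_scaleDr n) (@tens_scaleDl n).

Lemma tcl0 n : tcl (@TZero n) = 0. Proof. by []. Qed.
Lemma tclD n (s t : tterm n) : tcl (TAdd s t) = tcl s + tcl t.
Proof. exact: tcl_add. Qed.
Lemma tclZ n a (t : tterm n) : tcl (TScale a t) = a *: tcl t.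
Proof. exact: tcl_scale. Qed.

Definition tpure n i j (h : i + j = n) (x : M i) (y : N j) : tens n :=
  tcl (TPure h x y).

Lemma tpure_linl n i j (h : i + j = n) y : linear (fun x => tpure h x y).
Proof. by move=> a x x'; rewrite /tpure -tclZ -tclD; apply/tclP/trel_linl. Qed.
Lemma tpure_linr n i j (h : i + j = n) x : linear (tpure h x).
Proof. by move=> a y y'; rewrite /tpure -tclZ -tclD; apply/tclP/trel_linr. Qed.
Lemma tpure_bal n i p j ip pj (h1 : i + p = ip) (h2 : ip + j = n)
    (h3 : p + j = pj) (h4 : i + pj = n) x r y :
  tpure h2 (ract M h1 x r) y = tpure h4 x (lact N h3 r y).
Proof. exact/tclP/trel_bal. Qed.

Lemma tens_ind n (P : tens n -> Prop) :
  P 0 -> (forall x y, P x -> P y -> P (x + y)) ->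
  (forall a x, P x -> P (a *: x)) ->
  (forall i j (h : i + j = n) x y, P (tpure h x y)) -> forall t, P t.
Proof.
move=> P0 PD PZ Pp; elim/tensW; elim=> [|s Ps t Pt|a t Pt|i j h x y] //.
- by rewrite tclD; apply: PD.
- by rewrite tclZ; apply: PZ.
- exact: Pp.
Qed.

Section Lift.
Variables (n : int) (V : lmodType K).
Variable b : forall i j, i + j = n -> M i -> N j -> V.
Hypothesis b_linl : forall i j (h : i + j = n) y, linear (fun x => b h x y).
Hypothesis b_linr : forall i j (h : i + j = n) x, linear (b h x).
Hypothesis b_bal : forall i p j ip pj (h1 : i + p = ip) (h2 : ip + j = n)
  (h3 : p + j = pj) (h4 : i + pj = n) x r y,
  b h2 (ract M h1 x r) y = b h4 x (lact N h3 r y).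

Fixpoint teval (t : tterm n) : V :=
  match t with
  | TZero => 0
  | TAdd s t => teval s + teval t
  | TScale a t => a *: teval t
  | TPure _ _ h x y => b h x y
  end.

Lemma teval_rel s t : trel s t -> teval s = teval t.
Proof.
elim=> //=; try by move=> *; congruence.
- by move=> *; rewrite addrA.
- by move=> *; rewrite addrC.
- by move=> *; rewrite add0r.
- by move=> *; rewrite scaleN1r addNr.
- by move=> *; rewrite scalerA.
- by move=> *; rewrite scale1r.
- by move=> *; rewrite scalerDr.
- by move=> *; rewrite scalerDl.
- by move=> *; apply: b_linl.
- by move=> *; apply: b_linr.
Qed.

Definition tlift_fun (x : tens n) : V := teval (repr x).

Lemma tlift_cl t : tlift_fun (tcl t) = teval t.
Proof. exact/teval_rel/repr_tcl. Qed.

Lemma tlift_linear : linear tlift_fun.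
Proof.
move=> a; elim/tensW=> s; elim/tensW=> t.
by rewrite -tclZ -tclD !tlift_cl.
Qed.

HB.instance Definition _ :=
  GRing.isLinear.Build K (tens n) V *:%R tlift_fun tlift_linear.

Definition tlift : {linear tens n -> V} := tlift_fun.

Lemma tlift_pure i j (h : i + j = n) x y : tlift (tpure h x y) = b h x y.
Proof. exact: tlift_cl. Qed.

End Lift.

Lemma tpure0l n i j (h : i + j = n) y : tpure h 0 y = 0.
Proof.
by have := tpure_linl h y (-1) 0 0; rewrite scaler0 addr0 scaleN1r addNr.
Qed.
Lemma tpure0r n i j (h : i + j = n) x : tpure h x 0 = 0.
Proof.
by have := tpure_linr h x (-1) 0 0; rewrite scaler0 addr0 scaleN1r addNr.
Qed.
Lemma tpureZl n i j (h : i + j = n) a x y :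
  tpure h (a *: x) y = a *: tpure h x y.
Proof. by have := tpure_linl h y a x 0; rewrite tpure0l !addr0. Qed.
Lemma tpureZr n i j (h : i + j = n) a x y :
  tpure h x (a *: y) = a *: tpure h x y.
Proof. by have := tpure_linr h x a y 0; rewrite tpure0r !addr0. Qed.
Lemma tpureDl n i j (h : i + j = n) x x' y :
  tpure h (x + x') y = tpure h x y + tpure h x' y.
Proof. by have := tpure_linl h y 1 x x'; rewrite !scale1r. Qed.
Lemma tpureDr n i j (h : i + j = n) x y y' :
  tpure h x (y + y') = tpure h x y + tpure h x y'.
Proof. by have := tpure_linr h x 1 y y'; rewrite !scale1r. Qed.

Lemma deg_l (m n i j : int) : m + 1 = n -> i + j = n -> (i - 1) + j = m.
Proof. by lia. Qed.
Lemma deg_r (m n i j : int) : m + 1 = n -> i + j = n -> i + (j - 1) = m.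
Proof. by lia. Qed.

(* d (x (x) y) = dx (x) y + (-1)^|x| x (x) dy *)
Definition tens_d_pure n m (hm : m + 1 = n) i j (h : i + j = n)
    (x : M i) (y : N j) : tens m :=
  tpure (deg_l hm h) (cx_d M (deg_pred i) x) y
  + ksgn K i *: tpure (deg_r hm h) x (cx_d N (deg_pred j) y).

Lemma tens_d_linl n m (hm : m + 1 = n) i j (h : i + j = n) y :
  linear (fun x => tens_d_pure hm h x y).
Proof.
move=> a x x'; rewrite /tens_d_pure linearP !tpureDl !tpureZl.
by rewrite !scalerDr !scalerA (mulrC a) addrACA.
Qed.

Lemma tens_d_linr n m (hm : m + 1 = n) i j (h : i + j = n) x :
  linear (tens_d_pure hm h x).
Proof.
move=> a y y'; rewrite /tens_d_pure linearP !tpureDr !tpureZr.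
by rewrite !scalerDr !scalerA (mulrC a) addrACA.
Qed.

Lemma tens_d_bal n m (hm : m + 1 = n) i p j ip pj (h1 : i + p = ip)
    (h2 : ip + j = n) (h3 : p + j = pj) (h4 : i + pj = n) x r y :
  tens_d_pure hm h2 (ract M h1 x r) y = tens_d_pure hm h4 x (lact N h3 r y).
Proof.
rewrite /tens_d_pure.
have e1 : i - 1 + p = ip - 1 by lia.
have e2 : i + (p - 1) = ip - 1 by lia.
have e3 : p - 1 + j = pj - 1 by lia.
have e4 : p + (j - 1) = pj - 1 by lia.
rewrite (ract_leibniz h1 (deg_pred i) (deg_pred p) (deg_pred ip) e1 e2).
rewrite (lact_leibniz h3 (deg_pred p) (deg_pred j) (deg_pred pj) e3 e4).
rewrite tpureDl tpureDr tpureZl tpureZr scalerDr scalerA -addrA.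
rewrite (tpure_bal e1 _ h3 (deg_l hm h4)).
rewrite (tpure_bal e2 _ e3 (deg_r hm h4)).
rewrite (tpure_bal h1 _ e4 (deg_r hm h4)).
by rewrite -h1 ksgnD.
Qed.

Definition tens_d n m (hm : m + 1 = n) : {linear tens n -> tens m} :=
  tlift (@tens_d_linl n m hm) (@tens_d_linr n m hm) (@tens_d_bal n m hm).

Lemma tens_d_tpure n m (hm : m + 1 = n) i j (h : i + j = n) x y :
  tens_d hm (tpure h x y) = tens_d_pure hm h x y.
Proof. exact: tlift_pure. Qed.

Lemma tens_leibniz i j k i' j' k' (h : i + j = k)
    (hi : i' + 1 = i) (hj : j' + 1 = j) (hk : k' + 1 = k)
    (h1 : i' + j = k') (h2 : i + j' = k') x y :
  tens_d hk (tpure h x y) =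
    tpure h1 (cx_d M hi x) y + ksgn K i *: tpure h2 x (cx_d N hj y).
Proof.
have ei : i' = i - 1 by lia.
have ej : j' = j - 1 by lia.
subst i' j'; rewrite tens_d_tpure /tens_d_pure.
rewrite (eq_irrelevance hi (deg_pred i)) (eq_irrelevance hj (deg_pred j)).
by rewrite (eq_irrelevance h1 (deg_l hk h)) (eq_irrelevance h2 (deg_r hk h)).
Qed.

Lemma tens_dd n m l (hm : m + 1 = n) (hl : l + 1 = m) t :
  tens_d hl (tens_d hm t) = 0.
Proof.
elim/tens_ind: t => [|x y IHx IHy|a x IHx|i j h x y].
- by rewrite !linear0.
- by rewrite !linearD IHx IHy addr0.
- by rewrite !linearZ /= IHx scaler0.
rewrite tens_d_tpure /tens_d_pure linearD linearZ /= !tens_d_tpure.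
rewrite /tens_d_pure !cx_dd tpure0l tpure0r scaler0 add0r addr0.
have -> : ksgn K i = - ksgn K (i - 1) by rewrite ksgnD ksgnN ksgn1 mulrN1 opprK.
rewrite (eq_irrelevance (deg_l _ (deg_r _ _)) (deg_r hl (deg_l hm h))).
by rewrite scaleNr subrr.
Qed.

Definition tens_cx : cplx K := @Cplx K tens tens_d tens_dd.

Section LiftCx.
Variable C : cplx K.
Variable b : forall i j n, i + j = n -> M i -> N j -> C n.
Hypothesis b_linl : forall i j n (h : i + j = n) y, linear (fun x => b h x y).
Hypothesis b_linr : forall i j n (h : i + j = n) x, linear (b h x).
Hypothesis b_bal : forall n i p j ip pj (h1 : i + p = ip) (h2 : ip + j = n)
  (h3 : p + j = pj) (h4 : i + pj = n) x r y,
  b h2 (ract M h1 x r) y = b h4 x (lact N h3 r y).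
Hypothesis b_d : forall i j k i' j' k' (h : i + j = k)
  (hi : i' + 1 = i) (hj : j' + 1 = j) (hk : k' + 1 = k)
  (h1 : i' + j = k') (h2 : i + j' = k') x y,
  cx_d C hk (b h x y) =
    b h1 (cx_d M hi x) y + ksgn K i *: b h2 x (cx_d N hj y).

Definition tens_lift_fun n : {linear tens n -> C n} :=
  tlift (fun i j => @b_linl i j n) (fun i j => @b_linr i j n) (@b_bal n).

Lemma tens_lift_tpure i j n (h : i + j = n) x y :
  tens_lift_fun n (tpure h x y) = b h x y.
Proof. exact: tlift_pure. Qed.

Lemma tens_lift_d i j (h : j + 1 = i) t :
  tens_lift_fun j (tens_d h t) = cx_d C h (tens_lift_fun i t).
Proof.
elim/tens_ind: t => [|x y IHx IHy|a x IHx|p q e x y].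
- by rewrite !linear0.
- by rewrite !linearD IHx IHy.
- by rewrite !linearZ /= IHx.
rewrite tens_d_tpure tens_lift_tpure /tens_d_pure linearD linearZ /=.
by rewrite !tens_lift_tpure (b_d _ (deg_pred _) (deg_pred _) _ (deg_l h e) (deg_r h e)).
Qed.

Definition tens_lift : cmap tens_cx C :=
  @CMap K tens_cx C tens_lift_fun tens_lift_d.

End LiftCx.
End Tensor.

Definition Kflat (K : comPzRingType) (R : dga K) (F : ldgmod R) : Prop :=
  forall A : rdgmod R, acyclic A -> acyclic (tens_cx A F).

Definition Kprojective (K : comPzRingType) (R : dga K) (P : ldgmod R) : Prop :=
  forall A : ldgmod R, acyclic A -> acyclic (hom_cx P A).

Record Kflat_res (K : comPzRingType) (R : dga K) (X : ldgmod R) := KFlatRes {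
  fres_mod :> ldgmod R;
  fres_map : ldg_hom fres_mod X;
  fres_flat : Kflat fres_mod;
  fres_qis : quasi_iso fres_map }.

Record Kproj_res (K : comPzRingType) (R : dga K) (X : ldgmod R) := KProjRes {
  pres_mod :> ldgmod R;
  pres_map : ldg_hom pres_mod X;
  pres_proj : Kprojective pres_mod;
  pres_qis : quasi_iso pres_map }.

(* The canonical maps between derived functors are represented below by maps of
   complexes, computed with the resolutions above.  The derived functors do not
   depend, up to canonical isomorphism, on the resolutions chosen, so a canonical
   map is an isomorphism iff it is represented by a quasi-isomorphism for some
   choice of resolutions. *)
Section CanonicalMaps.
Variables (K : comPzRingType) (R S : dga K) (phi : dga_hom R S).

(* For q : F -> M over R, the map S (x)_R F -> M, s (x) f |-> s q(f).  When q is a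
   K-flat resolution, it represents S (x)^L_R M -> M. *)
Section Action.
Variables (M : ldgmod S) (F : ldgmod R) (q : ldg_hom F (lres phi M)).
Let b i j n (h : i + j = n) (s : S i) (f : F j) : M n := lact M h s (q j f).

Let b_linl i j n (h : i + j = n) f : linear (fun s => b h s f).
Proof. exact: lact_linl. Qed.
Let b_linr i j n (h : i + j = n) s : linear (b h s).
Proof. by move=> a f g; rewrite /b linearP lact_linr. Qed.
Let b_bal n i p j ip pj (h1 : i + p = ip) (h2 : ip + j = n)
    (h3 : p + j = pj) (h4 : i + pj = n) s r f :
  b h2 (ract (rres phi (rregular S)) h1 s r) f = b h4 s (lact F h3 r f).
Proof. by rewrite /b lh_act /= (lactA h1 h2 h3 h4). Qed.
Let b_d i j k i' j' k' (h : i + j = k)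
  (hi : i' + 1 = i) (hj : j' + 1 = j) (hk : k' + 1 = k)
  (h1 : i' + j = k') (h2 : i + j' = k') s f :
  cx_d M hk (b h s f) =
    b h1 (cx_d S hi s) f + ksgn K i *: b h2 s (cx_d F hj f).
Proof. by rewrite /b (lact_leibniz h hi hj hk h1 h2) cm_d. Qed.

Definition action_map : cmap (tens_cx (rres phi (rregular S)) F) M :=
  @tens_lift K R (rres phi (rregular S)) F M b b_linl b_linr b_bal b_d.

Lemma action_map_tpure i j n (h : i + j = n) (s : S i) (f : F j) :
  action_map n (@tpure K R (rres phi (rregular S)) F n i j h s f)
    = lact M h s (q j f).
Proof. exact: tens_lift_tpure. Qed.
End Action.

(* For q : F -> N' over R, the map M (x)_R F -> M (x)_S N', m (x) f |-> m (x) q(f).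
   When N' is a K-flat resolution of N over S and q is a K-flat resolution over R,
   it represents M (x)^L_R N -> M (x)^L_S N. *)
Section BaseChange.
Variables (M : rdgmod S) (N' : ldgmod S) (F : ldgmod R).
Variable q : ldg_hom F (lres phi N').
Let b i j n (h : i + j = n) (m : M i) (f : F j) : tens_cx M N' n :=
  tpure h m (q j f).

Let b_linl i j n (h : i + j = n) f : linear (fun m => b h m f).
Proof. exact: tpure_linl. Qed.
Let b_linr i j n (h : i + j = n) m : linear (b h m).
Proof. by move=> a f g; rewrite /b linearP; apply: tpure_linr. Qed.
Let b_bal n i p j ip pj (h1 : i + p = ip) (h2 : ip + j = n)
    (h3 : p + j = pj) (h4 : i + pj = n) m r f :
  b h2 (ract (rres phi M) h1 m r) f = b h4 m (lact F h3 r f).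
Proof. by rewrite /b lh_act /= (tpure_bal h1 h2 h3 h4). Qed.
Let b_d i j k i' j' k' (h : i + j = k)
  (hi : i' + 1 = i) (hj : j' + 1 = j) (hk : k' + 1 = k)
  (h1 : i' + j = k') (h2 : i + j' = k') m f :
  cx_d (tens_cx M N') hk (b h m f) =
    b h1 (cx_d M hi m) f + ksgn K i *: b h2 m (cx_d F hj f).
Proof. by rewrite /b /= (tens_leibniz h hi hj hk h1 h2) cm_d. Qed.

Definition base_change_map : cmap (tens_cx (rres phi M) F) (tens_cx M N') :=
  @tens_lift K R (rres phi M) F (tens_cx M N') b b_linl b_linr b_bal b_d.

Lemma base_change_map_tpure i j n (h : i + j = n) (m : M i) (f : F j) :
  base_change_map n (@tpure K R (rres phi M) F n i j h m f)
    = tpure h m (q j f).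
Proof. exact: tens_lift_tpure. Qed.
End BaseChange.

(* For q : P -> S over R, the map M -> Hom_R(P, M),
   m |-> (p |-> (-1)^(|m||p|) q(p) m).  When q is a K-projective resolution, it
   represents M -> RHom_R(S, M). *)
Section Unit.
Variables (M : ldgmod S) (P : ldgmod R).
Variable q : ldg_hom P (lres phi (lregular S)).

Definition unit_fun n (m : M n) : ghom P (lres phi M) n.
Proof.
refine (@GHom K R P (lres phi M) n
  (fun i j h p => ksgn K (n * i) *: lact M h (q i p) m) _ _).
- by move=> i j h a x y; rewrite linearP lact_linl scalerDr !scalerA mulrC.
- move=> p i j k l h1 h2 h3 h4 r x /=.
  rewrite (lh_act q h1) /= -(lactA h1 h3 h2 h4) lactZr !scalerA.
  by rewrite -ksgnD -mulrDr -h1.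
Defined.

Lemma unit_linear n : linear (@unit_fun n).
Proof.
move=> a x y; apply: ghomP => i j h p /=.
by rewrite lact_linr scalerDr !scalerA mulrC.
Qed.

HB.instance Definition _ n :=
  GRing.isLinear.Build K (M n) (ghom P (lres phi M) n) *:%R (@unit_fun n)
    (@unit_linear n).

Lemma unit_d i j (h : j + 1 = i) m :
  unit_fun (cx_d M h m) = cx_d (hom_cx P (lres phi M)) h (unit_fun m).
Proof.
apply: ghomP => k l e p /=.
rewrite linearZ /=.
have e1 : k - 1 + i = l by lia.
rewrite (lact_leibniz (deg_up h e) (deg_pred k) h erefl e1 e).
rewrite cm_d (eq_irrelevance (deg_down h e) e1) scalerDr !scalerA.
have -> : ksgn K i * ksgn K (i * (k - 1)) = ksgn K (i * k).
  by rewrite mulrBr mulr1 ksgnD ksgnN mulrCA ksgnK mulr1.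
rewrite addrAC subrr add0r; congr (_ *: _).
by rewrite -[X in ksgn K (X * k) * _]h mulrDl mul1r ksgnD -mulrA ksgnK mulr1.
Qed.

Definition unit_map : cmap M (hom_cx P (lres phi M)) :=
  @CMap K M (hom_cx P (lres phi M)) (fun n => @unit_fun n) unit_d.
End Unit.

(* For q : Q -> P over R, the map Hom_S(P, M') -> Hom_R(Q, M'), f |-> f o q.  When
   P is a K-projective resolution of M over S and q is a K-projective resolution
   over R, it represents RHom_S(M, M') -> RHom_R(M, M'). *)
Section Restrict.
Variables (P M' : ldgmod S) (Q : ldgmod R) (q : ldg_hom Q (lres phi P)).

Definition restrict_fun n (f : ghom P M' n) : ghom Q (lres phi M') n.
Proof.
refine (@GHom K R Q (lres phi M') n (fun i j h x => gh_fun f h (q i x)) _ _).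
- by move=> i j h a x y; rewrite linearP gh_lin.
- move=> p i j k l h1 h2 h3 h4 r x /=.
  by rewrite (lh_act q h1) /= (gh_act f h1 h2 h3 h4).
Defined.

Lemma restrict_linear n : linear (@restrict_fun n).
Proof. by move=> a f g; apply: ghomP. Qed.

HB.instance Definition _ n :=
  GRing.isLinear.Build K (ghom P M' n) (ghom Q (lres phi M') n) *:%R
    (@restrict_fun n) (@restrict_linear n).

Lemma restrict_d i j (h : j + 1 = i) f :
  restrict_fun (cx_d (hom_cx P M') h f) =
    cx_d (hom_cx Q (lres phi M')) h (restrict_fun f).
Proof. by apply: ghomP => k l e x /=; rewrite cm_d. Qed.

Definition restrict_map : cmap (hom_cx P M') (hom_cx Q (lres phi M')) :=
  @CMap K (hom_cx P M') (hom_cx Q (lres phi M')) (fun n => @restrict_fun n)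
    restrict_d.
End Restrict.
End CanonicalMaps.

Definition homotopic (K : comPzRingType) (R : dga K) (M N : ldgmod R)
    (f g : ldg_hom M N) : Prop :=
  exists s : ghom M N 1, forall i j k (hj : j + 1 = i) (hk : i + 1 = k) x,
    f i x - g i x = cx_d N hk (gh_fun s hk x) + gh_fun s hj (cx_d M hj x).

(* The derived category D(R): its objects are the DG left R-modules and its
   morphisms are formal composites of morphisms of DG modules and of formal
   inverses of quasi-isomorphisms, modulo deq, the congruence generated by the
   relations of the homotopy category and by the inverse laws. *)
Inductive dmor (K : comPzRingType) (R : dga K) :
  ldgmod R -> ldgmod R -> Type :=
| DHom M N (f : ldg_hom M N) : dmor M N
| DInv M N (q : ldg_hom M N) (hq : quasi_iso q) : dmor N M
| DComp M N P (g : dmor N P) (f : dmor M N) : dmor M P.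

Inductive deq (K : comPzRingType) (R : dga K) :
  forall M N : ldgmod R, dmor M N -> dmor M N -> Prop :=
| deq_refl M N (f : dmor M N) : deq f f
| deq_sym M N (f g : dmor M N) : deq f g -> deq g f
| deq_trans M N (f g h : dmor M N) : deq f g -> deq g h -> deq f h
| deq_comp M N P (g g' : dmor N P) (f f' : dmor M N) :
    deq g g' -> deq f f' -> deq (DComp g f) (DComp g' f')
| deq_assoc M N P Q (h : dmor P Q) (g : dmor N P) (f : dmor M N) :
    deq (DComp h (DComp g f)) (DComp (DComp h g) f)
| deq_idl M N (f : dmor M N) : deq (DComp (DHom (lh_id N)) f) f
| deq_idr M N (f : dmor M N) : deq (DComp f (DHom (lh_id M))) f
| deq_hom_comp M N P (g : ldg_hom N P) (f : ldg_hom M N) :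
    deq (DHom (lh_comp g f)) (DComp (DHom g) (DHom f))
| deq_homotopic M N (f g : ldg_hom M N) :
    homotopic f g -> deq (DHom f) (DHom g)
| deq_invl M N (q : ldg_hom M N) (hq : quasi_iso q) :
    deq (DComp (DInv hq) (DHom q)) (DHom (lh_id M))
| deq_invr M N (q : ldg_hom M N) (hq : quasi_iso q) :
    deq (DComp (DHom q) (DInv hq)) (DHom (lh_id N)).

Section DerivedRestriction.
Variables (K : comPzRingType) (R S : dga K) (phi : dga_hom R S).

(* The functor D(phi) : D(S) -> D(R) on morphisms. *)
Fixpoint dres (M N : ldgmod S) (f : dmor M N) : dmor (lres phi M) (lres phi N) :=
  match f with
  | DHom _ _ f => DHom (lh_res phi f)
  | DInv M N q hq => @DInv K R (lres phi M) (lres phi N) (lh_res phi q) hq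
  | DComp _ _ _ g f => DComp (dres g) (dres f)
  end.

Lemma homotopic_eq (M N : ldgmod R) (f g : ldg_hom M N) :
  (forall i x, f i x = g i x) -> homotopic f g.
Proof.
move=> fg; exists 0 => i j k hj hk x /=.
by rewrite fg subrr linear0 addr0.
Qed.

Lemma homotopic_res (M N : ldgmod S) (f g : ldg_hom M N) :
  homotopic f g -> homotopic (lh_res phi f) (lh_res phi g).
Proof. by case=> s fg; exists (restrict_fun (lh_id (lres phi M)) s). Qed.

Lemma dres_deq (M N : ldgmod S) (f g : dmor M N) :
  deq f g -> deq (dres f) (dres g).
Proof.
elim=> {M N f g} /=.
- by move=> *; apply: deq_refl.
- by move=> *; apply: deq_sym.
- by move=> M N f g h _ fg _; apply: deq_trans.
- by move=> *; apply: deq_comp.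
- by move=> *; apply: deq_assoc.
- move=> M N f; apply: deq_trans (deq_idl _).
  by apply: deq_comp (deq_refl _); apply/deq_homotopic/homotopic_eq.
- move=> M N f; apply: deq_trans (deq_idr _).
  by apply: deq_comp (deq_refl _) _; apply/deq_homotopic/homotopic_eq.
- move=> M N P g f; apply: deq_trans (deq_hom_comp _ _).
  by apply/deq_homotopic/homotopic_eq.
- by move=> M N f g fg; apply/deq_homotopic/homotopic_res.
- move=> M N q hq; apply: deq_trans (deq_invl _) _.
  by apply/deq_homotopic/homotopic_eq.
- move=> M N q hq; apply: deq_trans (deq_invr _) _.
  by apply/deq_homotopic/homotopic_eq.
Qed.

Definition dres_full : Prop :=
  forall (M N : ldgmod S) (g : dmor (lres phi M) (lres phi N)),
    exists f : dmor M N, deq (dres f) g.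

Definition dres_faithful : Prop :=
  forall (M N : ldgmod S) (f g : dmor M N), deq (dres f) (dres g) -> deq f g.

End DerivedRestriction.

(* Main.v *)
(* Semi-free resolutions are built in one stroke: a generator is a pair (z, w) of a
   cycle z, written in earlier generators, and an element w with d w equal to the
   image of z, and the differential sends it to z.  They are K-projective and K-flat.

   The key point is that if S (x)^L_R S -> S is an isomorphism, then so is
   S (x)^L_R N -> N for every N, without devissage: for a right resolution P -> S over
   R, the map P (x)_R S -> S is a quasi-isomorphism of right S-modules, and it stays
   one after tensoring over S with a K-flat module G, where it becomes
   P (x)_R G -> G.  Since S (x)_R Q is K-projective (K-flat) over S when Q is so over R,
   the maps of (3) and (5) are then obtained by applying M (x)_S - and Hom_S(-, M') to
   the quasi-isomorphism S (x)_R Q -> G.  In the other direction, Hom_R(Q, N) is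
   Hom_S(S (x)_R Q, N), so (4) and (6) say that Hom_S(S, -) and Hom_S(S (x)_R Q, -)
   agree up to homotopy; taking N = S (x)_R Q and N = S, as in the Yoneda lemma, gives
   a homotopy inverse of S (x)_R Q -> S. *)
Set Warnings "-notation-overridden,-ambiguous-paths".
Set Warnings "-projection-no-head-constant".
From HB Require Import structures.
From mathcomp Require Import all_boot all_order all_algebra.
From mathcomp Require Import boolp.
From mathcomp Require Import zify ring.
Require Import Defs.

Set Warnings "-redundant-canonical-projection".
Set Implicit Arguments.
Unset Strict Implicit.
Unset Printing Implicit Defensive.

Import GRing.Theory.
Local Open Scope ring_scope.
Local Open Scope quotient_scope.

(** * Complexes and quasi-isomorphisms *)

(** Three obstacles shape the development. Whether a generator is admissible depends on the
    differential, which exists only once all generators do; so the free module is built on raw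
    generators, where [fd] need not square to zero, and the valid elements are cut out afterwards. A
    generator contains its own boundary as a term, so structural induction takes the place of a
    filtration and its colimit.

    The conditions only assert that some resolution works. The passage from (1) to (2), (3), (4) and
    (5) therefore goes through [action_always_qi], valid for all K-flat resolutions at once, since
    the resolutions met later are of modules that are themselves resolutions. Right modules are
    resolved over the opposite algebra, because the semi-free construction is carried out on the
    left.

    The derived category is given by generators and relations, so equality in it is easy to prove
    but hard to exploit. The invariant that recovers a homotopy from it is the relation induced on
    homotopy classes of maps out of a K-projective module. *)

Section Complexes.
Variable K : comPzRingType.
Implicit Types C D E : cplx K.

Lemma cx_d_irr C i j (h h' : j + 1 = i) (x : C i) : cx_d C h x = cx_d C h' x.
Proof. by rewrite (eq_irrelevance h h'). Qed.

Lemma boundary_d C i j (h : j + 1 = i) (x : C i) : boundary (cx_d C h x).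
Proof. by exists i, h, x. Qed.

Lemma boundary0 C i : boundary (0 : C i).
Proof. by exists (i + 1), erefl, 0; rewrite linear0. Qed.

Lemma boundaryD C i (x y : C i) : boundary x -> boundary y -> boundary (x + y).
Proof.
move=> [k [h [u <-]]] [k' [h' [v <-]]]; subst k k'.
by exists (i + 1), erefl, (u + v); rewrite linearD.
Qed.

Lemma boundaryZ C i a (x : C i) : boundary x -> boundary (a *: x).
Proof. by move=> [k [h [u <-]]]; exists k, h, (a *: u); rewrite linearZ. Qed.

Lemma boundaryN C i (x : C i) : boundary x -> boundary (- x).
Proof. by rewrite -scaleN1r; apply: boundaryZ. Qed.

Lemma boundaryB C i (x y : C i) : boundary x -> boundary y -> boundary (x - y).
Proof. by move=> bx by_; apply: boundaryD => //; apply: boundaryN. Qed.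

Lemma boundary_cycle C i (x : C i) : boundary x -> cycle x.
Proof. by move=> [k [h [u <-]]] j h'; apply: cx_dd. Qed.

Lemma cycle_d C i j (h : j + 1 = i) (x : C i) : cx_d C h x = 0 -> cycle x.
Proof.
move=> dx j' h'; have e : j = j' by lia.
by subst j'; rewrite (cx_d_irr h' h).
Qed.

Lemma cycleB C i (x y : C i) : cycle x -> cycle y -> cycle (x - y).
Proof. by move=> cx cy j h; rewrite linearB /= cx cy subr0. Qed.

Lemma cycle_map C D (f : cmap C D) i (x : C i) : cycle x -> cycle (f i x).
Proof. by move=> cx j h; rewrite -cm_d cx linear0. Qed.

Lemma boundary_map C D (f : cmap C D) i (x : C i) :
  boundary x -> boundary (f i x).
Proof. by move=> [k [h [u <-]]]; exists k, h, (f k u); rewrite cm_d. Qed.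

Lemma qi_inj C D (f : cmap C D) i (x : C i) :
  quasi_iso f -> cycle x -> boundary (f i x) -> boundary x.
Proof. by move=> /(_ i) [inj _]; apply: inj. Qed.

Lemma qi_surj C D (f : cmap C D) i (y : D i) :
  quasi_iso f -> cycle y -> exists x : C i, cycle x /\ boundary (f i x - y).
Proof. by move=> /(_ i) [_ surj]; apply: surj. Qed.

Lemma qi_ext C D (f g : cmap C D) :
  (forall i x, f i x = g i x) -> quasi_iso f -> quasi_iso g.
Proof.
move=> fg qf i; split=> [x cx|y cy].
  by rewrite -fg; apply: qi_inj.
by have [x [cx bx]] := qi_surj qf cy; exists x; rewrite -fg.
Qed.

(** Together with the two cancellation lemmas below, this is two-out-of-three: later squares of
    comparison maps carry a quasi-isomorphism from one side to the opposite one. *)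
Lemma qi_comp C D E (g : cmap D E) (f : cmap C D) :
  quasi_iso g -> quasi_iso f -> quasi_iso (cmap_comp g f).
Proof.
move=> qg qf i; split=> [x cx /= b|z cz].
  by apply: (qi_inj qf cx); apply: (qi_inj qg) => //; apply: cycle_map.
have [y [cy by_]] := qi_surj qg cz; have [x [cx bx]] := qi_surj qf cy.
exists x; split=> //=.
have -> : g i (f i x) - z = g i (f i x - y) + (g i y - z).
  by rewrite linearB addrA subrK.
by apply: boundaryD => //; apply: boundary_map.
Qed.

Lemma qi_cancel_l C D E (g : cmap D E) (f : cmap C D) :
  quasi_iso g -> quasi_iso (cmap_comp g f) -> quasi_iso f.
Proof.
move=> qg qgf i; split=> [x cx b|y cy].
  by apply: (qi_inj qgf cx); apply: (boundary_map g b).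
have [x [cx bx]] := qi_surj qgf (cycle_map g cy).
exists x; split=> //; apply: (qi_inj qg).
  by apply: cycleB => //; apply: cycle_map.
by rewrite linearB.
Qed.

Lemma qi_cancel_r C D E (g : cmap D E) (f : cmap C D) :
  quasi_iso f -> quasi_iso (cmap_comp g f) -> quasi_iso g.
Proof.
move=> qf qgf i; split=> [y cy b|z cz].
  have [x [cx bx]] := qi_surj qf cy.
  have {}bx' : boundary (f i x).
    apply: boundary_map; apply: (qi_inj qgf cx) => /=.
    by rewrite /= -[f i x](subrK y) linearD; apply: boundaryD b; apply: boundary_map.
  by rewrite -[y](subKr (f i x)); apply: boundaryB.
have [x [cx bx]] := qi_surj qgf cz.
by exists (f i x); split=> //; apply: cycle_map.
Qed.

(* Mutually inverse isomorphisms on homology, where [g] need not be given as a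
   chain map. *)
Lemma qi_inverse C D (f : cmap C D) (g : forall i, D i -> C i) :
  (forall i x y, g i (x - y) = g i x - g i y) ->
  (forall i (y : D i), cycle y -> cycle (g i y)) ->
  (forall i (y : D i), boundary y -> boundary (g i y)) ->
  (forall i (x : C i), cycle x -> boundary (g i (f i x) - x)) ->
  (forall i (y : D i), cycle y -> boundary (f i (g i y) - y)) ->
  quasi_iso f.
Proof.
move=> gB gc gb gf fg i; split=> [x cx b|y cy].
  by rewrite -[x](subKr (g i (f i x))); apply: boundaryB; auto.
by exists (g i y); auto.
Qed.

(** The inverse is a bare family of functions; that it respects differentials is deduced from [f] by
    injectivity. This suits inverses out of tensor products, which are built degree by degree. *)
Lemma qi_iso C D (f : cmap C D) (g : forall i, D i -> C i) :
  (forall i, cancel (f i) (g i)) -> (forall i, cancel (g i) (f i)) -> quasi_iso f.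
Proof.
move=> gf fg i; split=> [x cx [k [h [y dy]]]|y cy].
  exists k, h, (g k y); apply: (can_inj (gf i)).
  by rewrite cm_d fg dy.
exists (g i y); rewrite fg subrr; split; last exact: boundary0.
by move=> j h; apply: (can_inj (gf j)); rewrite cm_d fg cy linear0.
Qed.

(* [iC], [iD], [pC], [pD] exhibit [E] as the mapping cone of [f], with [C]
   shifted up by one. *)
Section ConeChase.
Variables (C D E : cplx K) (f : cmap C D).
Variable iC : forall i j, i + 1 = j -> C i -> E j.
Variable iD : forall i, {linear D i -> E i}.
Variable pC : forall i j, i + 1 = j -> {linear E j -> C i}.
Variable pD : forall i, {linear E i -> D i}.
Hypothesis d_iC : forall i j k (hj : i + 1 = j) (hk : k + 1 = i) x,
  cx_d E hj (iC hj x) = iD i (f i x) - iC hk (cx_d C hk x).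
Hypothesis iC0 : forall i j (h : i + 1 = j), iC h 0 = 0.
Hypothesis d_iD : forall i j (h : j + 1 = i) x,
  cx_d E h (iD i x) = iD j (cx_d D h x).
Hypothesis d_pC : forall i j k (hj : i + 1 = j) (hk : k + 1 = i) x,
  pC hk (cx_d E hj x) = - cx_d C hk (pC hj x).
Hypothesis d_pD : forall i j (h : j + 1 = i) x,
  pD j (cx_d E h x) = cx_d D h (pD i x) + f j (pC h x).
Hypothesis pCiC : forall i j (h : i + 1 = j) x, pC h (iC h x) = x.
Hypothesis pCiD : forall i j (h : i + 1 = j) x, pC h (iD j x) = 0.
Hypothesis pDiD : forall i x, pD i (iD i x) = x.

(** If [f x = d y], then [(x, - y)] is a cycle of the cone, and the first component of a primitive
    bounds [x] up to sign. For a cycle [y], the first component of a primitive of [(0, y)] is a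
    cycle that [f] sends to the class of [y]. Only identities between inclusions and projections
    enter, so the argument survives a tensor or Hom functor, after which the complex is no longer
    literally a cone. *)
Lemma cone_chase : acyclic E -> quasi_iso f.
Proof.
move=> aE i; split=> [x cx [k [h [y dy]]]|y cy].
  have hk : i - 1 + 1 = i by lia.
  have ce : cycle (iC h x - iD k y).
    apply: (@cycle_d _ _ _ h).
    by rewrite linearB /= (d_iC h hk) d_iD (cx _ hk) iC0 dy subr0 subrr.
  have [l [hl [z dz]]] := aE _ _ ce.
  exists k, h, (- pC hl z).
  by rewrite linearN /= -(d_pC hl h) dz linearB /= pCiC pCiD subr0.
have [l [hl [z dz]]] : boundary (iD i y).
  by apply: aE => j h; rewrite d_iD cy linear0.
exists (pC hl z); split.
  by move=> j h; apply/eqP; rewrite -oppr_eq0 -(d_pC hl h) dz pCiD.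
rewrite -opprB; apply: boundaryN; exists l, hl, (pD l z).
have := d_pD hl z; rewrite dz pDiD => ->.
by rewrite addrK.
Qed.
End ConeChase.

(* The degree shift in a cone forces transports such as [C (i + 1 - 1) -> C i]. *)
Definition cxcast C i j (e : i = j) (x : C i) : C j :=
  eq_rect i (fun k => cx_deg C k) x j e.

Lemma cxcast_id C i (e : i = i) (x : C i) : cxcast e x = x.
Proof. by rewrite (eq_irrelevance e erefl). Qed.

Lemma cxcast_irr C i j (e e' : i = j) (x : C i) : cxcast e x = cxcast e' x.
Proof. by rewrite (eq_irrelevance e e'). Qed.

Lemma cxcastP C i j (e : i = j) a (x y : C i) :
  cxcast e (a *: x + y) = a *: cxcast e x + cxcast e y.
Proof. by case: j / e. Qed.

Lemma cxcastZ C i j (e : i = j) a (x : C i) :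
  cxcast e (a *: x) = a *: cxcast e x.
Proof. by case: j / e. Qed.

Lemma cxcast_d C i j i' j' (e : i = i') (e' : j = j') (h : j + 1 = i)
    (h' : j' + 1 = i') (x : C i) :
  cx_d C h' (cxcast e x) = cxcast e' (cx_d C h x).
Proof. by subst i' j'; rewrite !cxcast_id (cx_d_irr h' h). Qed.

Lemma cxcast_map C D (f : cmap C D) i j (e : i = j) x :
  f j (cxcast e x) = cxcast e (f i x).
Proof. by case: j / e. Qed.

Lemma cxcast_comp C i j k (e : i = j) (e' : j = k) (x : C i) :
  cxcast e' (cxcast e x) = cxcast (etrans e e') x.
Proof. by subst k j. Qed.
HB.instance Definition _ C i j (e : i = j) :=
  GRing.isLinear.Build K (C i) (C j) *:%R (@cxcast C i j e) (cxcastP e).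

End Complexes.

(** * Semi-free resolutions *)

Section Bilinearity.
Variables (K : comPzRingType) (R : dga K).

Lemma lactDl (L : ldgmod R) i j k (h : i + j = k) r s x :
  lact L h (r + s) x = lact L h r x + lact L h s x.
Proof. by have := lact_linl h x 1 r s; rewrite !scale1r. Qed.

Lemma dmul0r i j k (h : i + j = k) (r : R i) : dga_mul R h r 0 = 0.
Proof. exact: (lact0r (lregular R)). Qed.
Lemma dmul0l i j k (h : i + j = k) (r : R j) : dga_mul R h 0 r = 0.
Proof. exact: (lact0l (L := lregular R)). Qed.
Lemma dmulDr i j k (h : i + j = k) (r : R i) s t :
  dga_mul R h r (s + t) = dga_mul R h r s + dga_mul R h r t.
Proof. exact: (lactDr (L := lregular R)). Qed.
Lemma dmulZr i j k (h : i + j = k) a (r : R i) s :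
  dga_mul R h r (a *: s) = a *: dga_mul R h r s.
Proof. exact: (lactZr (L := lregular R)). Qed.
Lemma dmulBr i j k (h : i + j = k) (r : R i) s t :
  dga_mul R h r (s - t) = dga_mul R h r s - dga_mul R h r t.
Proof. exact: (lactBr (L := lregular R)). Qed.
Lemma dmulDl i j k (h : i + j = k) (r s : R i) t :
  dga_mul R h (r + s) t = dga_mul R h r t + dga_mul R h s t.
Proof. exact: (lactDl (L := lregular R)). Qed.
Lemma dmulZl i j k (h : i + j = k) a (r : R i) s :
  dga_mul R h (a *: r) s = a *: dga_mul R h r s.
Proof. exact: (lactZl (L := lregular R)). Qed.

Lemma ract0l (L : rdgmod R) i j k (h : i + j = k) r : ract L h 0 r = 0.
Proof.
by have := ract_linl h r (-1) (0 : L i) 0; rewrite scaler0 addr0 scaleN1r addNr.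
Qed.
Lemma ract0r (L : rdgmod R) i j k (h : i + j = k) (x : L i) : ract L h x 0 = 0.
Proof.
by have := ract_linr h x (-1) (0 : R j) 0; rewrite scaler0 addr0 scaleN1r addNr.
Qed.
Lemma ractDl (L : rdgmod R) i j k (h : i + j = k) (x y : L i) r :
  ract L h (x + y) r = ract L h x r + ract L h y r.
Proof. by have := ract_linl h r 1 x y; rewrite !scale1r. Qed.
Lemma ractZl (L : rdgmod R) i j k (h : i + j = k) a (x : L i) r :
  ract L h (a *: x) r = a *: ract L h x r.
Proof. by have := ract_linl h r a x 0; rewrite ract0l !addr0. Qed.
Lemma ractNl (L : rdgmod R) i j k (h : i + j = k) (x : L i) r :
  ract L h (- x) r = - ract L h x r.
Proof. by rewrite -scaleN1r ractZl scaleN1r. Qed.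
Lemma lactNr (L : ldgmod R) i j k (h : i + j = k) r (x : L j) :
  lact L h r (- x) = - lact L h r x.
Proof. by rewrite -scaleN1r lactZr scaleN1r. Qed.
Lemma ractZr (L : rdgmod R) i j k (h : i + j = k) a (x : L i) r :
  ract L h x (a *: r) = a *: ract L h x r.
Proof. by have := ract_linr h x a r 0; rewrite ract0r !addr0. Qed.

End Bilinearity.

Section Resolution.
Variables (K : comPzRingType) (R : dga K) (X : ldgmod R).

(** Raw data: nothing here says that [z] is a cycle or that [w] bounds its image. The nesting of the
    two types performs at once all the stages in which new generators kill cycles of the preceding
    stage. *)
Inductive gen (n : int) : Type :=
| Gen (z : term (n - 1)) (w : X n)
with term (n : int) : Type :=
| TmZero
| TmAdd (s t : term n)
| TmScale (a : K) (t : term n)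
| TmGen p q (h : p + q = n) (r : R p) (g : gen q).
Arguments TmZero {n}.

Scheme gen_mut := Induction for gen Sort Prop
with term_mut := Induction for term Sort Prop.
Combined Scheme gen_term_ind from gen_mut, term_mut.

Lemma tm_ind n (Q : term n -> Prop) :
  Q TmZero -> (forall s t, Q s -> Q t -> Q (TmAdd s t)) ->
  (forall a t, Q t -> Q (TmScale a t)) ->
  (forall p q (h : p + q = n) r g, Q (TmGen h r g)) -> forall t, Q t.
Proof.
move=> Q0 QD QZ Qg; fix IH 1; case=> [|s t|a t|p q h r g].
- exact: Q0.
- exact: (QD _ _ (IH s) (IH t)).
- exact: (QZ _ _ (IH t)).
- exact: Qg.
Qed.

Section Eval.
Variables (n : int) (V : lmodType K).
Variable b : forall p q, p + q = n -> R p -> gen q -> V.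

Fixpoint tmeval (t : term n) : V :=
  match t with
  | TmZero => 0
  | TmAdd s t => tmeval s + tmeval t
  | TmScale a t => a *: tmeval t
  | TmGen p q h r g => b h r g
  end.
End Eval.

Definition tmlin n (V : lmodType K)
    (b : forall p q, p + q = n -> R p -> gen q -> V) : Prop :=
  forall p q (h : p + q = n) g, linear (fun r => b p q h r g).

(* The quotient by [tmeq] is the free graded R-module on the generators: equality
   is defined by the universal property. *)
Definition tmeq n (s t : term n) : Prop :=
  forall (V : lmodType K) (b : forall p q, p + q = n -> R p -> gen q -> V),
    tmlin b -> tmeval b s = tmeval b t.

HB.instance Definition _ n := gen_eqMixin (term n).
HB.instance Definition _ n := gen_choiceMixin (term n).

Definition tmeqb n : rel (term n) := fun s t => `[< tmeq s t >].

Lemma tmeqb_refl n : reflexive (@tmeqb n).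
Proof. by move=> t; apply/asboolP. Qed.
Lemma tmeqb_sym n : symmetric (@tmeqb n).
Proof.
by move=> s t; apply/asboolP/asboolP => e V b bl; rewrite (e V b bl).
Qed.
Lemma tmeqb_trans n : transitive (@tmeqb n).
Proof.
move=> t s u /asboolP st /asboolP tu; apply/asboolP => V b bl.
by rewrite (st V b bl) (tu V b bl).
Qed.

Canonical tmeq_equiv n :=
  EquivRel (@tmeqb n) (@tmeqb_refl n) (@tmeqb_sym n) (@tmeqb_trans n).

Definition free n := {eq_quot (tmeq_equiv n)}.
HB.instance Definition _ n := Choice.on (free n).
HB.instance Definition _ n := EqQuotient.on (free n).

Definition fcl n (t : term n) : free n := \pi_(free n) t.

Lemma fclP n (s t : term n) : tmeq s t <-> fcl s = fcl t.
Proof.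
split=> [st|/eqmodP/asboolP //].
by apply/eqmodP/asboolP.
Qed.

Lemma fclK n (x : free n) : fcl (repr x) = x.
Proof. exact: reprK. Qed.

Lemma freeW n (Q : free n -> Prop) : (forall t, Q (fcl t)) -> forall x, Q x.
Proof. by move=> Qt x; rewrite -(fclK x). Qed.

Lemma repr_fcl n (t : term n) : tmeq (repr (fcl t)) t.
Proof. by apply/fclP; rewrite fclK. Qed.

Definition free_add n (x y : free n) : free n := fcl (TmAdd (repr x) (repr y)).
Definition free_scale n a (x : free n) : free n := fcl (TmScale a (repr x)).

Lemma fcl_add n (s t : term n) : fcl (TmAdd s t) = free_add (fcl s) (fcl t).
Proof. by apply/fclP => V b bl /=; rewrite !(repr_fcl _ bl). Qed.
Lemma fcl_scale n a (t : term n) : fcl (TmScale a t) = free_scale a (fcl t).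
Proof. by apply/fclP => V b bl /=; rewrite !(repr_fcl _ bl). Qed.

Lemma free_addA n : associative (@free_add n).
Proof.
elim/freeW=> s; elim/freeW=> t; elim/freeW=> u; rewrite -!fcl_add.
by apply/fclP => V b bl /=; rewrite addrA.
Qed.
Lemma free_addC n : commutative (@free_add n).
Proof.
elim/freeW=> s; elim/freeW=> t; rewrite -!fcl_add.
by apply/fclP => V b bl /=; rewrite addrC.
Qed.
Lemma free_add0 n : left_id (fcl TmZero) (@free_add n).
Proof.
by elim/freeW=> s; rewrite -fcl_add; apply/fclP => V b bl /=; rewrite add0r.
Qed.
Lemma free_addN n :
  left_inverse (fcl TmZero) (@free_scale n (-1)) (@free_add n).
Proof.
elim/freeW=> s; rewrite -fcl_scale -fcl_add.
by apply/fclP => V b bl /=; rewrite scaleN1r addNr.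
Qed.

HB.instance Definition _ n := GRing.isZmodule.Build (free n)
  (@free_addA n) (@free_addC n) (@free_add0 n) (@free_addN n).

Lemma free_scaleA n a b (x : free n) :
  free_scale a (free_scale b x) = free_scale (a * b) x.
Proof.
elim/freeW: x => t; rewrite -!fcl_scale.
by apply/fclP => V c cl /=; rewrite scalerA.
Qed.
Lemma free_scale1 n : left_id 1 (@free_scale n).
Proof.
by elim/freeW=> t; rewrite -fcl_scale; apply/fclP => V b bl /=; rewrite scale1r.
Qed.
Lemma free_scaleDr n : right_distributive (@free_scale n) +%R.
Proof.
move=> a; elim/freeW=> s; elim/freeW=> t.
rewrite /+%R /= -fcl_add -!fcl_scale -fcl_add.
by apply/fclP => V b bl /=; rewrite scalerDr.
Qed.
Lemma free_scaleDl n (x : free n) :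
  {morph (@free_scale n)^~ x : a b / a + b >-> a + b}.
Proof.
elim/freeW: x => t a b.
rewrite -!fcl_scale [RHS]/+%R /= -fcl_add.
by apply/fclP => V c cl /=; rewrite scalerDl.
Qed.

HB.instance Definition _ n := GRing.Zmodule_isLmodule.Build K (free n)
  (@free_scaleA n) (@free_scale1 n) (@free_scaleDr n) (@free_scaleDl n).

Lemma fclD n (s t : term n) : fcl (TmAdd s t) = fcl s + fcl t.
Proof. exact: fcl_add. Qed.
Lemma fclZ n a (t : term n) : fcl (TmScale a t) = a *: fcl t.
Proof. exact: fcl_scale. Qed.

Definition fgen n p q (h : p + q = n) (r : R p) (g : gen q) : free n :=
  fcl (TmGen h r g).

Lemma fgen_lin n p q (h : p + q = n) g : linear (fun r => fgen h r g).
Proof.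
move=> a r s; rewrite /fgen -fclZ -fclD.
by apply/fclP => V b bl /=; apply: bl.
Qed.
Lemma fgen0 n p q (h : p + q = n) g : fgen h 0 g = 0.
Proof.
by have := fgen_lin h g (-1) 0 0; rewrite scaler0 addr0 scaleN1r addNr.
Qed.
Lemma fgenZ n p q (h : p + q = n) a r g : fgen h (a *: r) g = a *: fgen h r g.
Proof. by have := fgen_lin h g a r 0; rewrite fgen0 !addr0. Qed.
Lemma fgenD n p q (h : p + q = n) r s g :
  fgen h (r + s) g = fgen h r g + fgen h s g.
Proof. by have := fgen_lin h g 1 r s; rewrite !scale1r. Qed.

Lemma free_ind n (Q : free n -> Prop) :
  Q 0 -> (forall x y, Q x -> Q y -> Q (x + y)) ->
  (forall a x, Q x -> Q (a *: x)) ->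
  (forall p q (h : p + q = n) r g, Q (fgen h r g)) -> forall x, Q x.
Proof.
move=> Q0 QD QZ Qg; elim/freeW; elim/tm_ind=> [|s t Qs Qt|a t Qt|p q h r g] //.
- by rewrite fclD; apply: QD.
- by rewrite fclZ; apply: QZ.
- exact: Qg.
Qed.

Section Lift.
Variables (n : int) (V : lmodType K).
Variable b : forall p q, p + q = n -> R p -> gen q -> V.
Hypothesis bl : tmlin b.

Definition flift_fun (x : free n) : V := tmeval b (repr x).

Lemma flift_cl t : flift_fun (fcl t) = tmeval b t.
Proof. exact: repr_fcl. Qed.

Lemma flift_linear : linear flift_fun.
Proof.
move=> a; elim/freeW=> s; elim/freeW=> t.
by rewrite -fclZ -fclD !flift_cl.
Qed.

HB.instance Definition _ :=
  GRing.isLinear.Build K (free n) V *:%R flift_fun flift_linear.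

Definition flift : {linear free n -> V} := flift_fun.

Lemma flift_gen p q (h : p + q = n) r g : flift (fgen h r g) = b h r g.
Proof. exact: flift_cl. Qed.
End Lift.

Section Action.
Variables (p n k : int) (h : p + n = k) (r : R p).
Definition fact_deg p' q (e : p' + q = n) : p + p' + q = k.
Proof. by rewrite -addrA e. Qed.
Definition fact_b p' q (e : p' + q = n) (r' : R p') (g : gen q) : free k :=
  fgen (fact_deg e) (dga_mul R erefl r r') g.
Lemma fact_lin : tmlin fact_b.
Proof.
by move=> p' q e g a s t; rewrite /fact_b dmulDr dmulZr fgenD fgenZ.
Qed.
Definition fact : {linear free n -> free k} := flift fact_lin.

Lemma fact_gen p' q s (e : p' + q = n) (r' : R p') (g : gen q)
    (hs : p + p' = s) (e' : s + q = k) :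
  fact (fgen e r' g) = fgen e' (dga_mul R hs r r') g.
Proof.
by subst s; rewrite /fact flift_gen /fact_b (eq_irrelevance (fact_deg e) e').
Qed.
End Action.

Lemma fact_linl p n k (h : p + n = k) x : linear (fun r => fact h r x).
Proof.
move=> a r s; elim/free_ind: x => [|x y IHx IHy|c x IHx|p' q e r' g].
- by rewrite !linear0 addr0.
- by rewrite !linearD IHx IHy addrACA.
- by rewrite !linearZ /= IHx scalerDr !scalerA mulrC.
have e' : p + p' + q = k by lia.
by rewrite !(fact_gen _ _ _ _ _ erefl e') dmulDl dmulZl fgenD fgenZ.
Qed.

Lemma factA a b c ab bc abc (h1 : a + b = ab) (h2 : ab + c = abc)
    (h3 : b + c = bc) (h4 : a + bc = abc) r s x :
  fact h4 r (fact h3 s x) = fact h2 (dga_mul R h1 r s) x.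
Proof.
elim/free_ind: x => [|x y IHx IHy|t x IHx|p' q e r' g].
- by rewrite !linear0.
- by rewrite !linearD IHx IHy.
- by rewrite !linearZ /= IHx.
have e1 : b + p' + q = bc by lia.
have e2 : a + b + p' + q = abc by lia.
have e3 : a + (b + p') = a + b + p' by lia.
have e4 : ab + p' = a + b + p' by lia.
rewrite (fact_gen _ _ _ _ _ erefl e1) (fact_gen _ _ _ _ _ e3 e2).
by rewrite (fact_gen _ _ _ _ _ e4 e2) (dga_mulA h1 e4).
Qed.

Lemma fact1 i (h : 0 + i = i) x : fact h (dga_one R) x = x.
Proof.
elim/free_ind: x => [|x y IHx IHy|t x IHx|p' q e r' g].
- by rewrite !linear0.
- by rewrite !linearD IHx IHy.
- by rewrite !linearZ /= IHx.
by rewrite (fact_gen _ _ _ _ _ (add0r p') e) dga_mul1l.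
Qed.

Definition gbd q (g : gen q) : free (q - 1) := let: Gen z _ := g in fcl z.
Definition gval q (g : gen q) : X q := let: Gen _ w := g in w.

Section Differential.
Variables (n m : int) (h : m + 1 = n).
Lemma fd_deg1 p q (e : p + q = n) : p - 1 + q = m. Proof. by lia. Qed.
Lemma fd_deg2 p q (e : p + q = n) : p + (q - 1) = m. Proof. by lia. Qed.
Definition fd_b p q (e : p + q = n) (r : R p) (g : gen q) : free m :=
  fgen (fd_deg1 e) (cx_d R (deg_pred p) r) g
  + ksgn K p *: fact (fd_deg2 e) r (gbd g).
Lemma fd_lin : tmlin fd_b.
Proof.
move=> p q e g a r s; rewrite /fd_b linearP fact_linl fgenD fgenZ.
by rewrite !scalerDr !scalerA (mulrC a) addrACA.
Qed.
Definition fd : {linear free n -> free m} := flift fd_lin.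

Lemma fd_gen p q p' (e : p + q = n) (r : R p) (g : gen q) (hp : p' + 1 = p)
    (e1 : p' + q = m) (e2 : p + (q - 1) = m) :
  fd (fgen e r g) = fgen e1 (cx_d R hp r) g + ksgn K p *: fact e2 r (gbd g).
Proof.
have ep : p' = p - 1 by lia.
subst p'; rewrite /fd flift_gen /fd_b (eq_irrelevance (fd_deg1 e) e1).
by rewrite (eq_irrelevance (fd_deg2 e) e2) (cx_d_irr hp (deg_pred p)).
Qed.
End Differential.

Lemma fd_leibniz i j k i' j' k' (h : i + j = k)
    (hi : i' + 1 = i) (hj : j' + 1 = j) (hk : k' + 1 = k)
    (h1 : i' + j = k') (h2 : i + j' = k') r x :
  fd hk (fact h r x) =
    fact h1 (cx_d R hi r) x + ksgn K i *: fact h2 r (fd hj x).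
Proof.
elim/free_ind: x => [|x y IHx IHy|t x IHx|p q e s g].
- by rewrite !linear0 addr0.
- by rewrite !linearD IHx IHy addrACA.
- by rewrite !linearZ /= IHx !scalerDr !scalerA mulrC.
have e1 : i + p + q = k by lia.
have e2 : p - 1 + q = j' by lia.
have e3 : p + (q - 1) = j' by lia.
have e4 : i' + p + q = k' by lia.
have e5 : i + p + (q - 1) = k' by lia.
have e6 : i' + p + 1 = i + p by lia.
have e7 : i + (p - 1) = i' + p by lia.
rewrite (fact_gen _ _ _ _ _ erefl e1) (fd_gen _ _ _ _ e6 e4 e5).
rewrite (dga_leibniz erefl hi (deg_pred p) e6 erefl e7).
rewrite (fact_gen _ _ _ _ _ erefl e4) (fd_gen _ _ _ _ (deg_pred p) e2 e3).
rewrite linearD linearZ /= (fact_gen _ _ _ _ _ e7 e4) (factA erefl e5).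
by rewrite fgenD fgenZ scalerDr scalerA -ksgnD addrA.
Qed.

Definition ff_b n p q (h : p + q = n) (r : R p) (g : gen q) : X n :=
  lact X h r (gval g).
Lemma ff_lin n : tmlin (@ff_b n).
Proof. by move=> p q h g; apply: lact_linl. Qed.
Definition ff n : {linear free n -> X n} := flift (@ff_lin n).

Lemma ff_gen n p q (h : p + q = n) r g :
  ff n (fgen h r g) = lact X h r (gval g).
Proof. exact: flift_gen. Qed.

Lemma ff_act p n k (h : p + n = k) r x : ff k (fact h r x) = lact X h r (ff n x).
Proof.
elim/free_ind: x => [|x y IHx IHy|t x IHx|p' q e r' g].
- by rewrite !linear0 lact0r.
- by rewrite !linearD lactDr IHx IHy.
- by rewrite !linearZ /= lactZr IHx.
have e' : p + p' + q = k by lia.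
by rewrite (fact_gen _ _ _ _ _ erefl e') !ff_gen (lactA erefl e').
Qed.

(* The resolution is free on the generators [Gen z w], with [d (Gen z w) = z] and
   [Gen z w |-> w], that keep [d o d = 0] and the map to [X] a chain map. *)
Fixpoint valid_gen n (g : gen n) : Prop :=
  match g with
  | Gen z w =>
      [/\ valid_term z, forall m (h : m + 1 = n - 1), fd h (fcl z) = 0
        & forall h : n - 1 + 1 = n, ff (n - 1) (fcl z) = cx_d X h w]
  end
with valid_term n (t : term n) : Prop :=
  match t with
  | TmZero => True
  | TmAdd s t => valid_term s /\ valid_term t
  | TmScale a t => valid_term t
  | TmGen _ _ _ _ g => valid_gen g
  end.

(** Validity of terms is not invariant under [tmeq]: an invalid generator may occur with coefficient
    0. Hence the existential quantifier over representatives. *)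
Definition valid n (x : free n) : Prop := exists t, valid_term t /\ fcl t = x.

Lemma valid0 n : valid (0 : free n).
Proof. by exists TmZero. Qed.
Lemma validD n (x y : free n) : valid x -> valid y -> valid (x + y).
Proof.
by move=> [s [vs <-]] [t [vt <-]]; exists (TmAdd s t); rewrite fclD.
Qed.
Lemma validZ n a (x : free n) : valid x -> valid (a *: x).
Proof. by move=> [s [vs <-]]; exists (TmScale a s); rewrite fclZ. Qed.
Lemma valid_fgen n p q (h : p + q = n) r g : valid_gen g -> valid (fgen h r g).
Proof. by exists (TmGen h r g). Qed.

Lemma valid_ind n (Q : free n -> Prop) :
  Q 0 -> (forall x y, Q x -> Q y -> Q (x + y)) ->
  (forall a x, Q x -> Q (a *: x)) ->
  (forall p q (h : p + q = n) r g, valid_gen g -> Q (fgen h r g)) ->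
  forall x, valid x -> Q x.
Proof.
move=> Q0 QD QZ Qg x [t [vt <-]].
elim/tm_ind: t vt => [|s t Qs Qt|a t Qt|p q h r g] //=.
- by move=> [/Qs Qfs /Qt Qft]; rewrite fclD; apply: QD.
- by move=> /Qt Qft; rewrite fclZ; apply: QZ.
- exact: Qg.
Qed.

Lemma valid_fact p n k (h : p + n = k) r x : valid x -> valid (fact h r x).
Proof.
elim/valid_ind => [|{}x y IHx IHy|t {}x IHx|p' q e r' g vg].
- by rewrite linear0; apply: valid0.
- by rewrite linearD; apply: validD.
- by rewrite linearZ; apply: validZ.
have e' : p + p' + q = k by lia.
by rewrite (fact_gen _ _ _ _ _ erefl e'); apply: valid_fgen.
Qed.

Lemma valid_gbd q (g : gen q) : valid_gen g -> valid (gbd g).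
Proof. by case: g => z w [vz _ _]; exists z. Qed.

Lemma valid_fd n m (h : m + 1 = n) x : valid x -> valid (fd h x).
Proof.
elim/valid_ind => [|{}x y IHx IHy|t {}x IHx|p q e r g vg].
- by rewrite linear0; apply: valid0.
- by rewrite linearD; apply: validD.
- by rewrite linearZ; apply: validZ.
have e1 : p - 1 + q = m by lia.
have e2 : p + (q - 1) = m by lia.
rewrite (fd_gen _ _ _ _ (deg_pred p) e1 e2); apply: validD.
  exact: valid_fgen.
by apply/validZ/valid_fact/valid_gbd.
Qed.

Lemma gbd_cycle q (g : gen q) m (h : m + 1 = q - 1) :
  valid_gen g -> fd h (gbd g) = 0.
Proof. by case: g => z w [_ dz _]; apply: dz. Qed.

Lemma ff_gbd q (g : gen q) (h : q - 1 + 1 = q) :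
  valid_gen g -> ff (q - 1) (gbd g) = cx_d X h (gval g).
Proof. by case: g h => z w h [_ _ fz]; apply: fz. Qed.

Lemma valid_dd n m l (h : m + 1 = n) (h' : l + 1 = m) x :
  valid x -> fd h' (fd h x) = 0.
Proof.
elim/valid_ind => [|{}x y IHx IHy|t {}x IHx|p q e r g vg].
- by rewrite !linear0.
- by rewrite !linearD IHx IHy addr0.
- by rewrite !linearZ /= IHx scaler0.
have e1 : p - 1 + q = m by lia.
have e2 : p + (q - 1) = m by lia.
have e3 : p - 1 - 1 + q = l by lia.
have e4 : p - 1 + (q - 1) = l by lia.
have e5 : p + (q - 1 - 1) = l by lia.
rewrite (fd_gen _ _ _ _ (deg_pred p) e1 e2) linearD linearZ /=.
rewrite (fd_gen _ _ _ _ (deg_pred _) e3 e4) cx_dd fgen0 add0r.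
rewrite (fd_leibniz e2 (deg_pred p) (deg_pred _) h' e4 e5).
(* The product of [d r] with the boundary of [g] occurs twice, with the opposite signs of [p] and
   [p - 1]; the term in [d (d g)] vanishes because a valid generator has a cycle as boundary. *)
rewrite (gbd_cycle _ vg) linear0 scaler0 addr0 -scalerDl.
by rewrite ksgnD ksgnN ksgn1 mulrN1 addNr scale0r.
Qed.

Lemma valid_ff_d n m (h : m + 1 = n) x : valid x -> ff m (fd h x) = cx_d X h (ff n x).
Proof.
elim/valid_ind => [|{}x y IHx IHy|t {}x IHx|p q e r g vg].
- by rewrite !linear0.
- by rewrite !linearD IHx IHy.
- by rewrite !linearZ /= IHx.
have e1 : p - 1 + q = m by lia.
have e2 : p + (q - 1) = m by lia.
rewrite (fd_gen _ _ _ _ (deg_pred p) e1 e2) linearD linearZ /= ff_act.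
rewrite !ff_gen (ff_gbd (deg_pred q)) //.
by rewrite (lact_leibniz e (deg_pred p) (deg_pred q) h e1 e2).
Qed.

Definition validb n : {pred free n} := fun x => `[< valid x >].

Lemma validb_submod n : submod_closed (@validb n).
Proof.
split=> [|a x y /asboolP vx /asboolP vy]; apply/asboolP; first exact: valid0.
by apply: validD => //; apply: validZ.
Qed.
HB.instance Definition _ n :=
  GRing.isSubmodClosed.Build K (free n) (@validb n) (@validb_submod n).

Definition sfree n := {x : free n | x \in @validb n}.
HB.instance Definition _ n := SubChoice.on (sfree n).
HB.instance Definition _ n := [SubChoice_isSubLmodule of sfree n by <:].

End Resolution.

Section GHom.
Variables (K : comPzRingType) (R : dga K) (M N : ldgmod R).

Lemma gh_irr n (f : ghom M N n) i j (h h' : i + n = j) x :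
  gh_fun f h x = gh_fun f h' x.
Proof. by rewrite (eq_irrelevance h h'). Qed.

Lemma ghom_dE n m (hm : m + 1 = n) (f : ghom M N n) i i' j j' (h : i + m = j')
    (e : i + n = j) (e' : i' + n = j') (hi : i' + 1 = i) (hj : j' + 1 = j) x :
  gh_fun (cx_d (hom_cx M N) hm f) h x =
    cx_d N hj (gh_fun f e x) - ksgn K n *: gh_fun f e' (cx_d M hi x).
Proof.
have ei : i' = i - 1 by lia.
subst i'; case: j / hj e => e; rewrite /= (gh_irr f (deg_up hm h) e).
by rewrite (gh_irr f (deg_down hm h) e') (cx_d_irr hi (deg_pred i)).
Qed.

Lemma ghom_cycleE n (f : ghom M N n) : @cycle K (hom_cx M N) n f ->
  forall i i' j j' (e : i + n = j) (e' : i' + n = j') (hi : i' + 1 = i)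
    (hj : j' + 1 = j) x,
  cx_d N hj (gh_fun f e x) = ksgn K n *: gh_fun f e' (cx_d M hi x).
Proof.
move=> cf i i' j j' e e' hi hj x; apply/eqP; rewrite -subr_eq0.
have h : i + (n - 1) = j' by lia.
by rewrite -(ghom_dE (deg_pred n) f h) cf.
Qed.

Lemma ghom_cycleI n (f : ghom M N n) :
  (forall i j (e : i + n = j + 1) (e' : i - 1 + n = j) x,
    cx_d N erefl (gh_fun f e x) = ksgn K n *: gh_fun f e' (cx_d M (deg_pred i) x))
  -> @cycle K (hom_cx M N) n f.
Proof.
move=> df m h; apply: ghomP => i j e x.
have e1 : i + n = j + 1 by lia.
have e2 : i - 1 + n = j by lia.
by rewrite /= (gh_irr f _ e1) (gh_irr f _ e2) df subrr.
Qed.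
End GHom.

(** The Leibniz rule for [1 = 1 * 1] reads [d 1 = d 1 + d 1]. *)
Lemma d_one (K : comPzRingType) (R : dga K) j (h : j + 1 = 0) :
  cx_d R h (dga_one R) = 0.
Proof.
have := dga_leibniz (add0r 0) h h h (addr0 j) (add0r j) (dga_one R) (dga_one R).
rewrite dga_mul1l dga_mul1r dga_mul1l /ksgn expr0 scale1r.
by move/eqP; rewrite -subr_eq0 opprD addNKr oppr_eq0 => /eqP.
Qed.

Lemma fd_one (K : comPzRingType) (R : dga K) (X : ldgmod R) q (g : gen X q)
    (h : q - 1 + 1 = q) : fd X h (fgen (add0r q) (dga_one R) g) = gbd g.
Proof.
have e0 : -1 + 1 = 0 :> int by [].
have e1 : -1 + q = q - 1 by lia.
by rewrite (fd_gen _ _ _ _ e0 e1 (add0r _)) d_one fgen0 add0r /ksgn expr0 scale1r fact1.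
Qed.

Section SemiFree.
Variables (K : comPzRingType) (R : dga K) (X : ldgmod R).

Definition smk n (x : free X n) (vx : valid x) : sfree X n := exist _ x (asboolT vx).

Lemma svalid n (x : sfree X n) : valid (val x).
Proof. exact: asboolW (valP x). Qed.

Lemma smkK n (x : free X n) (vx : valid x) : val (smk vx) = x.
Proof. by []. Qed.

Definition sd_fun n m (h : m + 1 = n) (x : sfree X n) : sfree X m :=
  smk (valid_fd h (svalid x)).
Lemma sd_linear n m (h : m + 1 = n) : linear (@sd_fun n m h).
Proof.
move=> a x y; apply: val_inj; exact: (linearP (fd X h) a (val x) (val y)).
Qed.
HB.instance Definition _ n m (h : m + 1 = n) :=
  GRing.isLinear.Build K (sfree X n) (sfree X m) *:%R (sd_fun h) (sd_linear h).
Definition sd n m (h : m + 1 = n) : {linear sfree X n -> sfree X m} := sd_fun h.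

Lemma sdd n m l (h : m + 1 = n) (h' : l + 1 = m) x : sd h' (sd h x) = 0.
Proof. by apply: val_inj; apply/valid_dd/svalid. Qed.

Definition sact p n k (h : p + n = k) (r : R p) (x : sfree X n) : sfree X k :=
  smk (valid_fact h r (svalid x)).

Definition semifree : ldgmod R.
Proof.
refine (@LDgMod K R (@Cplx K (sfree X) sd sdd) sact _ _ _ _ _).
- by move=> i j k h x a r s; apply: val_inj; rewrite /= fact_linl.
- by move=> i j k h r a x y; apply: val_inj; 
  exact: (linearP (fact X h r) a (val x) (val y)).
- by move=> a b c ab bc abc h1 h2 h3 h4 r s x; apply: val_inj; apply: factA.
- by move=> i h x; apply: val_inj; apply: fact1.
- move=> i j k i' j' k' h hi hj hk h1 h2 r x; apply: val_inj.
  exact: fd_leibniz.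
Defined.

Definition semifree_map : ldg_hom semifree X.
Proof.
unshelve refine (@LDgHom K R semifree X (@CMap K semifree X
  (fun n => ff X n \o val) _) _).
- by move=> i j h x; apply: valid_ff_d; apply: svalid.
- by move=> i j k h r x; apply: ff_act.
Defined.

(** One generator settles each half: [Gen z w] bounds a cycle [z] whose image is [d w], and
    [Gen 0 w] is a cycle lying over a given cycle [w]. *)
Lemma semifree_qi : quasi_iso semifree_map.
Proof.
move=> n; split=> [x cx [k [h [w dw]]]|w cw].
  have [z [vz ez]] := svalid x.
  have ek : n = k - 1 by lia.
  subst n.
  pose g : gen X k := Gen z w.
  have vg : valid_gen g.
    split=> // [m hm|hk].
      by rewrite ez; have := cx _ hm => /(congr1 val).
    by rewrite ez (cx_d_irr hk h) dw.
  exists k, h, (smk (valid_fgen (add0r k) (dga_one R) vg)).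
  apply: val_inj; rewrite /=.
  by rewrite (eq_irrelevance h (deg_pred k)) fd_one.
have vg : valid_gen (Gen (TmZero X (n - 1)) w).
  split=> // [m h|h]; first by rewrite linear0.
  by rewrite linear0 cw.
exists (smk (valid_fgen (add0r n) (dga_one R) vg)); split.
  by apply: (cycle_d (h := deg_pred n)); apply: val_inj; rewrite /= fd_one.
by rewrite /= ff_gen lact1 subrr; apply: boundary0.
Qed.
End SemiFree.

(** * Semi-free modules are K-projective *)

Section SemiFreeProjective.
Variables (K : comPzRingType) (R : dga K) (X A : ldgmod R).
Hypothesis acyA : acyclic A.
Variables (n n1 : int) (hn : n + 1 = n1).
Variable f : ghom (semifree X) A n.
Hypothesis cf : @cycle K (hom_cx (semifree X) A) n f.

(* The generator [g] as an element of the resolution, and 0 if [g] is not valid. *)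
Definition sgen q (g : gen X q) : sfree X q :=
  if pselect (valid_gen g) is left vg
  then smk (valid_fgen (add0r q) (dga_one R) vg) else 0.

Lemma sgenE q (g : gen X q) (vg : valid_gen g) :
  sgen g = smk (valid_fgen (add0r q) (dga_one R) vg).
Proof. by rewrite /sgen; case: pselect => // vg'; apply: val_inj. Qed.

Lemma sgen_act n' p q (e : p + q = n') r (g : gen X q) (vg : valid_gen g) :
  smk (valid_fgen e r vg) = lact (semifree X) e r (sgen g).
Proof.
apply: val_inj; rewrite (sgenE vg) /=.
by rewrite (fact_gen _ _ _ _ _ (addr0 p) e) dga_mul1r.
Qed.

Lemma hdeg1 q j : q + n1 = j -> q + n + 1 = j. Proof. by lia. Qed.
Lemma hdeg2 q : q - 1 + n1 = q + n. Proof. by lia. Qed.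
Lemma hdeg3 m j p q : m + n1 = j -> p + q = m -> p + (q + n1) = j.
Proof. by lia. Qed.

(* A null homotopy of [f], chosen generator by generator: the value at
   [Gen z w] solves [d a = f (Gen z w) + (-1)^(n+1) h(z)]. *)
Fixpoint hgen q (g : gen X q) j (h : q + n1 = j) {struct g} : A j :=
  match g with
  | Gen z w =>
    if pselect (exists a : A j, cx_d A (hdeg1 h) a =
         gh_fun f erefl (sgen (Gen z w)) + ksgn K n1 *: hterm z (hdeg2 q))
    is left ex then projT1 (cid ex) else 0
  end
with hterm m (t : term X m) j (h : m + n1 = j) {struct t} : A j :=
  match t with
  | TmZero => 0
  | TmAdd s t => hterm s h + hterm t h
  | TmScale a t => a *: hterm t h
  | TmGen p q e r g => ksgn K (n1 * p) *: lact A (hdeg3 h e) r (hgen g erefl)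
  end.

Definition hb m j (h : m + n1 = j) p q (e : p + q = m) (r : R p)
    (g : gen X q) : A j :=
  ksgn K (n1 * p) *: lact A (hdeg3 h e) r (hgen g erefl).

Lemma hb_lin m j (h : m + n1 = j) : tmlin (hb h).
Proof.
by move=> p q e g a r s; rewrite /hb lact_linl scalerDr !scalerA (mulrC a).
Qed.
Definition hfree m j (h : m + n1 = j) : {linear free X m -> A j} :=
  flift (hb_lin h).

Lemma hfree_cl m j (h : m + n1 = j) t : hfree h (fcl t) = hterm t h.
Proof.
rewrite /hfree /= (flift_cl (hb_lin h)); 
elim/tm_ind: t => [|s t IHs IHt|a t IHt|p q e r g] //=.
  by rewrite IHs IHt.
by rewrite IHt.
Qed.

Lemma hfree_gen m j (h : m + n1 = j) p q (e : p + q = m) r g i (h1 : q + n1 = i)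
  (h2 : p + i = j) :
  hfree h (fgen e r g) = ksgn K (n1 * p) *: lact A h2 r (hgen g h1).
Proof.
subst i; rewrite /hfree flift_gen /hb.
by rewrite (eq_irrelevance (hdeg3 h e) h2).
Qed.

Lemma hfree_act p i j k l (h1 : p + i = k) (h2 : i + n1 = j) (h3 : k + n1 = l)
      (h4 : p + j = l) (r : R p) (x : free X i) :
  hfree h3 (fact X h1 r x) = ksgn K (n1 * p) *: lact A h4 r (hfree h2 x).
Proof.
elim/free_ind: x => [|x y IHx IHy|t x IHx|p' q e r' g].
- by rewrite !linear0 lact0r scaler0.
- by rewrite !linearD lactDr IHx IHy scalerDr.
- by rewrite !linearZ /= IHx lactZr !scalerA mulrC.
have e' : p + p' + q = k by lia.
have e1 : p + p' + (q + n1) = l by lia.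
have e2 : p' + (q + n1) = j by lia.
rewrite (fact_gen _ _ _ _ _ erefl e') (hfree_gen _ _ _ _ erefl e1).
rewrite (hfree_gen _ _ _ _ erefl e2) lactZr scalerA (lactA erefl e1).
by rewrite mulrDr ksgnD.
Qed.

Let hgen_d q (g : gen X q) : Prop :=
  valid_gen g -> forall j (h : q + n1 = j),
    cx_d A (hdeg1 h) (hgen g h) =
      gh_fun f erefl (sgen g) + ksgn K n1 *: hfree (hdeg2 q) (gbd g).
Let hterm_d m (t : term X m) : Prop :=
  valid_term t -> forall (v : valid (fcl t)) m' j j'
    (h : m + n1 = j) (e : m + n = j') (hj : j' + 1 = j) (hm : m' + 1 = m)
    (h' : m' + n1 = j'),
  cx_d A hj (hfree h (fcl t)) =
    gh_fun f e (smk v) + ksgn K n1 *: hfree h' (fd X hm (fcl t)).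

(** The choice made by [hgen] at [Gen z w] is possible only if the homotopy equation already holds
    at [z]: it makes the prescribed right-hand side a cycle, hence a boundary by acyclicity of [A].
    The equation on terms then follows from the one on generators by the Leibniz rule, so both are
    proved by mutual induction. *)
Lemma hgen_term_d q :
  (forall g : gen X q, hgen_d g) /\ (forall t : term X q, hterm_d t).
Proof.
move: q; apply: (@gen_term_ind K R X hgen_d hterm_d).
- move=> q z IH w vg j h /=; rewrite -hfree_cl.
  case: pselect => [ex|]; first by case: (cid ex).
  case; case: (vg) => vz dz fz.
  have vz' : valid (fcl z) by exists z.
  have e1 : q - 1 + n = q + n - 1 by lia.
  have e2 : q - 1 - 1 + n1 = q + n - 1 by lia.
  (* Since [d z = 0], the equation at [z] becomes [d (h z) = f z]. *)
  have dh := IH vz vz' _ _ _ (hdeg2 q) e1 (deg_pred _) (deg_pred _) e2.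
  rewrite dz linear0 scaler0 addr0 in dh.
  have [] : boundary (gh_fun f erefl (sgen (Gen z w)) +
                      ksgn K n1 *: hfree (hdeg2 q) (fcl z)).
    apply: acyA; apply: (cycle_d (h := deg_pred _)).
    rewrite linearD linearZ /= dh (ghom_cycleE cf _ e1 (deg_pred q)).
    have -> : cx_d (semifree X) (deg_pred q) (sgen (Gen z w)) = smk vz'.
      by apply: val_inj; rewrite (sgenE vg) /= fd_one.
    (* [f] is a cycle of degree [n], so [d (f g)] is [(-1)^n f z]; the correction term contributes
       [(-1)^(n+1) f z]. *)
    by rewrite -scalerDl -hn ksgnD ksgn1 mulrN1 subrr scale0r.
  move=> k [hk [y dy]]; have ek : k = j by lia.
  move: hk y dy; rewrite {k}ek => hk y dy.
  by exists y; rewrite (cx_d_irr (hdeg1 h) hk).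
- move=> m _ v m' j j' h e hj hm h'.
  have -> : smk v = 0 by apply: val_inj.
  by rewrite !linear0 gh0 addr0.
- move=> m s IHs t IHt [v1 v2] v m' j j' h e hj hm h'.
  have [vs vt] : valid (fcl s) /\ valid (fcl t).
    by split; [exists s|exists t].
  have -> : smk v = smk vs + smk vt by apply: val_inj; rewrite /= fclD.
  rewrite fclD !linearD ghD (IHs v1 vs _ _ _ h e hj hm h').
  by rewrite (IHt v2 vt _ _ _ h e hj hm h') addrACA.
- move=> m a t IHt vt v m' j j' h e hj hm h'.
  have vt' : valid (fcl t) by exists t.
  have -> : smk v = a *: smk vt' by apply: val_inj; rewrite /= fclZ.
  rewrite fclZ !linearZ ghZ /= (IHt vt vt' _ _ _ h e hj hm h') scalerDr.
  by rewrite !scalerA mulrC.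
move=> m p q e r g IH vg v m' j j' h e' hj hm h'.
rewrite -/(fgen e r g).
have e1 : p + (q + n1) = j by lia.
have e2 : p - 1 + (q + n1) = j' by lia.
have e3 : p + (q + n) = j' by lia.
have e4 : p - 1 + q = m' by lia.
have e5 : p + (q - 1) = m' by lia.
rewrite (hfree_gen _ _ _ _ erefl e1) linearZ /=.
rewrite (lact_leibniz e1 (deg_pred p) (hdeg1 erefl) hj e2 e3) (IH vg).
rewrite (fd_gen _ _ _ _ (deg_pred p) e4 e5) [hfree h' _]linearD.
rewrite [hfree h' (_ *: _)]linearZ /=.
rewrite (hfree_gen _ _ _ _ erefl e2) (hfree_act e5 (hdeg2 q) h' e3).
have -> : smk v = lact (semifree X) e r (sgen g).
  by rewrite -sgen_act; apply: val_inj.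
rewrite (gh_act f e erefl e' e3) lactDr lactZr !scalerDr !scalerA.
have s1 : ksgn K (n1 * p) * ksgn K p = ksgn K (n * p).
  by rewrite -hn mulrDl mul1r ksgnD -mulrA ksgnK mulr1.
rewrite mulrBr mulr1 ksgnD ksgnN.
have s2 : ksgn K n1 * (ksgn K (n1 * p) * ksgn K n1) = ksgn K (n1 * p).
  by rewrite mulrCA ksgnK mulr1.
have s3 : ksgn K n1 * ksgn K p * ksgn K (n1 * p) = ksgn K (n * p) * ksgn K n1.
  by rewrite -mulrA [ksgn K p * _]mulrC s1 mulrC.
by rewrite s2 s1 s3 addrCA.
Qed.

Lemma semifree_null_homotopy :
  exists h : ghom (semifree X) A n1,
    cx_d (hom_cx (semifree X) A) hn h = f.
Proof.
unshelve eexists.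
  refine (@GHom K R (semifree X) A n1
    (fun i j h x => hfree h (val (x : sfree X i))) _ _).
  - by move=> i j h a x y; rewrite linearP.
  - by move=> p i j k l h1 h2 h3 h4 r x; apply: hfree_act.
apply: ghomP => i j e x.
have e1 : i + n1 = j + 1 by lia.
have e2 : i - 1 + n1 = j by lia.
rewrite (ghom_dE _ _ _ e1 e2 (deg_pred i) erefl) /=.
(* The induction speaks of valid terms, so the element is replaced by a valid representative. *)
have [t [vt et]] := svalid x; have [_ /(_ _ vt) ht] := hgen_term_d i.
have v : valid (fcl t) by rewrite et; apply: svalid.
rewrite -et (ht v _ _ _ e1 e erefl (deg_pred i) e2) addrK.
by congr gh_fun; apply: val_inj.
Qed.
End SemiFreeProjective.

Lemma semifree_Kprojective (K : comPzRingType) (R : dga K) (X : ldgmod R) :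
  Kprojective (semifree X).
Proof.
move=> A acyA n f cf.
have [h eh] := semifree_null_homotopy acyA erefl cf.
by exists (n + 1), erefl, h.
Qed.

(** * Semi-free modules are K-flat *)

Section SemiFreeFlat.
Variables (K : comPzRingType) (R : dga K) (X : ldgmod R).

(** The boundary of a generator may involve generators of several degrees, so the finite lists below
    must mix degrees. *)
Definition sigen := {q : int & gen X q}.
Definition tgen q (g : gen X q) : sigen := existT (gen X) q g.

Lemma coef_deg (m n p q q0 : int) (hm : m + q0 = n) (h : p + q = n) :
  q = q0 -> p = m.
Proof. by lia. Qed.

Section Coefficient.
Variables (q0 : int) (g0 : gen X q0).

(** Generators are compared in the sigma type because their degrees differ a priori. Equality is
    decided classically and forces the degree of [r], up to the cast. *)
Definition coef_b m n (hm : m + q0 = n) p q (h : p + q = n) (r : R p)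
    (g : gen X q) : R m :=
  if pselect (tgen g = tgen g0) is left e
  then cxcast (coef_deg hm h (congr1 (@projT1 _ _) e)) r else 0.

Lemma coef_lin m n (hm : m + q0 = n) : tmlin (coef_b hm).
Proof.
move=> p q h g a r s; rewrite /coef_b; case: pselect => [e|_].
  exact: cxcastP.
by rewrite scaler0 addr0.
Qed.
Definition coef m n (hm : m + q0 = n) : {linear free X n -> R m} :=
  flift (coef_lin hm).

Lemma coef_neq m n (hm : m + q0 = n) p q (h : p + q = n) r (g : gen X q) :
  tgen g <> tgen g0 -> coef hm (fgen h r g) = 0.
Proof. by move=> ne; rewrite /coef flift_gen /coef_b; case: pselect. Qed.

Lemma coef_eq m n (hm : m + q0 = n) (h : m + q0 = n) r :
  coef hm (fgen h r g0) = r.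
Proof.
rewrite /coef flift_gen /coef_b; case: pselect => // e.
exact: cxcast_id.
Qed.

Lemma coef_act m n p k l (hm : m + q0 = n) (h : p + n = k) (hl : l + q0 = k)
    (hp : p + m = l) r x :
  coef hl (fact X h r x) = dga_mul R hp r (coef hm x).
Proof.
elim/free_ind: x => [|x y IHx IHy|t x IHx|p' q e r' g].
- by rewrite !linear0 dmul0r.
- by rewrite !linearD dmulDr IHx IHy.
- by rewrite !linearZ /= dmulZr IHx.
have e' : p + p' + q = k by lia.
rewrite (fact_gen _ _ _ _ _ erefl e').
case: (pselect (tgen g = tgen g0)) => [|ne]; last first.
  by rewrite !coef_neq // dmul0r.
move=> eg; have eq := congr1 (@projT1 _ _) eg; rewrite /= in eq.
subst q; have ep : p' = m by lia.
subst p' l; rewrite (eq_irrelevance hl e').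
have -> : g = g0 by apply: eq_from_Tagged eg.
by rewrite !coef_eq.
Qed.

Variable A : rdgmod R.

Lemma coefA_deg m n i j (hm : m + q0 = n) (h : i + j = n) : i + (j - q0) = m.
Proof. by lia. Qed.

(** This is where freeness enters the proof of flatness: [x (x) r g0] has coefficient [x r] at [g0],
    and elements supported on other generators have coefficient 0. *)
Definition coefA_b m n (hm : m + q0 = n) i j (h : i + j = n) (x : A i)
    (y : semifree X j) : A m :=
  ract A (coefA_deg hm h) x (coef (subrK q0 j) (val (y : sfree X j))).
Lemma coefA_linl m n (hm : m + q0 = n) i j (h : i + j = n) y :
  linear (fun x => coefA_b hm h x y).
Proof. by move=> a x x'; rewrite /coefA_b ract_linl. Qed.
Lemma coefA_linr m n (hm : m + q0 = n) i j (h : i + j = n) x :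
  linear (coefA_b hm h x).
Proof. by move=> a y y'; rewrite /coefA_b (linearP (coef _)) ract_linr. Qed.

Lemma coefA_bal m n (hm : m + q0 = n) i p j ip pj (h1 : i + p = ip)
    (h2 : ip + j = n) (h3 : p + j = pj) (h4 : i + pj = n) x r (y : semifree X j) :
  coefA_b hm h2 (ract A h1 x r) y = coefA_b hm h4 x (lact (semifree X) h3 r y).
Proof.
have e : p + (j - q0) = pj - q0 by lia.
rewrite /coefA_b /= (coef_act (subrK q0 j) h3 _ e).
by rewrite (ractA h1 (coefA_deg hm h2)).
Qed.

Definition coefA m n (hm : m + q0 = n) :
    {linear tens A (semifree X) n -> A m} :=
  @tlift K R A (semifree X) n (A m) (coefA_b hm) (coefA_linl hm)
    (coefA_linr hm) (coefA_bal hm).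

Lemma coefA_tpure m n (hm : m + q0 = n) i j k (h : i + j = n) x y
    (hk : k + q0 = j) (h' : i + k = m) :
  coefA hm (tpure h x y) = ract A h' x (coef hk (val (y : sfree X j))).
Proof.
rewrite /coefA tlift_pure /coefA_b; have ek : k = j - q0 by lia.
subst k; rewrite (eq_irrelevance (coefA_deg hm h) h').
by rewrite (eq_irrelevance hk (subrK q0 j)).
Qed.

End Coefficient.

Inductive fspan (L : seq sigen) n : free X n -> Prop :=
| fspan0 : fspan L 0
| fspanD x y : fspan L x -> fspan L y -> fspan L (x + y)
| fspanZ a x : fspan L x -> fspan L (a *: x)
| fspan_gen p q (h : p + q = n) r (g : gen X q) :
    List.In (tgen g) L -> fspan L (fgen h r g).

(* The boundary of each generator in [L] is spanned by later ones, so a cycle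
   [a (x) g + ...] on [g :: L] has [d a = 0], and [a] can be removed up to a boundary
   when the coefficients form an acyclic module. *)
Fixpoint good (L : seq sigen) : Prop :=
  match L with
  | [::] => True
  | u :: L' =>
    [/\ valid_gen (projT2 u), fspan L' (gbd (projT2 u)), ~ List.In u L' & good L']
  end.

Lemma fspan_sub L L' n (x : free X n) :
  (forall u, List.In u L -> List.In u L') -> fspan L x -> fspan L' x.
Proof.
move=> sub; elim=> [|{}x y _ IHx _ IHy|a {}x _ IHx|p q h r g /sub g_in].
- exact: fspan0.
- exact: fspanD.
- exact: fspanZ.
- exact: fspan_gen.
Qed.

(** An element of [L1] not yet present goes in front of the merged list. Its boundary is spanned by
    the rest of [L1], which the merged list already contains. *)
Lemma good_merge L1 L2 : good L1 -> good L2 ->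
  exists L, [/\ good L, forall u, List.In u L1 -> List.In u L
    & forall u, List.In u L2 -> List.In u L].
Proof.
elim: L1 => [|u L1 IH] /=; first by move=> _ g2; exists L2.
move=> [vu su _ g1] g2; have [L [gL sub1 sub2]] := IH g1 g2.
case: (pselect (List.In u L)) => [uL|nuL].
  by exists L; split=> // v [<- //|/sub1].
exists (u :: L); split=> [|v [->|/sub1]|v /sub2] /=; [|by left|by right|by right].
by split=> //; apply: fspan_sub su.
Qed.

Lemma good_valid L : good L -> forall u, List.In u L -> valid_gen (projT2 u).
Proof.
by elim: L => //= u L IH [vu _ _ gL] v [<- //|]; apply: IH.
Qed.

Lemma good_fspan L : good L -> forall u, List.In u L -> fspan L (gbd (projT2 u)).
Proof.
elim: L => //= u L IH [vu su _ gL] v [<-|/(IH gL) sv].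
  by apply: fspan_sub su => w wL; right.
by apply: fspan_sub sv => w wL; right.
Qed.

(** A generator contains its boundary as a subterm, so structural induction collects the finitely
    many generators it depends on, each placed before those of its boundary. *)
Lemma good_exists n :
  (forall g : gen X n, valid_gen g -> exists L, good L /\ List.In (tgen g) L) /\
  (forall t : term X n, valid_term t -> exists L, good L /\ fspan L (fcl t)).
Proof.
move: n; apply: (@gen_term_ind K R X
  (fun n g => valid_gen g -> exists L, good L /\ List.In (tgen g) L)
  (fun n t => valid_term t -> exists L, good L /\ fspan L (fcl t))).
- move=> n z IH w vg; have [vz _ _] := vg; have [L [gL sz]] := IH vz.
  case: (pselect (List.In (tgen (Gen z w)) L)) => [gin|nin]; first by exists L.
  by exists (tgen (Gen z w) :: L); split; [split|left].
- by move=> n _; exists [::]; split=> //; apply: fspan0.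
- move=> n s IHs t IHt [/IHs[L1 [g1 s1]] /IHt[L2 [g2 s2]]].
  have [L [gL sub1 sub2]] := good_merge g1 g2.
  exists L; split=> //; rewrite fclD.
  by apply: fspanD; [apply: fspan_sub s1|apply: fspan_sub s2].
- move=> n a t IHt /IHt[L [gL sL]]; exists L; split=> //.
  by rewrite fclZ; apply: fspanZ.
- move=> n p q h r g IH /IH[L [gL gin]]; exists L; split=> //.
  exact: fspan_gen.
Qed.

Lemma coef_fspan0 q0 (g0 : gen X q0) L n m (hm : m + q0 = n) x :
  ~ List.In (tgen g0) L -> fspan L x -> coef g0 hm x = 0.
Proof.
move=> nin; elim=> [|{}x y _ IHx _ IHy|a {}x _ IHx|p q h r g gin].
- by rewrite linear0.
- by rewrite linearD IHx IHy addr0.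
- by rewrite linearZ /= IHx scaler0.
- by rewrite coef_neq // => eg; apply: nin; rewrite -eg.
Qed.

Section Flat.
Variable A : rdgmod R.
Local Notation T := (tens A (semifree X)).

Inductive tspan (L : seq sigen) n : T n -> Prop :=
| tspan0 : tspan L 0
| tspanD x y : tspan L x -> tspan L y -> tspan L (x + y)
| tspanZ a x : tspan L x -> tspan L (a *: x)
| tspan_gen p q (h : p + q = n) (x : A p) (g : gen X q) :
    List.In (tgen g) L -> tspan L (tpure h x (sgen g : semifree X q)).

Lemma tspan_sub L L' n (x : T n) :
  (forall u, List.In u L -> List.In u L') -> tspan L x -> tspan L' x.
Proof.
move=> sub; elim=> [|{}x y _ IHx _ IHy|a {}x _ IHx|p q h r g /sub g_in].
- exact: tspan0.
- exact: tspanD.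
- exact: tspanZ.
- exact: tspan_gen.
Qed.

(** Ring coefficients cross the tensor sign, [x (x) r g = x r (x) g], so coefficients in [A]
    suffice. *)
Lemma tspan_fspan L n i j (h : i + j = n) x (y : sfree X j) :
  good L -> fspan L (val y) -> tspan L (tpure h x (y : semifree X j)).
Proof.
move=> gL sy.
(* Induction on [fspan] forgets that [y] lies in the submodule of valid elements; validity is
   re-established along the way. *)
suff [v] : exists v : valid (val y), tspan L (tpure h x (smk v : semifree X j)).
  by congr (tspan L (tpure h x _)); apply: val_inj.
elim: sy => [|{}y z _ [vy sy] _ [vz sz]|a {}y _ [vy sy]|p q e r g gin].
- exists (valid0 X j); have -> : smk (valid0 X j) = 0 by apply: val_inj.
  by rewrite tpure0r; apply: tspan0.
- exists (validD vy vz).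
  have -> : smk (validD vy vz) = smk vy + smk vz by apply: val_inj.
  by rewrite (tpureDr h); apply: tspanD.
- exists (validZ a vy).
  have -> : smk (validZ a vy) = a *: smk vy by apply: val_inj.
  by rewrite (tpureZr h); apply: tspanZ.
have vg := good_valid gL gin; exists (valid_fgen e r vg).
have e1 : i + p + q = n by lia.
rewrite (sgen_act _ _ vg) -(tpure_bal erefl e1).
exact: tspan_gen.
Qed.

Lemma tspan_exists n (t : T n) : exists L, good L /\ tspan L t.
Proof.
elim/tens_ind: t => [|x y [L1 [g1 s1]] [L2 [g2 s2]]|a x [L [gL sL]]|i j h x y].
- by exists [::]; split=> //; apply: tspan0.
- have [L [gL sub1 sub2]] := good_merge g1 g2; exists L; split=> //.
  by apply: tspanD; [apply: tspan_sub s1|apply: tspan_sub s2].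
- by exists L; split=> //; apply: tspanZ.
have [t [vt et]] := svalid y; have [_ /(_ _ vt)[L [gL sL]]] := good_exists j.
by exists L; split=> //; apply: tspan_fspan => //; rewrite -et.
Qed.

Lemma coefA_gen_neq q0 (g0 : gen X q0) m n (hm : m + q0 = n) p q (h : p + q = n)
    (x : A p) (g : gen X q) : valid_gen g -> tgen g <> tgen g0 ->
  coefA g0 A hm (tpure h x (sgen g : semifree X q)) = 0.
Proof.
move=> vg ne; have e : p + (q - q0) = m by lia.
rewrite (coefA_tpure _ _ _ _ _ (subrK q0 q) e) (sgenE vg) smkK.
by rewrite coef_neq // ract0r.
Qed.

Lemma coefA_gen_eq q0 (g0 : gen X q0) m n (hm : m + q0 = n) (h : m + q0 = n)
    (x : A m) : valid_gen g0 ->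
  coefA g0 A hm (tpure h x (sgen g0 : semifree X q0)) = x.
Proof.
move=> vg; rewrite (coefA_tpure _ _ _ _ _ (add0r q0) (addr0 m)) (sgenE vg) smkK.
by rewrite coef_eq ract1.
Qed.

Lemma coefA_fspan0 q0 (g0 : gen X q0) L m n (hm : m + q0 = n) i j (h : i + j = n)
    (x : A i) (y : semifree X j) : ~ List.In (tgen g0) L ->
  fspan L (val (y : sfree X j)) -> coefA g0 A hm (tpure h x y) = 0.
Proof.
move=> nin sy; have e : i + (j - q0) = m by lia.
rewrite (coefA_tpure _ _ _ _ _ (subrK q0 j) e).
by rewrite (coef_fspan0 _ nin sy) ract0r.
Qed.

Lemma tgen_eq (Q : forall q, gen X q -> Prop) q0 (g0 : gen X q0) q (g : gen X q) :
  tgen g = tgen g0 -> Q q0 g0 -> Q q g.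
Proof. by move=> /(congr1 (fun u => Q (projT1 u) (projT2 u))) /= ->. Qed.

Lemma tspan_rem q0 (g0 : gen X q0) L m n (hm : m + q0 = n) t :
  good (tgen g0 :: L) -> tspan (tgen g0 :: L) t ->
  tspan L (t - tpure hm (coefA g0 A hm t) (sgen g0 : semifree X q0)).
Proof.
move=> gL; elim=> [|x y _ IHx _ IHy|a x _ IHx|p q h x g gin].
- by rewrite linear0 tpure0l subr0; apply: tspan0.
- by rewrite linearD tpureDl opprD addrACA; apply: tspanD.
- by rewrite linearZ tpureZl -scalerBr; apply: tspanZ.
have [vg0 sg0 nin gL'] := gL.
case: (pselect (tgen g = tgen g0)) => [eg|ne]; last first.
  case: gin => [/esym //|gin]; have vg := good_valid gL' gin.
  by rewrite coefA_gen_neq // tpure0l subr0; apply: tspan_gen.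
have eq := congr1 (@projT1 _ _) eg; rewrite /= in eq.
subst q; have -> : g = g0 by apply: eq_from_Tagged eg.
have ep : p = m by lia.
subst p; rewrite coefA_gen_eq // (eq_irrelevance h hm) subrr.
exact: tspan0.
Qed.

(** The boundaries of all generators in the list, that of [g0] included, are spanned by [L], where
    [g0] does not occur. So only the differential of [A] contributes to the coefficient at [g0]. *)
Lemma coefA_d q0 (g0 : gen X q0) L m m' n n' (hm : m + q0 = n)
    (hm' : m' + q0 = n') (hn : n' + 1 = n) (h : m' + 1 = m) t :
  good (tgen g0 :: L) -> tspan (tgen g0 :: L) t ->
  coefA g0 A hm' (tens_d A (semifree X) hn t) = cx_d A h (coefA g0 A hm t).
Proof.
move=> gL; elim=> [|x y _ IHx _ IHy|a x _ IHx|p q e x g gin].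
- by rewrite !linear0.
- by rewrite !linearD IHx IHy.
- by rewrite !linearZ /= IHx.
have [vg0 sg0 nin gL'] := gL; have vg : valid_gen g := good_valid gL gin.
have sg : fspan L (gbd g).
  case: gin => [eg|gin]; last exact: (good_fspan gL' gin).
  exact: (tgen_eq (Q := fun _ g => fspan L (gbd g)) (esym eg) sg0).
have e1 : p - 1 + q = n' by lia.
have e2 : p + (q - 1) = n' by lia.
rewrite (tens_leibniz e (deg_pred p) (deg_pred q) hn e1 e2) linearD linearZ /=.
rewrite (coefA_fspan0 _ e2 _ nin) ?scaler0 ?addr0; last first.
  by rewrite (sgenE vg) /= fd_one.
case: (pselect (tgen g = tgen g0)) => [eg|ne]; last first.
  by rewrite !coefA_gen_neq // linear0.
have eq := congr1 (@projT1 _ _) eg; rewrite /= in eq.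
subst q; have -> : g = g0 by apply: eq_from_Tagged eg.
have ep : p = m by lia.
subst p; have em : m' = m - 1 by lia.
by subst m'; rewrite !coefA_gen_eq // (cx_d_irr h (deg_pred m)).
Qed.

Lemma good_acyclic L : acyclic A -> good L -> forall n (t : T n),
  tspan L t -> @cycle K (tens_cx A (semifree X)) n t ->
  @boundary K (tens_cx A (semifree X)) n t.
Proof.
move=> acyA; elim: L => [|[q0 g0] L IH] gL n t st ct.
  suff -> : t = 0 by apply: boundary0.
  elim: st => [|x y _ -> _ ->|a x _ ->|] //; rewrite ?addr0 ?scaler0 //.
have hm : n - q0 + q0 = n by rewrite subrK.
have e1 : n - q0 - 1 + q0 = n - 1 by lia.
have [k [hk [b db]]] : boundary (coefA g0 A hm t).
  apply: acyA; apply: (cycle_d (h := deg_pred _)).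
  by rewrite -(coefA_d hm e1 (deg_pred n) (deg_pred _) gL st) ct linear0.
have h1 : k + q0 = n + 1 by lia.
(* With [d b] equal to the leading coefficient, [t - d u] loses its [g0] component; what remains of
   [d u] is [b] tensored with the boundary of [g0], supported on the shorter list. *)
pose u : T (n + 1) := tpure h1 b (sgen g0 : semifree X q0).
pose du := cx_d (tens_cx A (semifree X)) erefl u.
suff : @boundary K (tens_cx A (semifree X)) n (t - du).
  move=> bt; rewrite -[t](subrK du); apply: boundaryD bt _.
  exact: boundary_d.
apply: IH; last 1 first.
- by apply: cycleB => //; apply/boundary_cycle/boundary_d.
- by case: gL.
rewrite /du /=.
have h2 : k + (q0 - 1) = n by lia.
rewrite (tens_leibniz h1 hk (deg_pred q0) erefl hm h2) db opprD addrA.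
case: (gL) => vg0 sg0 nin gL'.
apply: tspanD; first exact: tspan_rem.
rewrite -scaleN1r; apply/tspanZ/tspanZ/tspan_fspan => //.
by rewrite (sgenE vg0) /= fd_one.
Qed.
End Flat.

Lemma semifree_Kflat : Kflat (semifree X).
Proof.
move=> A acyA n t ct; have [L [gL sL]] := tspan_exists t.
exact: good_acyclic sL ct.
Qed.
End SemiFreeFlat.

(** * Cones and exactness of the derived functors *)

Lemma ksgn_eq (K : pzRingType) (i j c : int) : i = j + c + c -> ksgn K i = ksgn K j.
Proof. by move=> ->; rewrite !ksgnD -mulrA ksgnK mulr1. Qed.

Section Cone.
Variables (K : comPzRingType) (C D : cplx K) (f : cmap C D).

Definition cone_deg (n : int) : lmodType K := (C (n - 1) * D n)%type.

Lemma cone_deg1 (i j : int) : j + 1 = i -> j - 1 + 1 = i - 1. Proof. by lia. Qed.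
Lemma cone_deg2 (i j : int) : j + 1 = i -> i - 1 = j. Proof. by lia. Qed.

Definition cone_d_fun i j (h : j + 1 = i) (x : cone_deg i) : cone_deg j :=
  (- cx_d C (cone_deg1 h) x.1, cxcast (cone_deg2 h) (f _ x.1) + cx_d D h x.2).

Lemma cone_d_linear i j (h : j + 1 = i) : linear (@cone_d_fun i j h).
Proof.
move=> a [x y] [x' y']; congr pair; rewrite /=.
  by rewrite linearP opprD scalerN.
by rewrite !linearP scalerDr addrACA.
Qed.
HB.instance Definition _ i j (h : j + 1 = i) :=
  GRing.isLinear.Build K (cone_deg i) (cone_deg j) *:%R (@cone_d_fun i j h)
    (cone_d_linear h).
Definition cone_d i j (h : j + 1 = i) : {linear cone_deg i -> cone_deg j} :=
  @cone_d_fun i j h.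

Lemma cone_dd i j k (h : j + 1 = i) (h' : k + 1 = j) x :
  cone_d h' (cone_d h x) = 0.
Proof.
case: x => x y; congr pair; rewrite /=.
  by rewrite linearN /= cx_dd !oppr0.
rewrite !linearN /= linearD /= cx_dd addr0.
by rewrite (cxcast_d _ (cone_deg2 h') (cone_deg1 h)) -cm_d addNr.
Qed.

Definition cone_cx : cplx K := @Cplx K cone_deg cone_d cone_dd.

(** For a cycle [(x, y)] the element [f x] is a boundary, so [x = d u]. Then [y + f u] is a cycle,
    hence of the form [f v - d w] with [v] a cycle, and [(v - u, - w)] bounds [(x, y)]. *)
Lemma cone_acyclic : quasi_iso f -> acyclic cone_cx.
Proof.
move=> qf n [x y] cxy.
have dxy m (h : m + 1 = n) : cx_d C (cone_deg1 h) x = 0 /\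
    cxcast (cone_deg2 h) (f _ x) + cx_d D h y = 0.
  have /pair_equal_spec[e1 e2] := cxy _ h; split=> //.
  by apply/eqP; rewrite -oppr_eq0; apply/eqP.
have cx : cycle x by have [dx _] := dxy _ (deg_pred n); apply: cycle_d dx.
have [k [hk [u du]]] : boundary x.
  apply: (qi_inj qf cx); have [_ /eqP] := dxy _ (deg_pred n).
  rewrite addr_eq0 cxcast_id => /eqP ->.
  by apply: boundaryN; apply: boundary_d.
have ek : k = n by lia.
move: hk u du; rewrite {k}ek => hk u du.
have cy : cycle (y + f n u).
  apply: (cycle_d (h := deg_pred n)); have [_] := dxy _ (deg_pred n).
  by rewrite cxcast_id linearD -cm_d !(cx_d_irr (deg_pred n) hk)
      du [X in X = _ -> _]addrC.
have [v [cv [l [hl [w dw]]]]] := qi_surj qf cy.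
have en : n = l - 1 by lia.
exists l, hl, (cxcast en (v - u), - w); congr pair; rewrite /=.
  rewrite (cxcast_d _ (erefl : n - 1 = n - 1) hk) cxcast_id linearB /= cv du.
  by rewrite sub0r opprK.
rewrite cxcast_map cxcast_comp cxcast_id linearB linearN /= dw.
by rewrite opprB [LHS]addrC addrA subrK addrK.
Qed.

End Cone.

Record rdg_hom (K : comPzRingType) (R : dga K) (M N : rdgmod R) := RDgHom {
  rh_map :> cmap M N;
  rh_act : forall i j k (h : i + j = k) (x : M i) (r : R j),
    rh_map k (ract M h x r) = ract N h (rh_map i x) r }.

Definition rh_id (K : comPzRingType) (R : dga K) (M : rdgmod R) : rdg_hom M M :=
  @RDgHom K R M M (@CMap K M M (fun i => idfun) (fun _ _ _ _ => erefl))
    (fun _ _ _ _ _ _ => erefl).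

Section TensorMaps.
Variables (K : comPzRingType) (R : dga K).

Lemma tens_ext (M : rdgmod R) (N : ldgmod R) n (V : lmodType K)
    (f g : {linear tens M N n -> V}) :
  (forall i j (h : i + j = n) x y, f (tpure h x y) = g (tpure h x y)) ->
  forall t, f t = g t.
Proof.
move=> fg; elim/tens_ind => [|x y IHx IHy|a x IHx|i j h x y] //.
- by rewrite !linear0.
- by rewrite !linearD IHx IHy.
- by rewrite !linearZ /= IHx.
Qed.

Section LeftFactor.
Variables (M M' : rdgmod R) (N : ldgmod R) (k : int).
Variable phi : forall i j, i + k = j -> {linear M i -> M' j}.
Hypothesis phi_act : forall i p ip j jp (hi : i + p = ip) (h : i + k = j)
  (hj : j + p = jp) (h' : ip + k = jp) x r,
  phi h' (ract M hi x r) = ract M' hj (phi h x) r.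
Variables (n n' : int) (hn : n + k = n').

Lemma tensl_deg i j : i + j = n -> i + k + j = n'. Proof. by lia. Qed.
(** A nonzero degree [k] is needed for the cone inclusions and projections, which shift degrees.
    Acting on the left factor, the map passes no element and takes no sign. *)
Definition tensl_b i j (h : i + j = n) (x : M i) (y : N j) : tens M' N n' :=
  tpure (tensl_deg h) (phi erefl x) y.
Lemma tensl_linl i j (h : i + j = n) y : linear (fun x => tensl_b h x y).
Proof. by move=> a x x'; rewrite /tensl_b linearP tpure_linl. Qed.
Lemma tensl_linr i j (h : i + j = n) x : linear (tensl_b h x).
Proof. by move=> a y y'; rewrite /tensl_b tpure_linr. Qed.
Lemma tensl_bal i p j ip pj (h1 : i + p = ip) (h2 : ip + j = n)
    (h3 : p + j = pj) (h4 : i + pj = n) x r y :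
  tensl_b h2 (ract M h1 x r) y = tensl_b h4 x (lact N h3 r y).
Proof.
have e : i + k + p = ip + k by lia.
by rewrite /tensl_b (phi_act h1 erefl e) (tpure_bal e _ h3 (tensl_deg h4)).
Qed.
Definition tensl : {linear tens M N n -> tens M' N n'} :=
  tlift tensl_linl tensl_linr tensl_bal.

Lemma tensl_tpure i j i' (h : i + j = n) (hi : i + k = i') (h' : i' + j = n') x y :
  tensl (tpure h x y) = tpure h' (phi hi x) y.
Proof.
by subst i'; rewrite /tensl tlift_pure /tensl_b (eq_irrelevance (tensl_deg h) h').
Qed.
End LeftFactor.

Section Map.
Variables (M M' : rdgmod R) (N N' : ldgmod R).
Variables (f : rdg_hom M M') (g : ldg_hom N N').
Let b i j n (h : i + j = n) (x : M i) (y : N j) : tens_cx M' N' n :=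
  tpure h (f i x) (g j y).
Let b_linl i j n (h : i + j = n) y : linear (fun x => b h x y).
Proof. by move=> a x x'; rewrite /b linearP; apply: tpure_linl. Qed.
Let b_linr i j n (h : i + j = n) x : linear (b h x).
Proof. by move=> a y y'; rewrite /b linearP; apply: tpure_linr. Qed.
Let b_bal n i p j ip pj (h1 : i + p = ip) (h2 : ip + j = n)
    (h3 : p + j = pj) (h4 : i + pj = n) x r y :
  b h2 (ract M h1 x r) y = b h4 x (lact N h3 r y).
Proof. by rewrite /b rh_act lh_act (tpure_bal h1 h2 h3 h4). Qed.
Let b_d i j k i' j' k' (h : i + j = k)
    (hi : i' + 1 = i) (hj : j' + 1 = j) (hk : k' + 1 = k)
    (h1 : i' + j = k') (h2 : i + j' = k') x y :
  cx_d (tens_cx M' N') hk (b h x y) =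
    b h1 (cx_d M hi x) y + ksgn K i *: b h2 x (cx_d N hj y).
Proof. by rewrite /b /= (tens_leibniz h hi hj hk h1 h2) !cm_d. Qed.

Definition tens_map : cmap (tens_cx M N) (tens_cx M' N') :=
  @tens_lift K R M N (tens_cx M' N') b b_linl b_linr b_bal b_d.
Lemma tens_map_tpure n i j (h : i + j = n) x y :
  tens_map n (tpure h x y) = tpure h (f i x) (g j y).
Proof. exact: tens_lift_tpure. Qed.
End Map.
End TensorMaps.

Section RightCone.
Variables (K : comPzRingType) (R : dga K) (A B : rdgmod R) (f : rdg_hom A B).

Lemma rcone_deg (i j k : int) : i + j = k -> i - 1 + j = k - 1.
Proof. by lia. Qed.

Lemma ract_cast (M : rdgmod R) i i' j k k' (h : i + j = k) (h' : i' + j = k')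
    (ei : i = i') (ek : k = k') (x : M i) r :
  ract M h' (cxcast ei x) r = cxcast ek (ract M h x r).
Proof.
case: i' / ei h' => h'; case: k' / ek h' => h'.
by rewrite !cxcast_id (eq_irrelevance h' h).
Qed.

(** The shift sits on the left of [A], so the right action carries over without sign. In [lcone] a
    scalar of degree [i] has to cross the shift, which costs [(-1)^i]. *)
Definition rcone : rdgmod R.
Proof.
refine (@RDgMod K R (cone_cx f) (fun i j k h (x : cone_deg A B i) r =>
  (ract A (rcone_deg h) x.1 r, ract B h x.2 r) : cone_deg A B k) _ _ _ _ _).
- by move=> i j k h r a [x y] [x' y']; congr pair; rewrite /= ract_linl.
- by move=> i j k h [x y] a r r'; congr pair; rewrite /= ract_linr.
- move=> a b c ab bc abc h1 h2 h3 h4 [x y] r s; congr pair => /=.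
    exact: ractA.
  exact: ractA.
- move=> i h [x y]; congr pair => /=; last exact: ract1.
  by rewrite (eq_irrelevance (rcone_deg h) (addr0 _)) ract1.
move=> i j k i' j' k' h hi hj hk h1 h2 [x y] r; congr pair; rewrite /=.
  have e1 : i' - 1 + j = k' - 1 by lia.
  have e2 : i - 1 + j' = k' - 1 by lia.
  rewrite (ract_leibniz (rcone_deg h) (cone_deg1 hi) hj _ e1 e2).
  rewrite (eq_irrelevance (rcone_deg h1) e1) (eq_irrelevance (rcone_deg h2) e2).
  have es : - ksgn K (i - 1) = ksgn K i.
    by rewrite ksgnD ksgnN ksgn1 mulrN1 opprK.
  by rewrite opprD -scaleNr es -ractNl.
rewrite rh_act (ract_leibniz h hi hj hk h1 h2) ractDl addrA.
by rewrite (ract_cast (rcone_deg h) h1 _ (cone_deg2 hk)).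
Defined.

Lemma rinc1_deg (i j : int) : i + 1 = j -> i = j - 1. Proof. by lia. Qed.
Lemma deg0 (i j : int) : i + 0 = j -> i = j. Proof. by lia. Qed.

Definition rinc1_fun i j (h : i + 1 = j) (x : A i) : rcone j :=
  (cxcast (rinc1_deg h) x, 0).
Lemma rinc1_linear i j (h : i + 1 = j) : linear (rinc1_fun h).
Proof.
by move=> a x y; congr pair; rewrite /= ?scaler0 ?addr0 // linearP.
Qed.
HB.instance Definition _ i j (h : i + 1 = j) :=
  GRing.isLinear.Build K (A i) (rcone j) *:%R (rinc1_fun h) (rinc1_linear h).

Definition rinc2_fun i j (h : i + 0 = j) (x : B i) : rcone j :=
  (0, cxcast (deg0 h) x).
Lemma rinc2_linear i j (h : i + 0 = j) : linear (rinc2_fun h).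
Proof.
by move=> a x y; congr pair; rewrite /= ?scaler0 ?addr0 // linearP.
Qed.
HB.instance Definition _ i j (h : i + 0 = j) :=
  GRing.isLinear.Build K (B i) (rcone j) *:%R (rinc2_fun h) (rinc2_linear h).

Definition rproj1_fun i j (h : i + -1 = j) (x : rcone i) : A j :=
  cxcast h (x : cone_deg A B i).1.
Lemma rproj1_linear i j (h : i + -1 = j) : linear (rproj1_fun h).
Proof. by move=> a [x x'] [y y']; rewrite /rproj1_fun linearP. Qed.
HB.instance Definition _ i j (h : i + -1 = j) :=
  GRing.isLinear.Build K (rcone i) (A j) *:%R (rproj1_fun h) (rproj1_linear h).

Definition rproj2_fun i j (h : i + 0 = j) (x : rcone i) : B j :=
  cxcast (deg0 h) (x : cone_deg A B i).2.
Lemma rproj2_linear i j (h : i + 0 = j) : linear (rproj2_fun h).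
Proof. by move=> a [x x'] [y y']; rewrite /rproj2_fun linearP. Qed.
HB.instance Definition _ i j (h : i + 0 = j) :=
  GRing.isLinear.Build K (rcone i) (B j) *:%R (rproj2_fun h) (rproj2_linear h).

Lemma rinc1_act i p ip j jp (hi : i + p = ip) (h : i + 1 = j)
  (hj : j + p = jp) (h' : ip + 1 = jp) x r :
  rinc1_fun h' (ract A hi x r) = ract rcone hj (rinc1_fun h x) r.
Proof.
congr pair; last by rewrite /= ract0l.
by rewrite (ract_cast hi _ _ (rinc1_deg h')).
Qed.
Lemma rinc2_act i p ip j jp (hi : i + p = ip) (h : i + 0 = j)
  (hj : j + p = jp) (h' : ip + 0 = jp) x r :
  rinc2_fun h' (ract B hi x r) = ract rcone hj (rinc2_fun h x) r.
Proof.
congr pair; first by rewrite /= ract0l.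
by rewrite (ract_cast hi _ _ (deg0 h')).
Qed.
Lemma rproj1_act i p ip j jp (hi : i + p = ip) (h : i + -1 = j)
  (hj : j + p = jp) (h' : ip + -1 = jp) (x : rcone i) r :
  rproj1_fun h' (ract rcone hi x r) = ract A hj (rproj1_fun h x) r.
Proof. by rewrite /rproj1_fun (ract_cast (rcone_deg hi) _ _ h'). Qed.
Lemma rproj2_act i p ip j jp (hi : i + p = ip) (h : i + 0 = j)
  (hj : j + p = jp) (h' : ip + 0 = jp) (x : rcone i) r :
  rproj2_fun h' (ract rcone hi x r) = ract B hj (rproj2_fun h x) r.
Proof. by rewrite /rproj2_fun (ract_cast hi _ _ (deg0 h')). Qed.

Variable F : ldgmod R.
Lemma degN (i j : int) : i + 1 = j -> j + -1 = i. Proof. by lia. Qed.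

Definition tinc1 i j (h : i + 1 = j) : {linear tens A F i -> tens rcone F j} :=
  @tensl K R A rcone F 1 rinc1_fun rinc1_act i j h.
Definition tinc2 i : {linear tens B F i -> tens rcone F i} :=
  @tensl K R B rcone F 0 rinc2_fun rinc2_act i i (addr0 i).
Definition tproj1 i j (h : i + 1 = j) : {linear tens rcone F j -> tens A F i} :=
  @tensl K R rcone A F (-1) rproj1_fun rproj1_act j i (degN h).
Definition tproj2 i : {linear tens rcone F i -> tens B F i} :=
  @tensl K R rcone B F 0 rproj2_fun rproj2_act i i (addr0 i).

Lemma tinc1_tpure i j p p' q (h : i + 1 = j) (e : p + q = i) (hp : p + 1 = p')
    (e' : p' + q = j) x y :
  tinc1 h (tpure e x y) = tpure e' (rinc1_fun hp x) y.
Proof. exact: tensl_tpure. Qed.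
Lemma tinc2_tpure i p q (e : p + q = i) x y :
  tinc2 i (tpure e x y) = tpure e (rinc2_fun (addr0 p) x) y.
Proof. exact: tensl_tpure. Qed.
Lemma tproj1_tpure i j p p' q (h : i + 1 = j) (e : p + q = j) (hp : p - 1 = p')
    (e' : p' + q = i) (x : rcone p) y :
  tproj1 h (tpure e x y) = tpure e' (rproj1_fun hp x) y.
Proof. exact: tensl_tpure. Qed.
Lemma tproj2_tpure i p q (e : p + q = i) (x : rcone p) y :
  tproj2 i (tpure e x y) = tpure e (rproj2_fun (addr0 p) x) y.
Proof. exact: tensl_tpure. Qed.

(** The cone of [f] is acyclic and stays so after tensoring with [F]. The result carries the induced
    inclusions and projections, which is all that [cone_chase] asks for. *)
Lemma Kflat_qi : Kflat F -> quasi_iso f -> quasi_iso (tens_map f (lh_id F)).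
Proof.
move=> flF qf.
apply: (@cone_chase K (tens_cx A F) (tens_cx B F) (tens_cx rcone F)
   (tens_map f (lh_id F)) (fun i j h => tinc1 h) tinc2 (fun i j h => tproj1 h)
   tproj2); last by apply: flF; apply: cone_acyclic.
- move=> i j k hj hk; elim/tens_ind=> [|x y IHx IHy|a x IHx|p q e x y].
  + by rewrite !linear0 addr0.
  + by rewrite !linearD IHx IHy addrACA.
  + by rewrite !linearZ /= IHx scalerBr scalerN.
  have e1 : p + 1 + q = j by lia.
  have e2 : p - 1 + q = k by lia.
  have e3 : p + (q - 1) = k by lia.
  have e4 : p + 1 + (q - 1) = i by lia.
  rewrite tens_map_tpure tinc2_tpure (tinc1_tpure _ _ erefl e1).
  rewrite [LHS](tens_leibniz e1 (erefl : p + 1 = p + 1) (deg_pred q) hj e e4).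
  rewrite /= (tens_leibniz e (deg_pred p) (deg_pred q) hk e2 e3).
  rewrite [tinc1 hk _]linearD [tinc1 hk (_ *: _)]linearZZ.
  rewrite (tinc1_tpure _ _ (deg_pred p) e).
  rewrite (tinc1_tpure _ _ erefl e4).
  rewrite opprD addrA -scaleNr ksgnD ksgn1 mulrN1; congr (_ + _).
  rewrite -scaleN1r -tpureZl -tpureDl; congr (tpure _ _ _).
  rewrite scaleN1r; congr pair; rewrite /= ?sub0r ?linear0 ?addr0 ?subr0.
    congr (- _); exact: cxcast_d.
  by rewrite cxcast_map cxcast_comp ?cxcast_id.
- by move=> i j h; rewrite linear0.
- move=> i j h; elim/tens_ind=> [|x y IHx IHy|a x IHx|p q e x y].
  + by rewrite !linear0.
  + by rewrite !linearD IHx IHy.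
  + by rewrite !linearZ /= IHx.
  have e1 : p - 1 + q = j by lia.
  have e2 : p + (q - 1) = j by lia.
  rewrite tinc2_tpure [LHS](tens_leibniz e (deg_pred p) (deg_pred q) h e1 e2).
  rewrite /= (tens_leibniz e (deg_pred p) (deg_pred q) h e1 e2).
  rewrite [tinc2 j _]linearD [tinc2 j (_ *: _)]linearZZ !tinc2_tpure.
  congr (tpure _ _ _ + _).
  congr pair; rewrite /=; first by rewrite linear0 oppr0.
  by rewrite !linear0 add0r ?cxcast_id.
- move=> i j k hj hk; elim/tens_ind=> [|x y IHx IHy|a x IHx|p q e x y].
  + by rewrite !linear0.
  + by rewrite !linearD IHx IHy.
  + by rewrite !linearZ /= IHx scalerN.
  have e1 : p - 1 + q = i by lia.
  have e2 : p + (q - 1) = i by lia.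
  have e3 : p - 1 - 1 + q = k by lia.
  have e4 : p - 1 + (q - 1) = k by lia.
  rewrite [cx_d _ hj _](tens_leibniz e (deg_pred p) (deg_pred q) hj e1 e2).
  rewrite [tproj1 hk _]linearD [tproj1 hk (_ *: _)]linearZZ.
  rewrite (tproj1_tpure _ _ erefl e3) (tproj1_tpure _ _ erefl e4).
  rewrite (tproj1_tpure _ _ erefl e1).
  rewrite (tens_leibniz e1 (deg_pred _) (deg_pred q) hk e3 e4).
  rewrite opprD -scaleNr; congr (_ + _ *: _).
    rewrite -scaleN1r -tpureZl; congr (tpure _ _ _).
    rewrite /rproj1_fun /= ?cxcast_id scaleN1r; congr (- _); exact: cx_d_irr.
  by rewrite ksgnD ksgnN ksgn1 mulrN1 opprK.
- move=> i j h; elim/tens_ind=> [|x y IHx IHy|a x IHx|p q e x y].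
  + by rewrite !linear0 addr0.
  + by rewrite !linearD IHx IHy addrACA.
  + by rewrite !linearZ /= IHx scalerDr.
  have e1 : p - 1 + q = j by lia.
  have e2 : p + (q - 1) = j by lia.
  rewrite [cx_d _ h _](tens_leibniz e (deg_pred p) (deg_pred q) h e1 e2).
  rewrite [tproj2 j _]linearD [tproj2 j (_ *: _)]linearZZ.
  rewrite !tproj2_tpure (tproj1_tpure _ _ erefl e1).
  rewrite tens_map_tpure (tens_leibniz e (deg_pred p) (deg_pred q) h e1 e2).
  rewrite addrAC -tpureDl; congr (tpure _ _ _ + _).
  rewrite /rproj2_fun /rproj1_fun /= ?cxcast_id; exact: addrC.
- move=> i j h; elim/tens_ind=> [|x y IHx IHy|a x IHx|p q e x y].
  + by rewrite !linear0.
  + by rewrite !linearD IHx IHy.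
  + by rewrite !linearZ /= IHx.
  have e1 : p + 1 + q = j by lia.
  have e2 : p + 1 - 1 = p by lia.
  rewrite (tinc1_tpure _ _ erefl e1) (tproj1_tpure _ _ e2 e).
  by rewrite /rproj1_fun /= cxcast_comp cxcast_id.
- move=> i j h; elim/tens_ind=> [|x y IHx IHy|a x IHx|p q e x y].
  + by rewrite !linear0.
  + by rewrite !linearD IHx IHy addr0.
  + by rewrite !linearZ /= IHx scaler0.
  have e1 : p - 1 + q = i by lia.
  rewrite tinc2_tpure (tproj1_tpure _ _ erefl e1).
  by rewrite /rproj1_fun /= tpure0l.
move=> i; elim/tens_ind=> [|x y IHx IHy|a x IHx|p q e x y].
+ by rewrite !linear0.
+ by rewrite !linearD IHx IHy.
+ by rewrite !linearZ /= IHx.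
by rewrite tinc2_tpure tproj2_tpure /rproj2_fun /= ?cxcast_id.
Qed.
End RightCone.

Lemma gh_cast (K : comPzRingType) (R : dga K) (M N : ldgmod R) n
    (f : ghom M N n) i j j' (h : i + n = j) (h' : i + n = j') (e : j = j') x :
  cxcast e (gh_fun f h x) = gh_fun f h' x.
Proof. by case: j' / e h' => h'; rewrite cxcast_id (gh_irr f h h'). Qed.

Lemma lact_cast (K : comPzRingType) (R : dga K) (M : ldgmod R) i j j' k k'
    (h : i + j = k) (h' : i + j' = k') (ej : j = j') (ek : k = k') r (x : M j) :
  lact M h' r (cxcast ej x) = cxcast ek (lact M h r x).
Proof.
case: j' / ej h' => h'; case: k' / ek h' => h'.
by rewrite !cxcast_id (eq_irrelevance h' h).
Qed.

(** * Cones of left modules and the functor Hom out of a K-projective module *)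

Section LeftCone.
Variables (K : comPzRingType) (R : dga K) (A B : ldgmod R) (f : ldg_hom A B).

Lemma lcone_deg (i j k : int) : i + j = k -> i + (j - 1) = k - 1.
Proof. by lia. Qed.

Definition lcone : ldgmod R.
Proof.
refine (@LDgMod K R (cone_cx f) (fun i j k h r (x : cone_deg A B j) =>
  (ksgn K i *: lact A (lcone_deg h) r x.1, lact B h r x.2) : cone_deg A B k)
  _ _ _ _ _).
- move=> i j k h [x y] a r r'; congr pair; rewrite /= lact_linl //.
  by rewrite scalerDr !scalerA mulrC.
- move=> i j k h r a [x y] [x' y']; congr pair; rewrite /= lact_linr //.
  by rewrite scalerDr !scalerA mulrC.
- move=> a b c ab bc abc h1 h2 h3 h4 r s [x y]; congr pair; rewrite /=.
    rewrite lactZr scalerA -ksgnD h1; congr (_ *: _); exact: lactA.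
  exact: lactA.
- move=> i h [x y]; congr pair => /=; last exact: lact1.
  by rewrite /ksgn expr0 scale1r (eq_irrelevance (lcone_deg h) (add0r _)) lact1.
move=> i j k i' j' k' h hi hj hk h1 h2 r [x y]; congr pair; rewrite /=.
  have e1 : i' + (j - 1) = k' - 1 by lia.
  have e2 : i + (j' - 1) = k' - 1 by lia.
  rewrite linearZZ (lact_leibniz (lcone_deg h) hi (cone_deg1 hj) _ e1 e2).
  rewrite (eq_irrelevance (lcone_deg h1) e1) (eq_irrelevance (lcone_deg h2) e2).
  have es : - ksgn K i = ksgn K i' by rewrite -hi ksgnD ksgn1 mulrN1 opprK.
  by rewrite lactNr scalerDr opprD -scaleNr es !scalerN.
rewrite (lact_leibniz h hi hj hk h1 h2) lactDr scalerDr linearZZ linearZZ lh_act.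
rewrite (lact_cast (lcone_deg h) h2 _ (cone_deg2 hk)).
by rewrite addrCA.
Defined.

Variable P : ldgmod R.

Section Post.
Variable n : int.
Definition hom_post_fun (u : ghom P A n) : ghom P B n.
Proof.
refine (@GHom K R P B n (fun i j h x => f j (gh_fun u h x)) _ _).
- by move=> i j h a x y; rewrite gh_lin linearP.
- move=> p i j k l h1 h2 h3 h4 r x.
  by rewrite (gh_act u h1 h2 h3 h4) linearZZ lh_act.
Defined.
Lemma hom_post_linear : linear hom_post_fun.
Proof. by move=> a u v; apply: ghomP => i j h x /=; rewrite linearP. Qed.
HB.instance Definition _ :=
  GRing.isLinear.Build K (ghom P A n) (ghom P B n) *:%R hom_post_fun hom_post_linear.
End Post.

Lemma hom_post_d i j (h : j + 1 = i) (u : ghom P A i) :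
  hom_post_fun (cx_d (hom_cx P A) h u) = cx_d (hom_cx P B) h (hom_post_fun u).
Proof. by apply: ghomP => k l e x /=; rewrite linearB linearZZ cm_d. Qed.

Definition hom_post : cmap (hom_cx P A) (hom_cx P B) :=
  @CMap K (hom_cx P A) (hom_cx P B) (fun n => @hom_post_fun n) hom_post_d.

Section Inclusions.
Variables (i j : int) (hij : i + 1 = j).

Lemma linc1_deg (p q : int) : p + j = q -> p + i = q - 1. Proof. by lia. Qed.
Definition linc1 (u : ghom P A i) : ghom P lcone j.
Proof.
refine (@GHom K R P lcone j (fun p q h x =>
  (gh_fun u (linc1_deg h) x, 0) : cone_deg A B q) _ _).
- move=> p q h a x y; congr pair; rewrite /= ?gh_lin //.
  by rewrite scaler0 addr0.
- move=> p k l m n h1 h2 h3 h4 r x.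
  congr pair; rewrite /=; last by rewrite lact0r scaler0.
  rewrite (gh_act u h1 (linc1_deg h2) (linc1_deg h3) (lcone_deg h4)).
  rewrite scalerA -ksgnD; congr (_ *: _).
  (* [i p] and [(i + 1) p + p] have the same parity: the sign in the action on the cone absorbs the
     change of degree from [i] to [i + 1]. *)
  by rewrite -hij mulrDl mul1r; apply/esym/(@ksgn_eq _ _ _ p).
Defined.

Lemma lproj1_deg (p q : int) : p + i = q -> p + j = q + 1. Proof. by lia. Qed.
Definition lproj1_fun (u : ghom P lcone j) : ghom P A i.
Proof.
refine (@GHom K R P A i (fun p q h x =>
  cxcast (addrK 1 q) (gh_fun u (lproj1_deg h) x : cone_deg A B (q + 1)).1) _ _).
- by move=> p q h a x y; rewrite gh_lin linearP.
- move=> p k l m n h1 h2 h3 h4 r x.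
  have e : p + (l + 1) = n + 1 by lia.
  rewrite (gh_act u h1 (lproj1_deg h2) (lproj1_deg h3) e).
  rewrite /= !cxcastZ scalerA -ksgnD.
  rewrite (lact_cast (lcone_deg e) h4 (addrK 1 l) (addrK 1 n)).
  by congr (_ *: _); apply: (@ksgn_eq _ _ _ p); rewrite -hij mulrDl mul1r.
Defined.
Lemma lproj1_linear : linear lproj1_fun.
Proof. by move=> a u v; apply: ghomP => p q h x /=; rewrite linearP. Qed.
HB.instance Definition _ :=
  GRing.isLinear.Build K (ghom P lcone j) (ghom P A i) *:%R lproj1_fun lproj1_linear.
End Inclusions.

Definition linc2_fun n (u : ghom P B n) : ghom P lcone n.
Proof.
refine (@GHom K R P lcone n (fun p q h x =>
  (0, gh_fun u h x) : cone_deg A B q) _ _).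
- move=> p q h a x y; congr pair; rewrite /= ?gh_lin //.
  by rewrite scaler0 addr0.
- move=> p k l m n' h1 h2 h3 h4 r x.
  congr pair; rewrite /=; first by rewrite lact0r !scaler0.
  exact: gh_act.
Defined.
Lemma linc2_linear n : linear (@linc2_fun n).
Proof.
by move=> a u v; apply: ghomP => p q h x; congr pair; rewrite /= scaler0 addr0.
Qed.
HB.instance Definition _ n :=
  GRing.isLinear.Build K (ghom P B n) (ghom P lcone n) *:%R (@linc2_fun n)
    (@linc2_linear n).

Definition lproj2_fun n (u : ghom P lcone n) : ghom P B n.
Proof.
refine (@GHom K R P B n (fun p q h x =>
  (gh_fun u h x : cone_deg A B q).2) _ _).
- by move=> p q h a x y; rewrite gh_lin.
- by move=> p k l m n' h1 h2 h3 h4 r x; rewrite (gh_act u h1 h2 h3 h4).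
Defined.
Lemma lproj2_linear n : linear (@lproj2_fun n).
Proof. by move=> a u v; apply: ghomP. Qed.
HB.instance Definition _ n :=
  GRing.isLinear.Build K (ghom P lcone n) (ghom P B n) *:%R (@lproj2_fun n)
    (@lproj2_linear n).

(** The same cone argument as for [Kflat_qi], with [Hom(P, -)] in place of the tensor product. *)
Lemma Kproj_qi : Kprojective P -> quasi_iso f -> quasi_iso hom_post.
Proof.
move=> pP qf.
apply: (@cone_chase K (hom_cx P A) (hom_cx P B) (hom_cx P lcone) hom_post
   linc1 (fun n => @linc2_fun n) lproj1_fun (fun n => @lproj2_fun n));
  last by apply: pP; apply: cone_acyclic.
- move=> i j k hj hk u; apply: ghomP => p q h x.
  have e1 : p + j = q + 1 by lia.
  have e2 : p - 1 + j = q by lia.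
  have e3 : p + i = q + 1 - 1 by lia.
  have e4 : p - 1 + i = q - 1 by lia.
  have dE := ghom_dE hk u (linc1_deg hk h) e3 e4 (deg_pred p) (cone_deg1 erefl) x.
  have ekj : - ksgn K j = ksgn K i by rewrite -hj ksgnD ksgn1 mulrN1 opprK.
  rewrite (ghom_dE _ _ _ e1 e2 (deg_pred p) erefl).
  congr pair.
    transitivity (0 - gh_fun (cx_d (hom_cx P A) hk u) (linc1_deg hk h) x).
      rewrite dE /= (gh_irr u _ e3) (gh_irr u _ e4) -[- (ksgn K j *: _)]scaleNr ekj.
      rewrite sub0r opprB; exact: addrC.
    by rewrite /= scaleN1r.
  rewrite /= !scaler0 linear0 !addr0 subr0 -cxcast_map; congr (f _ _).
  exact: gh_cast.
- by move=> i j h; apply: ghomP.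
- move=> i j h u; apply: ghomP => p q e x; congr pair => /=.
    by rewrite linear0 scaler0 subr0 oppr0.
  by rewrite !linear0 add0r.
- move=> i j k hj hk u; apply: ghomP => p q h x.
  have e1 : p + i = q + 1 by lia.
  have e2 : p - 1 + i = q by lia.
  have e3 : p + j = q + 1 + 1 by lia.
  have e4 : p - 1 + j = q + 1 by lia.
  have dE := ghom_dE hj u (lproj1_deg hk h) e3 e4 (deg_pred p) erefl x.
  have dE' := ghom_dE hk (lproj1_fun hj u) h e1 e2 (deg_pred p) erefl x.
  have ekj : - ksgn K j = ksgn K i by rewrite -hj ksgnD ksgn1 mulrN1 opprK.
  transitivity (cxcast (addrK 1 q)
    (gh_fun (cx_d (hom_cx P lcone) hj u) (lproj1_deg hk h) x
       : cone_deg A B (q + 1)).1) => //.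
  transitivity (-1 *: gh_fun (cx_d (hom_cx P A) hk (lproj1_fun hj u)) h x) => //.
  rewrite dE dE' scaleN1r /= (gh_irr u _ e3) (gh_irr u _ e4).
  rewrite (cxcast_d _ (addrK 1 q) (cone_deg1 erefl)).
  rewrite [cxcast _ (_ - _)]linearB /= [cxcast _ (- _)]linearN /= cxcastZ.
  rewrite -[- (ksgn K j *: _)]scaleNr ekj opprB.
  exact: addrC.
- move=> i j h u; apply: ghomP => p q e x.
  have e1 : p + i = q + 1 by lia.
  have e2 : p - 1 + i = q by lia.
  have dE := ghom_dE h u e e1 e2 (deg_pred p) erefl x.
  have dE' := ghom_dE h (lproj2_fun u) e e1 e2 (deg_pred p) erefl x.
  transitivity (gh_fun (cx_d (hom_cx P lcone) h u) e x : cone_deg A B q).2 => //.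
  transitivity (gh_fun (cx_d (hom_cx P B) h (lproj2_fun u)) e x +
    gh_fun (hom_post j (lproj1_fun h u)) e x) => //.
  rewrite dE dE' /= cxcast_map (gh_irr u _ e1) [RHS]addrC addrA.
  congr (_ + _ + _); exact: cxcast_irr.
- by move=> i j h u; apply: ghomP => p q e x /=; apply: gh_cast.
- by move=> i j h u; apply: ghomP => p q e x /=; apply: linear0.
- by move=> i u; apply: ghomP.
Qed.
End LeftCone.

(** * The opposite algebra and right resolutions *)

Section Opposite.
Variable K : comPzRingType.

Lemma deg_swap (i j k : int) : i + j = k -> j + i = k. Proof. by lia. Qed.

Lemma ksgn_swapl (i i' j : int) : i' + 1 = i ->
  ksgn K (i' * j) = ksgn K (i * j) * ksgn K j.
Proof. by move=> <-; rewrite mulrDl mul1r ksgnD -mulrA ksgnK mulr1. Qed.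
Lemma ksgn_swapr (i j j' : int) : j' + 1 = j ->
  ksgn K i * ksgn K (i * j') = ksgn K (i * j).
Proof. by move=> <-; rewrite mulrDr mulr1 ksgnD mulrC. Qed.
(** Both sides are the Koszul sign of reversing three factors, computed in two ways. *)
Lemma ksgn_swapA (a b c ab bc : int) : a + b = ab -> b + c = bc ->
  ksgn K (a * bc) * ksgn K (b * c) = ksgn K (ab * c) * ksgn K (a * b).
Proof. by move=> <- <-; rewrite -!ksgnD; congr ksgn; ring. Qed.

Definition rop (R : dga K) : dga K.
Proof.
refine (@Dga K R (fun i j k h r s => ksgn K (i * j) *: dga_mul R (deg_swap h) s r)
  (dga_one R) _ _ _ _ _ _).
- move=> i j k h s a r r'.
  by rewrite dmulDr dmulZr scalerDr !scalerA (mulrC a).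
- move=> i j k h r a s s'.
  by rewrite dmulDl dmulZl scalerDr !scalerA (mulrC a).
- move=> a b c ab bc abc h1 h2 h3 h4 r s t.
  rewrite dmulZl dmulZr !scalerA (ksgn_swapA h1 h3); congr (_ *: _).
  exact/esym/dga_mulA.
- by move=> i h r; rewrite mul0r /ksgn expr0 scale1r dga_mul1r.
- by move=> i h r; rewrite mulr0 /ksgn expr0 scale1r dga_mul1l.
move=> i j k i' j' k' h hi hj hk h1 h2 r s; rewrite linearZZ.
rewrite (dga_leibniz (deg_swap h) hj hi hk (deg_swap h2) (deg_swap h1)).
rewrite scalerDr !scalerA (ksgn_swapl _ hi) (ksgn_swapr _ hj).
exact: addrC.
Defined.

Variable R : dga K.

Definition lmod_of_rmod (M : rdgmod R) : ldgmod (rop R).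
Proof.
refine (@LDgMod K (rop R) M
  (fun i j k h r x => ksgn K (i * j) *: ract M (deg_swap h) x r) _ _ _ _ _).
- move=> i j k h x a r r'.
  by rewrite ract_linr scalerDr !scalerA (mulrC a).
- move=> i j k h r a x x'.
  by rewrite ract_linl scalerDr !scalerA (mulrC a).
- move=> a b c ab bc abc h1 h2 h3 h4 r s x /=.
  rewrite ractZl ractZr !scalerA (ksgn_swapA h1 h3); congr (_ *: _).
  exact/esym/ractA.
- by move=> i h x; rewrite mul0r /ksgn expr0 scale1r ract1.
move=> i j k i' j' k' h hi hj hk h1 h2 r x; rewrite linearZZ.
rewrite (ract_leibniz (deg_swap h) hj hi hk (deg_swap h2) (deg_swap h1)).
rewrite scalerDr !scalerA (ksgn_swapl _ hi) (ksgn_swapr _ hj).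
exact: addrC.
Defined.

Definition rmod_of_lmod (N : ldgmod (rop R)) : rdgmod R.
Proof.
refine (@RDgMod K R N
  (fun i j k h x r => ksgn K (i * j) *: lact N (deg_swap h) (r : rop R _) x)
  _ _ _ _ _).
- move=> i j k h r a x x'.
  by rewrite lact_linr scalerDr !scalerA (mulrC a).
- move=> i j k h x a r r'.
  by rewrite (lact_linl (deg_swap h) x) scalerDr !scalerA (mulrC a).
- move=> a b c ab bc abc h1 h2 h3 h4 x r s.
  have e : ksgn K (ab * c) * ksgn K (a * b) * ksgn K (c * b) = ksgn K (a * bc).
    by rewrite -(ksgn_swapA h1 h3) [c * b]mulrC -mulrA ksgnK mulr1.
  rewrite lactZr scalerA (lactA (deg_swap h3) (deg_swap h4)) /=.
  rewrite (lactZl (deg_swap h4)) scalerA e; congr (_ *: lact N _ _ _).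
  by rewrite (eq_irrelevance (deg_swap (deg_swap h3)) h3).
- move=> i h x; rewrite mulr0 /ksgn expr0 scale1r; exact: lact1.
move=> i j k i' j' k' h hi hj hk h1 h2 x r; rewrite linearZZ.
rewrite (lact_leibniz (deg_swap h) hj hi hk (deg_swap h2) (deg_swap h1)).
rewrite scalerDr !scalerA (ksgn_swapl _ hi) (ksgn_swapr _ hj).
exact: addrC.
Defined.

(** Stated directly for left [R]-modules, so that no translation passes through [rop (rop R)], which
    agrees with [R] only after cancellation of signs. *)
Definition oprmod (X : ldgmod R) : rdgmod (rop R).
Proof.
refine (@RDgMod K (rop R) X
  (fun i j k h x r => ksgn K (i * j) *: lact X (deg_swap h) (r : R _) x)
  _ _ _ _ _).
- move=> i j k h r a x x'.
  by rewrite lact_linr scalerDr !scalerA (mulrC a).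
- move=> i j k h x a r r'.
  by rewrite lact_linl scalerDr !scalerA (mulrC a).
- move=> a b c ab bc abc h1 h2 h3 h4 x r s /=.
  rewrite lactZr lactZl !scalerA (ksgn_swapA h1 h3); congr (_ *: _).
  exact/esym/lactA.
- move=> i h x; rewrite mulr0 /ksgn expr0 scale1r; exact: lact1.
move=> i j k i' j' k' h hi hj hk h1 h2 x r; rewrite linearZZ.
rewrite (lact_leibniz (deg_swap h) hj hi hk (deg_swap h2) (deg_swap h1)).
rewrite scalerDr !scalerA (ksgn_swapl _ hi) (ksgn_swapr _ hj).
exact: addrC.
Defined.

Definition oprmod_hom (X Y : ldgmod R) (f : ldg_hom X Y) :
  rdg_hom (oprmod X) (oprmod Y).
Proof.
refine (@RDgHom K (rop R) (oprmod X) (oprmod Y) (lh_map f) _).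
by move=> i j k h x r; rewrite /= linearZZ lh_act.
Defined.

Section Swap.
Variables (Q : ldgmod (rop R)) (X : ldgmod R).
Local Notation PX := (tens_cx (rmod_of_lmod Q) X).
Local Notation XQ := (tens_cx (oprmod X) Q).

Let b i j n (h : i + j = n) (x : rmod_of_lmod Q i) (y : X j) : XQ n :=
  ksgn K (i * j) *: @tpure _ _ (oprmod X) Q n j i (deg_swap h) y x.
Let b_linl i j n (h : i + j = n) y : linear (fun x => b h x y).
Proof.
move=> a x x'; rewrite /b.
by rewrite (tpure_linr (M := oprmod X) (deg_swap h)) scalerDr !scalerA (mulrC a).
Qed.
Let b_linr i j n (h : i + j = n) x : linear (b h x).
Proof.
move=> a y y'; rewrite /b.
by rewrite (tpure_linl (M := oprmod X) (deg_swap h)) scalerDr !scalerA (mulrC a).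
Qed.
Let b_bal n i p j ip pj (h1 : i + p = ip) (h2 : ip + j = n)
    (h3 : p + j = pj) (h4 : i + pj = n) x r y :
  b h2 (ract (rmod_of_lmod Q) h1 x r) y = b h4 x (lact X h3 r y).
Proof.
rewrite /b /= tpureZr scalerA.
rewrite -(tpure_bal (M := oprmod X) (deg_swap h3) (deg_swap h4) (deg_swap h1)) /=.
rewrite tpureZl scalerA (eq_irrelevance (deg_swap (deg_swap h3)) h3).
congr (_ *: _); rewrite -!ksgnD -h1 -h3; apply: (@ksgn_eq _ _ _ (p * j)).
by ring.
Qed.
Let b_d i j k i' j' k' (h : i + j = k)
    (hi : i' + 1 = i) (hj : j' + 1 = j) (hk : k' + 1 = k)
    (h1 : i' + j = k') (h2 : i + j' = k') x y :
  cx_d XQ hk (b h x y) =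
    b h1 (cx_d (rmod_of_lmod Q) hi x) y + ksgn K i *: b h2 x (cx_d X hj y).
Proof.
rewrite /b linearZZ /=.
rewrite (tens_leibniz (M := oprmod X) (deg_swap h) hj hi hk (deg_swap h2)
  (deg_swap h1)).
rewrite scalerDr !scalerA (ksgn_swapl _ hi) (ksgn_swapr _ hj).
exact: addrC.
Qed.
Definition swap : cmap PX XQ :=
  @tens_lift K R (rmod_of_lmod Q) X XQ b b_linl b_linr b_bal b_d.
Lemma swap_tpure i j n (h : i + j = n) x y :
  swap n (@tpure _ _ (rmod_of_lmod Q) X n i j h x y) =
  ksgn K (i * j) *: @tpure _ _ (oprmod X) Q n j i (deg_swap h) y x.
Proof. exact: tens_lift_tpure. Qed.

Let c i j n (h : i + j = n) (y : oprmod X i) (x : Q j) : PX n :=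
  ksgn K (i * j) *: @tpure _ _ (rmod_of_lmod Q) X n j i (deg_swap h) x y.
Let c_linl i j n (h : i + j = n) x : linear (fun y => c h y x).
Proof.
move=> a y y'; rewrite /c.
by rewrite (tpure_linr (N := X) (deg_swap h)) scalerDr !scalerA (mulrC a).
Qed.
Let c_linr i j n (h : i + j = n) y : linear (c h y).
Proof.
move=> a x x'; rewrite /c.
by rewrite (tpure_linl (N := X) (deg_swap h)) scalerDr !scalerA (mulrC a).
Qed.
Let c_bal n i p j ip pj (h1 : i + p = ip) (h2 : ip + j = n)
    (h3 : p + j = pj) (h4 : i + pj = n) y r x :
  c h2 (ract (oprmod X) h1 y r) x = c h4 y (lact Q h3 r x).
Proof.
rewrite /c /= tpureZr scalerA.
rewrite -(tpure_bal (M := rmod_of_lmod Q) (N := X) (deg_swap h3) (deg_swap h4)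
  (deg_swap h1)) /=.
rewrite tpureZl scalerA (eq_irrelevance (deg_swap (deg_swap h3)) h3).
congr (_ *: _); rewrite -!ksgnD -h1 -h3; apply: (@ksgn_eq _ _ _ (p * j)).
by ring.
Qed.
Let c_d i j k i' j' k' (h : i + j = k)
    (hi : i' + 1 = i) (hj : j' + 1 = j) (hk : k' + 1 = k)
    (h1 : i' + j = k') (h2 : i + j' = k') y x :
  cx_d PX hk (c h y x) =
    c h1 (cx_d (oprmod X) hi y) x + ksgn K i *: c h2 y (cx_d Q hj x).
Proof.
rewrite /c linearZZ /=.
rewrite (tens_leibniz (M := rmod_of_lmod Q) (N := X)
  (deg_swap h) hj hi hk (deg_swap h2) (deg_swap h1)).
rewrite scalerDr !scalerA (ksgn_swapl _ hi) (ksgn_swapr _ hj).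
exact: addrC.
Qed.
Definition unswap : cmap XQ PX :=
  @tens_lift K (rop R) (oprmod X) Q PX c c_linl c_linr c_bal c_d.
Lemma unswap_tpure i j n (h : i + j = n) y x :
  unswap n (@tpure _ _ (oprmod X) Q n i j h y x) =
  ksgn K (i * j) *: @tpure _ _ (rmod_of_lmod Q) X n j i (deg_swap h) x y.
Proof. exact: tens_lift_tpure. Qed.

Lemma swap_qi : quasi_iso swap.
Proof.
apply: (@qi_iso _ _ _ swap (fun n => unswap n)) => n.
  apply: (tens_ext (f := unswap n \o swap n) (g := idfun)) => i j h x y.
  rewrite -[LHS]/(unswap n (swap n _)) swap_tpure linearZZ
    unswap_tpure scalerA (mulrC j) ksgnK scale1r.
  by rewrite (eq_irrelevance (deg_swap (deg_swap h)) h).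
apply: (tens_ext (f := swap n \o unswap n) (g := idfun)) => i j h x y.
rewrite -[LHS]/(swap n (unswap n _)) unswap_tpure linearZZ
  swap_tpure scalerA (mulrC j) ksgnK scale1r.
by rewrite (eq_irrelevance (deg_swap (deg_swap h)) h).
Qed.
End Swap.

(** Formulated as preservation of quasi-isomorphisms rather than of acyclicity: the cone argument
    has been carried out for maps of the left factor, and here it is the right factor that
    varies. *)
Definition rflat (P : rdgmod R) : Prop :=
  forall (X Y : ldgmod R) (f : ldg_hom X Y),
    quasi_iso f -> quasi_iso (tens_map (rh_id P) f).

(** The swap identifies the tensor product over [R] with one over [rop R] and turns a map of the
    right factor into a map of the left factor, where [Kflat_qi] applies. *)
Lemma rmod_of_lmod_flat (Q : ldgmod (rop R)) : Kflat Q -> rflat (rmod_of_lmod Q).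
Proof.
move=> fQ X Y f qf; apply: (qi_cancel_l (swap_qi Q Y)).
have qT := Kflat_qi (f := oprmod_hom f) fQ qf.
apply: qi_ext (qi_comp qT (swap_qi Q X)) => n.
apply: (tens_ext (f := tens_map (oprmod_hom f) (lh_id Q) n \o swap Q X n)
  (g := swap Q Y n \o tens_map (rh_id (rmod_of_lmod Q)) f n)) => i j h x y.
rewrite -[LHS]/(tens_map (oprmod_hom f) (lh_id Q) n (swap Q X n _)).
rewrite -[RHS]/(swap Q Y n (tens_map (rh_id (rmod_of_lmod Q)) f n _)).
by rewrite tens_map_tpure !swap_tpure linearZZ tens_map_tpure.
Qed.

(** A right module is a left module over the opposite algebra, where the semi-free resolution is
    available; the two Koszul signs met on the way there and back cancel. *)
Lemma rflat_resolution (M : rdgmod R) :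
  exists (P : rdgmod R) (p : rdg_hom P M), rflat P /\ quasi_iso p.
Proof.
pose Q := semifree (lmod_of_rmod M).
pose q := semifree_map (lmod_of_rmod M).
have q_act i j k (h : i + j = k) (x : rmod_of_lmod Q i) (r : R j) :
    lh_map q k (ract (rmod_of_lmod Q) h x r) = ract M h (lh_map q i x) r.
  rewrite [LHS]linearZZ lh_act /= scalerA (mulrC j) ksgnK scale1r.
  by rewrite (eq_irrelevance (deg_swap (deg_swap h)) h).
exists (rmod_of_lmod Q), (@RDgHom K R (rmod_of_lmod Q) M (lh_map q) q_act).
by split; [apply/rmod_of_lmod_flat/semifree_Kflat|apply: semifree_qi].
Qed.
End Opposite.

(** * Homotopies *)

Section Homotopy.
Variables (K : comPzRingType) (R : dga K).
Implicit Types M N P Q : ldgmod R.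

Definition gh_of M N (f : ldg_hom M N) : ghom M N 0.
Proof.
refine (@GHom K R M N 0 (fun i j h x => cxcast (deg0 h) (f i x)) _ _).
- by move=> i j h a x y; rewrite !linearP.
- move=> p i j k l h1 h2 h3 h4 r x.
  rewrite mul0r /ksgn expr0 scale1r lh_act.
  by rewrite (lact_cast h1 h4 (deg0 h2) (deg0 h3)).
Defined.

Lemma gh_of_cycle M N (f : ldg_hom M N) :
  @cycle K (hom_cx M N) 0 (gh_of f).
Proof.
apply: ghom_cycleI => i j e e' x.
by rewrite /ksgn expr0 scale1r /= cm_d (cxcast_d _ (deg0 e') (deg_pred i)).
Qed.

Section HomOfCycle.
Variables (M N : ldgmod R) (u : ghom M N 0).
Hypothesis cu : @cycle K (hom_cx M N) 0 u.
Definition hom_of_fun i (x : M i) : N i := gh_fun u (addr0 i) x.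
Lemma hom_of_linear i : linear (@hom_of_fun i).
Proof. exact: gh_lin. Qed.
HB.instance Definition _ i :=
  GRing.isLinear.Build K (M i) (N i) *:%R (@hom_of_fun i) (@hom_of_linear i).
Lemma hom_of_d i j (h : j + 1 = i) x :
  hom_of_fun (cx_d M h x) = cx_d N h (hom_of_fun x).
Proof. by rewrite [RHS](ghom_cycleE cu _ (addr0 j) h) /ksgn expr0 scale1r. Qed.
Lemma hom_of_act i j k (h : i + j = k) (r : R i) x :
  hom_of_fun (lact M h r x) = lact N h r (hom_of_fun x).
Proof. by rewrite [LHS](gh_act u h (addr0 j) _ h) mul0r /ksgn expr0 scale1r. Qed.
Definition hom_of : ldg_hom M N :=
  @LDgHom K R M N (@CMap K M N (fun i => @hom_of_fun i) hom_of_d) hom_of_act.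
End HomOfCycle.

(** Homotopy classes of maps are the degree-zero homology of the Hom complex. This translates
    quasi-isomorphisms of Hom complexes into existence and uniqueness of maps up to homotopy. *)
Lemma homotopicP M N (f g : ldg_hom M N) :
  homotopic f g <-> @boundary K (hom_cx M N) 0 (gh_of f - gh_of g).
Proof.
have s1 : ksgn K 1 = -1 by rewrite ksgn1.
split=> [[s sP]|[k [h [s sP]]]].
  exists 1, erefl, s; apply: ghomP => i j e x.
  have e1 : i + 1 = j + 1 by lia.
  have e2 : i - 1 + 1 = j by lia.
  rewrite (ghom_dE _ _ _ e1 e2 (deg_pred i) erefl) s1 scaleN1r opprK.
  rewrite /= scaleN1r -linearB /= (sP i (i - 1) (i + 1) (deg_pred i) erefl).
  move: (deg0 e) => {}e; case: j / e e1 e2 => e1 e2.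
  by rewrite cxcast_id (gh_irr s e1 erefl) (gh_irr s e2 (deg_pred i)).
have ek : k = 1 by lia.
move: h s sP; rewrite {k}ek => h s sP.
exists s => i j k hj hk x.
have := congr1 (fun u => gh_fun u (addr0 i) x) sP.
rewrite (ghom_dE _ _ _ hk hj hj hk) s1 scaleN1r opprK => ->.
by rewrite /= scaleN1r !cxcast_id.
Qed.

Lemma homotopic_sym M N (f g : ldg_hom M N) : homotopic f g -> homotopic g f.
Proof. by move=> /homotopicP b; apply/homotopicP; rewrite -opprB; apply: boundaryN. Qed.

Lemma homotopic_trans M N (g f h : ldg_hom M N) :
  homotopic f g -> homotopic g h -> homotopic f h.
Proof.
move=> /homotopicP b /homotopicP c; apply/homotopicP.
by rewrite -(subrK (gh_of g) (gh_of f)) -addrA; apply: boundaryD.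
Qed.

Lemma homotopic_compl M N P (h : ldg_hom N P) (f g : ldg_hom M N) :
  homotopic f g -> homotopic (lh_comp h f) (lh_comp h g).
Proof.
move=> [s sP]; exists (hom_post_fun h s) => i j k hj hk x /=.
by rewrite -linearB (sP i j k hj hk) linearD cm_d.
Qed.

Lemma homotopic_boundary M N (f g : ldg_hom M N) i (x : M i) :
  homotopic f g -> cycle x -> boundary (f i x - g i x).
Proof.
move=> [s sP] cx; rewrite (sP i (i - 1) (i + 1) (deg_pred i) erefl).
by rewrite cx gh0 addr0; apply: boundary_d.
Qed.

Section Precomposition.
Variables (Q P N : ldgmod R) (q : ldg_hom Q P).
Definition hom_pre_fun n (u : ghom P N n) : ghom Q N n.
Proof.
refine (@GHom K R Q N n (fun i j h x => gh_fun u h (q i x)) _ _).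
- by move=> i j h a x y; rewrite linearP gh_lin.
- by move=> p i j k l h1 h2 h3 h4 r x; rewrite lh_act (gh_act u h1 h2 h3 h4).
Defined.
Lemma hom_pre_linear n : linear (@hom_pre_fun n).
Proof. by move=> a u v; apply: ghomP. Qed.
HB.instance Definition _ n :=
  GRing.isLinear.Build K (ghom P N n) (ghom Q N n) *:%R (@hom_pre_fun n)
    (@hom_pre_linear n).
Lemma hom_pre_d i j (h : j + 1 = i) u :
  hom_pre_fun (cx_d (hom_cx P N) h u) = cx_d (hom_cx Q N) h (hom_pre_fun u).
Proof. by apply: ghomP => k l e x /=; rewrite cm_d. Qed.
Definition hom_pre : cmap (hom_cx P N) (hom_cx Q N) :=
  @CMap K (hom_cx P N) (hom_cx Q N) (fun n => @hom_pre_fun n) hom_pre_d.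
End Precomposition.

Lemma homotopic_compr M N P (h : ldg_hom M N) (f g : ldg_hom N P) :
  homotopic f g -> homotopic (lh_comp f h) (lh_comp g h).
Proof.
move=> [s sP]; exists (hom_pre_fun h s) => i j k hj hk x /=.
by rewrite (sP i j k hj hk) cm_d.
Qed.

(** For a cycle [u] of degree [n], the differential of [u s] is [(-1)^n u (d s + s d)]; hence
    [(-1)^n u s] is a primitive of [u f - u g]. *)
Lemma hom_pre_homotopic Q P N (f g : ldg_hom Q P) n (u : ghom P N n) :
  homotopic f g -> @cycle K (hom_cx P N) n u ->
  @boundary K (hom_cx Q N) n (hom_pre_fun f u - hom_pre_fun g u).
Proof.
move=> [s sP] cu.
have deg i j : i + (n + 1) = j -> i + 1 + n = j by lia.
have lin i j (h : i + (n + 1) = j) :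
    linear (fun x => gh_fun u (deg i j h) (gh_fun s (erefl (i + 1)) x)).
  by move=> a x y; rewrite !gh_lin.
have act p i j k l (h1 : p + i = k) (h2 : i + (n + 1) = j)
    (h3 : k + (n + 1) = l) (h4 : p + j = l) (r : R p) (x : Q i) :
  gh_fun u (deg k l h3) (gh_fun s (erefl (k + 1)) (lact Q h1 r x)) =
  ksgn K ((n + 1) * p) *: lact N h4 r
    (gh_fun u (deg i j h2) (gh_fun s (erefl (i + 1)) x)).
  have e : p + (i + 1) = k + 1 by lia.
  rewrite (gh_act s h1 erefl erefl e) ghZ (gh_act u e (deg i j h2) _ h4).
  by rewrite scalerA -ksgnD -mulrDl addrC.
pose us : ghom Q N (n + 1) := @GHom K R Q N (n + 1) _ lin act.
exists (n + 1), erefl, (ksgn K n *: us); apply: ghomP => i j e x.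
have e1 : i + (n + 1) = j + 1 by lia.
have e2 : i - 1 + (n + 1) = j by lia.
have e3 : i + 1 + n = j + 1 by lia.
have e4 : i - 1 + 1 = i by lia.
have e5 : i + 1 - 1 = i by lia.
rewrite (ghom_dE _ _ _ e1 e2 (deg_pred i) erefl) /=.
have e6 : i + 1 - 1 + n = j by lia.
have dus : cx_d N erefl (gh_fun u (deg i (j + 1) e1) (gh_fun s erefl x)) =
    ksgn K n *: gh_fun u e (cx_d P erefl (gh_fun s erefl x)).
  exact: (ghom_cycleE cu _ e erefl erefl).
rewrite linearZZ dus scalerA ksgnK scale1r ksgnD ksgn1 mulrN1 scaleNr opprK.
rewrite scalerA ksgnK scale1r scaleN1r.
have -> : gh_fun u e (f i x) - gh_fun u e (g i x) = gh_fun u e (f i x - g i x).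
  by rewrite ghD -scaleN1r -[in RHS]scaleN1r ghZ.
rewrite (sP i (i - 1) (i + 1) (deg_pred i) erefl) ghD; congr (_ + _).
have aux k (h : i - 1 + 1 = k) (h' : k + n = j) y :
    gh_fun u (deg (i - 1) j e2) (gh_fun s erefl y) = gh_fun u h' (gh_fun s h y).
  by case: k / h h' => h'; apply: gh_irr.
exact: aux.
Qed.

(** This is surjectivity of [Hom(P, q)] on degree-zero homology; the uniqueness lemma that follows
    is injectivity. *)
Lemma Kproj_lift (P X Y : ldgmod R) (q : ldg_hom X Y) (g : ldg_hom P Y) :
  Kprojective P -> quasi_iso q -> exists g', homotopic (lh_comp q g') g.
Proof.
move=> pP qq; have [u [cu bu]] := qi_surj (Kproj_qi pP qq) (@gh_of_cycle _ _ g).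
exists (hom_of cu); apply/homotopicP; move: bu; congr boundary.
congr (_ - _); apply: ghomP => i j h x /=.
by rewrite -(gh_cast u (addr0 i) h (deg0 h)) cxcast_map.
Qed.

Lemma Kproj_lift_uniq (P X Y : ldgmod R) (q : ldg_hom X Y) (a b : ldg_hom P X) :
  Kprojective P -> quasi_iso q -> homotopic (lh_comp q a) (lh_comp q b) ->
  homotopic a b.
Proof.
move=> pP qq /homotopicP h; apply/homotopicP.
apply: (qi_inj (Kproj_qi pP qq)).
  by apply: (cycleB (C := hom_cx P X)); apply: gh_of_cycle.
move: h; congr boundary; apply: ghomP => i j h x /=.
by rewrite linearD linearZZ /= !cxcast_map.
Qed.

Definition homotopy_inverse (P Q : ldgmod R) (e : ldg_hom P Q) (s : ldg_hom Q P) :=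
  homotopic (lh_comp e s) (lh_id Q) /\ homotopic (lh_comp s e) (lh_id P).

Lemma homotopic_ext M N (f f' g g' : ldg_hom M N) :
  (forall i x, f i x = f' i x) -> (forall i x, g i x = g' i x) ->
  homotopic f g -> homotopic f' g'.
Proof.
by move=> ff gg [s sP]; exists s => i j k hj hk x; rewrite -ff -gg; apply: sP.
Qed.

Lemma homotopic_refl M N (f : ldg_hom M N) : homotopic f f.
Proof. exact: homotopic_eq. Qed.

(** Lifting the identity of [Q] through [e] gives [s] with [e s] homotopic to 1. Then [e (s e)] and
    [e] are homotopic, and uniqueness of lifts cancels [e]. *)
Lemma Kproj_homotopy_inverse (P Q : ldgmod R) (e : ldg_hom P Q) :
  Kprojective P -> Kprojective Q -> quasi_iso e ->
  exists s, homotopy_inverse e s.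
Proof.
move=> pP pQ qe; have [s es] := Kproj_lift (lh_id Q) pQ qe.
exists s; split=> //; apply: (Kproj_lift_uniq pP qe).
apply: homotopic_ext (homotopic_compr e es) => //.
Qed.

Lemma homotopy_inverse_qi (P Q : ldgmod R) (e : ldg_hom P Q) (s : ldg_hom Q P) :
  homotopy_inverse e s -> quasi_iso e.
Proof.
move=> [es se]; apply: (@qi_inverse _ _ _ e (fun i => s i)).
- by move=> *; rewrite linearB.
- by move=> *; apply: cycle_map.
- by move=> *; apply: boundary_map.
- by move=> i x cx; apply: (homotopic_boundary se cx).
- by move=> i x cx; apply: (homotopic_boundary es cx).
Qed.

Lemma hom_pre_qi (P Q N : ldgmod R) (e : ldg_hom P Q) (s : ldg_hom Q P) :
  homotopy_inverse e s -> quasi_iso (hom_pre N e).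
Proof.
move=> [es se]; apply: (@qi_inverse _ _ _ (hom_pre N e) (fun i => hom_pre N s i)).
- by move=> *; rewrite linearB.
- by move=> *; apply: (cycle_map (hom_pre N s)).
- by move=> *; apply: (boundary_map (hom_pre N s)).
- move=> i u cu; move: (hom_pre_homotopic es cu); congr boundary.
  by congr (_ - _); apply: ghomP.
- move=> i u cu; move: (hom_pre_homotopic se cu); congr boundary.
  by congr (_ - _); apply: ghomP.
Qed.

End Homotopy.

(** * Induction along a morphism of DGAs *)

Section Induction.
Variables (K : comPzRingType) (R S : dga K) (phi : dga_hom R S).
Local Notation SR := (rres phi (rregular S)).
Local Notation RS := (lres phi (lregular S)).

Section LeftInduction.
Variable Q : ldgmod R.

Section Act.
Variables (M : rdgmod S) (p n k : int) (h : p + n = k) (m : M p).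
Lemma indact_deg i j : i + j = n -> p + i + j = k. Proof. by lia. Qed.
Let b i j (e : i + j = n) (s : SR i) (x : Q j) : tens (rres phi M) Q k :=
  @tpure _ _ (rres phi M) Q k _ j (indact_deg e) (ract M erefl m (s : S i)) x.
Let b_linl i j (e : i + j = n) x : linear (fun s => b e s x).
Proof. by move=> a s s'; rewrite /b ract_linr (tpure_linl (M := rres phi M)). Qed.
Let b_linr i j (e : i + j = n) s : linear (b e s).
Proof. by move=> a x x'; rewrite /b (tpure_linr (M := rres phi M)). Qed.
Let b_bal i q j iq qj (h1 : i + q = iq) (h2 : iq + j = n)
    (h3 : q + j = qj) (h4 : i + qj = n) s r x :
  b h2 (ract SR h1 s r) x = b h4 s (lact Q h3 r x).
Proof.
have e : p + i + q = p + iq by lia.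
rewrite /b -(tpure_bal (M := rres phi M) e (indact_deg h2) h3 (indact_deg h4)).
by rewrite /= -(ractA erefl e h1 erefl).
Qed.
(** With a general right module [M], one construction yields both the [S]-action on the induced
    module (at [M = S]) and the associativity map [ind_assoc]. *)
Definition indact : {linear tens SR Q n -> tens (rres phi M) Q k} :=
  @tlift K R SR Q n _ b b_linl b_linr b_bal.
Lemma indact_tpure i j pi (e : i + j = n) (hi : p + i = pi) (e' : pi + j = k)
    (s : SR i) x :
  indact (tpure e s x) =
  @tpure _ _ (rres phi M) Q k pi j e' (ract M hi m (s : S i)) x.
Proof.
subst pi; rewrite /indact tlift_pure /b.
by rewrite (eq_irrelevance (indact_deg e) e').
Qed.
End Act.

Lemma indact_linl (M : rdgmod S) p n k (h : p + n = k) t :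
  linear (fun m : M p => indact h m t).
Proof.
move=> a m m'; elim/tens_ind: t => [|x y IHx IHy|c x IHx|i j e s x].
- by rewrite !linear0 addr0.
- by rewrite !linearD IHx IHy addrACA.
- rewrite ![indact _ _ (_ *: _)]linearZZ IHx scalerDr !scalerA.
  by rewrite (mulrC c).
have e' : p + i + j = k by lia.
rewrite !(indact_tpure _ _ _ erefl e') ract_linl.
exact: (tpure_linl (M := rres phi M)).
Qed.

Lemma indactA (M : rdgmod S) a b c ab bc abc (h1 : a + b = ab)
    (h2 : ab + c = abc) (h3 : b + c = bc) (h4 : a + bc = abc) (m : M a) s t :
  indact h4 m (indact (M := rregular S) h3 s t) = indact h2 (ract M h1 m s) t.
Proof.
elim/tens_ind: t => [|x y IHx IHy|d x IHx|i j e s' x].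
- by rewrite !linear0.
- by rewrite !linearD IHx IHy.
- by rewrite !linearZZ IHx.
have e1 : b + i + j = bc by lia.
have e2 : a + (b + i) = ab + i by lia.
have e3 : ab + i + j = abc by lia.
rewrite (indact_tpure (M := rregular S) _ _ _ erefl e1).
rewrite (indact_tpure _ _ _ e2 e3) (indact_tpure _ _ _ erefl e3).
by rewrite /= (ractA h1 erefl erefl e2).
Qed.

Lemma indact1 i (h : 0 + i = i) t :
  indact (M := rregular S) h (dga_one S) t = t.
Proof.
elim/tens_ind: t => [|x y IHx IHy|d x IHx|p q e s' x].
- by rewrite !linear0.
- by rewrite !linearD IHx IHy.
- by rewrite !linearZZ IHx.
by rewrite (indact_tpure (M := rregular S) _ _ _ (add0r p) e) /= dga_mul1l.
Qed.

Lemma indact_leibniz (M : rdgmod S) i j k i' j' k' (h : i + j = k)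
    (hi : i' + 1 = i) (hj : j' + 1 = j) (hk : k' + 1 = k)
    (h1 : i' + j = k') (h2 : i + j' = k') (m : M i) t :
  tens_d (rres phi M) Q hk (indact h m t) =
    indact h1 (cx_d M hi m) t + ksgn K i *: indact h2 m (tens_d SR Q hj t).
Proof.
elim/tens_ind: t => [|x y IHx IHy|d x IHx|p q e s x].
- by rewrite !linear0 addr0.
- by rewrite !linearD IHx IHy addrACA.
- rewrite ![indact _ _ (_ *: _)]linearZZ ![tens_d _ _ _ (_ *: _)]linearZZ.
  by rewrite IHx [indact _ _ (_ *: _)]linearZZ scalerDr !scalerA (mulrC d).
have e1 : i + p + q = k by lia.
have e2 : p - 1 + q = j' by lia.
have e3 : p + (q - 1) = j' by lia.
have e4 : i' + p + q = k' by lia.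
have e5 : i + p + (q - 1) = k' by lia.
have e6 : i' + p + 1 = i + p by lia.
have e7 : i + (p - 1) = i' + p by lia.
rewrite (indact_tpure _ _ _ erefl e1).
rewrite (tens_leibniz (M := rres phi M) e1 e6 (deg_pred q) hk e4 e5).
rewrite (tens_leibniz (M := SR) e (deg_pred p) (deg_pred q) hj e2 e3).
rewrite [indact h2 m (_ + _)]linearD [indact h2 m (_ *: _)]linearZZ.
rewrite (indact_tpure _ _ _ erefl e4) (indact_tpure _ _ _ e7 e4).
rewrite (indact_tpure _ _ _ erefl e5) /=.
rewrite (ract_leibniz erefl hi (deg_pred p) e6 erefl e7).
rewrite (tpureDl (M := rres phi M)) (tpureZl (M := rres phi M)).
by rewrite scalerDr scalerA -ksgnD addrA.
Qed.

Definition ind : ldgmod S.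
Proof.
refine (@LDgMod K S (tens_cx SR Q) (fun i j k h s t => indact (M := rregular S) h s t)
  _ _ _ _ _).
- by move=> i j k h t; apply: (indact_linl (M := rregular S)).
- by move=> i j k h s a t t'; rewrite linearP.
- by move=> a b c ab bc abc h1 h2 h3 h4 r s t; apply: (indactA (M := rregular S)).
- by move=> i h t; apply: indact1.
- move=> i j k i' j' k' h hi hj hk h1 h2 s t.
  exact: (indact_leibniz (M := rregular S)).
Defined.

Section Unit.
Definition ind_unit_fun i (x : Q i) : ind i :=
  @tpure _ _ SR Q i 0 i (add0r i) (dga_one S) x.
Lemma ind_unit_linear i : linear (@ind_unit_fun i).
Proof. by move=> a x y; rewrite /ind_unit_fun (tpure_linr (M := SR)). Qed.
HB.instance Definition _ i :=
  GRing.isLinear.Build K (Q i) (ind i) *:%R (@ind_unit_fun i) (@ind_unit_linear i).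
Lemma ind_unit_d i j (h : j + 1 = i) x :
  ind_unit_fun (cx_d Q h x) = cx_d ind h (ind_unit_fun x).
Proof.
have e : -1 + i = j by lia.
rewrite /ind_unit_fun /= (tens_leibniz (M := SR) (add0r i) (addNr 1) h h e (add0r j)).
by rewrite /= d_one (tpure0l SR) add0r /ksgn expr0 scale1r.
Qed.
Lemma ind_unit_act i j k (h : i + j = k) (r : R i) x :
  ind_unit_fun (lact Q h r x) = lact (lres phi ind) h r (ind_unit_fun x).
Proof.
rewrite /ind_unit_fun -(tpure_bal (M := SR) (add0r i) h h (add0r k)) /=.
rewrite (indact_tpure (M := rregular S) _ _ _ (addr0 i) h) /=.
by rewrite dga_mul1l dga_mul1r.
Qed.
Definition ind_unit : ldg_hom Q (lres phi ind) :=
  @LDgHom K R Q (lres phi ind) (@CMap K Q (lres phi ind)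
    (fun i => @ind_unit_fun i) ind_unit_d) ind_unit_act.
End Unit.

Lemma ind_tpureE i j n (h : i + j = n) (s : S i) (x : Q j) :
  @tpure _ _ SR Q n i j h s x = lact ind h s (ind_unit j x).
Proof.
by rewrite /= (indact_tpure (M := rregular S) _ _ _ (addr0 i) h) /= dga_mul1r.
Qed.

Lemma ind_ext n (V : lmodType K) (f g : {linear ind n -> V}) :
  (forall i j (h : i + j = n) (s : S i) (x : Q j),
     f (lact ind h s (ind_unit j x)) = g (lact ind h s (ind_unit j x))) ->
  forall t, f t = g t.
Proof.
by move=> fg; apply: tens_ext => i j h x y; rewrite ind_tpureE; apply: fg.
Qed.

Section AssocMap.
Variable M : rdgmod S.
Let b i j n (h : i + j = n) (m : M i) (t : ind j) : tens_cx (rres phi M) Q n :=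
  indact h m t.
Let b_linl i j n (h : i + j = n) t : linear (fun m => b h m t).
Proof. exact: indact_linl. Qed.
Let b_linr i j n (h : i + j = n) m : linear (b h m).
Proof. by move=> a t t'; rewrite /b linearP. Qed.
Let b_bal n i p j ip pj (h1 : i + p = ip) (h2 : ip + j = n)
    (h3 : p + j = pj) (h4 : i + pj = n) m s t :
  b h2 (ract M h1 m s) t = b h4 m (lact ind h3 s t).
Proof. by rewrite /b /= (indactA h1 h2). Qed.
Let b_d i j k i' j' k' (h : i + j = k)
    (hi : i' + 1 = i) (hj : j' + 1 = j) (hk : k' + 1 = k)
    (h1 : i' + j = k') (h2 : i + j' = k') m t :
  cx_d (tens_cx (rres phi M) Q) hk (b h m t) =
    b h1 (cx_d M hi m) t + ksgn K i *: b h2 m (cx_d ind hj t).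
Proof. exact: indact_leibniz. Qed.
Definition ind_assoc : cmap (tens_cx M ind) (tens_cx (rres phi M) Q) :=
  @tens_lift K S M ind (tens_cx (rres phi M) Q) b b_linl b_linr b_bal b_d.
Lemma ind_assoc_tpure i j n (h : i + j = n) m t :
  ind_assoc n (tpure h m t) = indact h m t.
Proof. exact: tens_lift_tpure. Qed.

(** [M (x)_S (S (x)_R Q)] and [M (x)_R Q] are isomorphic complexes, with [ind_assoc] as inverse.
    Consequently the comparison map of (3) is [M (x)_S -] applied to an action map. *)
Lemma base_change_unit_qi : quasi_iso (base_change_map M ind_unit).
Proof.
apply: (@qi_iso _ _ _ (base_change_map M ind_unit) (fun n => ind_assoc n)) => n.
  apply: (tens_ext (f := ind_assoc n \o base_change_map M ind_unit n) (g := idfun)).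
  move=> i j h m x; rewrite -[LHS]/(ind_assoc n (base_change_map M ind_unit n _)).
  rewrite base_change_map_tpure ind_assoc_tpure.
  by rewrite (indact_tpure _ _ _ (addr0 i) h) ract1.
apply: (tens_ext (f := base_change_map M ind_unit n \o ind_assoc n) (g := idfun)).
move=> i j h m t; rewrite -[LHS]/(base_change_map M ind_unit n (ind_assoc n _)).
rewrite ind_assoc_tpure.
elim/tens_ind: t => [|x y IHx IHy|d x IHx|p q e s x].
- by rewrite tpure0r !linear0.
- by rewrite !linearD /= IHx IHy tpureDr.
- by rewrite !linearZZ /= IHx tpureZr.
have e1 : i + p + q = n by lia.
rewrite (indact_tpure _ _ _ erefl e1) base_change_map_tpure.
by rewrite (tpure_bal (N := ind) erefl e1 e h) -ind_tpureE.
Qed.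
End AssocMap.

(** Tensoring [A] over [S] with the induced module is tensoring [A] over [R] with [Q], and
    restriction of scalars does not change the complex of [A], hence not its acyclicity. *)
Lemma ind_Kflat : Kflat Q -> Kflat ind.
Proof.
move=> fQ A acyA n t ct.
have qi := base_change_unit_qi A.
have [u [cu bu]] := qi_surj qi ct.
have aT : @boundary K (tens_cx (rres phi A) Q) n u by apply: fQ.
rewrite -[t](subKr (base_change_map A ind_unit n u)).
by apply: (boundaryB (C := tens_cx A ind)) => //; apply: boundary_map.
Qed.

Section Adjunction.
Variable N : ldgmod S.

Section Action.
Variable q : ldg_hom Q (lres phi N).
Lemma action_map_act i j k (h : i + j = k) (s : S i) (t : ind j) :
  action_map q k (lact ind h s t) = lact N h s (action_map q j t).
Proof.
elim/tens_ind: t => [|x y IHx IHy|d x IHx|p p' e t x].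
- by rewrite lact0r !linear0 lact0r.
- by rewrite lactDr !linearD lactDr /= IHx IHy.
- by rewrite lactZr !linearZZ lactZr /= IHx.
have e1 : i + p + p' = k by lia.
rewrite /= (indact_tpure (M := rregular S) _ _ _ erefl e1).
by rewrite !action_map_tpure (lactA erefl e1).
Qed.
(** The action map is the [S]-linear map adjoint to [q]. Its linearity allows it to be tensored over
    [S] and inverted up to [S]-linear homotopy. *)
Definition ind_hom : ldg_hom ind N :=
  @LDgHom K S ind N (action_map q) action_map_act.

Lemma ind_hom_unit i x : ind_hom i (ind_unit i x) = q i x.
Proof. by rewrite [LHS]action_map_tpure lact1. Qed.
End Action.

Section Transpose.
Variables (n : int) (u : ghom Q (lres phi N) n).
Section Fun.
Variables (i j : int) (h : i + n = j).
Lemma adj_deg p q : p + q = i -> p + (q + n) = j. Proof. by lia. Qed.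
Let b p q (e : p + q = i) (s : SR p) (x : Q q) : N j :=
  ksgn K (n * p) *: lact N (adj_deg e) (s : S p) (gh_fun u erefl x).
Let b_linl p q (e : p + q = i) x : linear (fun s => b e s x).
Proof. by move=> a s s'; rewrite /b lact_linl scalerDr !scalerA mulrC. Qed.
Let b_linr p q (e : p + q = i) s : linear (b e s).
Proof. by move=> a x x'; rewrite /b gh_lin lact_linr scalerDr !scalerA mulrC. Qed.
Let b_bal p r q pr rq (h1 : p + r = pr) (h2 : pr + q = i)
    (h3 : r + q = rq) (h4 : p + rq = i) s a x :
  b h2 (ract SR h1 s a) x = b h4 s (lact Q h3 a x).
Proof.
have e : r + (q + n) = rq + n by lia.
rewrite /b (gh_act u h3 erefl erefl e) lactZr scalerA -ksgnD -mulrDr h1.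
by rewrite /= -(lactA h1 (adj_deg h2) e (adj_deg h4)).
Qed.
Definition adj_fun : {linear ind i -> N j} :=
  @tlift K R SR Q i (N j) b b_linl b_linr b_bal.
Lemma adj_fun_tpure p q q' (e : p + q = i) (hq : q + n = q') (e' : p + q' = j) s x :
  adj_fun (@tpure _ _ SR Q i p q e s x) =
  ksgn K (n * p) *: lact N e' (s : S p) (gh_fun u hq x).
Proof.
by subst q'; rewrite /adj_fun tlift_pure /b (eq_irrelevance (adj_deg e) e').
Qed.
End Fun.

Definition adj : ghom ind N n.
Proof.
refine (@GHom K S ind N n (fun i j h t => adj_fun h t) _ _).
- by move=> i j h a x y; rewrite linearP.
- move=> p i j k l h1 h2 h3 h4 s t.
  elim/tens_ind: t => [|x y IHx IHy|d x IHx|p' q e t x].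
  + by rewrite lact0r !linear0 lact0r scaler0.
  + by rewrite lactDr !linearD lactDr /= IHx IHy scalerDr.
  + by rewrite lactZr !linearZZ lactZr /= IHx !scalerA mulrC.
  have e1 : p + p' + q = k by lia.
  have e2 : p + p' + (q + n) = l by lia.
  have e3 : p' + (q + n) = j by lia.
  rewrite /= (indact_tpure (M := rregular S) _ _ _ erefl e1).
  rewrite (adj_fun_tpure h3 e1 erefl e2) (adj_fun_tpure h2 e erefl e3).
  by rewrite lactZr scalerA -ksgnD -mulrDr (lactA erefl e2).
Defined.
End Transpose.

(** The adjunction between induction and restriction, as an isomorphism of Hom complexes with
    inverse [adj]. *)
Lemma restrict_unit_qi : quasi_iso (restrict_map N ind_unit).
Proof.
apply: (@qi_iso _ _ _ (restrict_map N ind_unit) (fun n => @adj n)) => n u.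
  (* [gh_fun u h] is a bare function with a linearity proof; it is packed as a linear map so that
     both sides can be compared on the elements [s (1 (x) x)]. *)
  apply: ghomP => i j h; apply: (ind_ext (f := adj_fun (restrict_fun ind_unit u) h)
    (g := HB.pack (gh_fun u h) (GRing.isLinear.Build _ _ _ _ _ (gh_lin u h)))).
  move=> p q e s x; have e1 : p + (q + n) = j by lia.
  rewrite -ind_tpureE (adj_fun_tpure _ _ _ erefl e1) ind_tpureE.
  by rewrite [RHS](gh_act u e erefl h e1).
apply: ghomP => i j h x /=; have e1 : 0 + j = j by rewrite add0r.
rewrite (adj_fun_tpure _ _ _ h e1) mulr0 /ksgn expr0 scale1r.
exact: (lact1 (l := N)).
Qed.

(** Injectivity of the adjunction on degree-zero homology: a homotopy over [S] out of the induced
    module may be sought over [R], after composition with the unit. *)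
Lemma ind_homotopic (f g : ldg_hom ind N) :
  homotopic (lh_comp (lh_res phi f) ind_unit) (lh_comp (lh_res phi g) ind_unit) ->
  homotopic f g.
Proof.
move=> /homotopicP fg; apply/homotopicP; apply: (qi_inj restrict_unit_qi).
  by apply: (cycleB (C := hom_cx ind N)); apply: gh_of_cycle.
by move: fg; congr boundary; apply: ghomP.
Qed.
End Adjunction.

Lemma ind_Kproj : Kprojective Q -> Kprojective ind.
Proof.
move=> pQ A acyA n u cu; apply: (qi_inj (restrict_unit_qi A) cu).
apply: (pQ (lres phi A)) => //.
exact: (cycle_map (restrict_map A ind_unit) cu).
Qed.
End LeftInduction.

Section RightInduction.
Variable P : rdgmod R.

Section Act.
Variables (N : ldgmod S) (m q k : int) (h : m + q = k) (y : N q).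
Lemma rindact_deg i j : i + j = m -> i + (j + q) = k. Proof. by lia. Qed.
Let b i j (e : i + j = m) (x : P i) (s : RS j) : tens P (lres phi N) k :=
  @tpure _ _ P (lres phi N) k i _ (rindact_deg e) x (lact N erefl (s : S j) y).
Let b_linl i j (e : i + j = m) s : linear (fun x => b e x s).
Proof. by move=> a x x'; rewrite /b tpure_linl. Qed.
Let b_linr i j (e : i + j = m) x : linear (b e x).
Proof. by move=> a s s'; rewrite /b lact_linl (tpure_linr (N := lres phi N)). Qed.
Let b_bal i p j ip pj (h1 : i + p = ip) (h2 : ip + j = m)
    (h3 : p + j = pj) (h4 : i + pj = m) x r s :
  b h2 (ract P h1 x r) s = b h4 x (lact RS h3 r s).
Proof.
have e : p + (j + q) = pj + q by lia.
rewrite /b (tpure_bal (N := lres phi N) h1 (rindact_deg h2) e (rindact_deg h4)).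
by rewrite /= (lactA h3 erefl erefl e).
Qed.
Definition rindact : {linear tens P RS m -> tens P (lres phi N) k} :=
  @tlift K R P RS m _ b b_linl b_linr b_bal.
Lemma rindact_tpure i j jq (e : i + j = m) (hj : j + q = jq) (e' : i + jq = k)
    x (s : RS j) :
  rindact (tpure e x s) =
  @tpure _ _ P (lres phi N) k i jq e' x (lact N hj (s : S j) y).
Proof.
subst jq; rewrite /rindact tlift_pure /b.
by rewrite (eq_irrelevance (rindact_deg e) e').
Qed.
End Act.

Lemma rindact_linr (N : ldgmod S) m q k (h : m + q = k) t :
  linear (fun y : N q => rindact h y t).
Proof.
move=> a y y'; elim/tens_ind: t => [|u v IHu IHv|c u IHu|i j e x s].
- by rewrite !linear0 addr0.
- by rewrite !linearD IHu IHv addrACA.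
- rewrite ![rindact _ _ (_ *: _)]linearZZ IHu scalerDr !scalerA.
  by rewrite (mulrC c).
have e' : i + (j + q) = k by lia.
rewrite !(rindact_tpure _ _ _ erefl e') lact_linr.
exact: (tpure_linr (N := lres phi N)).
Qed.

Lemma rindactA (N : ldgmod S) a b c ab bc abc (h1 : a + b = ab)
    (h2 : ab + c = abc) (h3 : b + c = bc) (h4 : a + bc = abc) t (s : S b) (y : N c) :
  rindact h4 (lact N h3 s y) t = rindact h2 y (rindact (N := lregular S) h1 s t).
Proof.
elim/tens_ind: t => [|u v IHu IHv|d u IHu|i j e x s'].
- by rewrite !linear0.
- by rewrite !linearD IHu IHv.
- by rewrite !linearZZ IHu.
have e1 : i + (j + b) = ab by lia.
have e2 : j + b + c = j + bc by lia.
have e3 : i + (j + bc) = abc by lia.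
rewrite (rindact_tpure (N := lregular S) _ _ _ erefl e1).
rewrite (rindact_tpure _ _ _ e2 e3) (rindact_tpure _ _ _ erefl e3).
by rewrite /= (lactA erefl e2).
Qed.

Lemma rindact1 i (h : i + 0 = i) t :
  rindact (N := lregular S) h (dga_one S) t = t.
Proof.
elim/tens_ind: t => [|u v IHu IHv|d u IHu|p q e x s].
- by rewrite !linear0.
- by rewrite !linearD IHu IHv.
- by rewrite !linearZZ IHu.
by rewrite (rindact_tpure (N := lregular S) _ _ _ (addr0 q) e) /= dga_mul1r.
Qed.

Lemma rindact_leibniz (N : ldgmod S) i j k i' j' k' (h : i + j = k)
    (hi : i' + 1 = i) (hj : j' + 1 = j) (hk : k' + 1 = k)
    (h1 : i' + j = k') (h2 : i + j' = k') t (y : N j) :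
  tens_d P (lres phi N) hk (rindact h y t) =
    rindact h1 y (tens_d P RS hi t) + ksgn K i *: rindact h2 (cx_d N hj y) t.
Proof.
elim/tens_ind: t => [|u v IHu IHv|d u IHu|p q e x s].
- by rewrite !linear0 addr0.
- by rewrite !linearD IHu IHv addrACA.
- rewrite ![rindact _ _ (_ *: _)]linearZZ ![tens_d _ _ _ (_ *: _)]linearZZ.
  by rewrite IHu [rindact _ _ (_ *: _)]linearZZ scalerDr !scalerA (mulrC d).
have e1 : p + (q + j) = k by lia.
have e2 : p - 1 + q = i' by lia.
have e3 : p + (q - 1) = i' by lia.
have e4 : p - 1 + (q + j) = k' by lia.
have e5 : p + (q + j - 1) = k' by lia.
have e6 : q - 1 + j = q + j - 1 by lia.
have e7 : q + j' = q + j - 1 by lia.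
rewrite (rindact_tpure _ _ _ erefl e1).
rewrite (tens_leibniz (N := lres phi N) e1 (deg_pred p) (deg_pred _) hk e4 e5).
rewrite (tens_leibniz (N := RS) e (deg_pred p) (deg_pred q) hi e2 e3).
rewrite [rindact h1 y (_ + _)]linearD [rindact h1 y (_ *: _)]linearZZ.
rewrite (rindact_tpure _ _ _ erefl e4) (rindact_tpure _ _ _ e6 e5).
rewrite (rindact_tpure _ _ _ e7 e5) /=.
rewrite (lact_leibniz erefl (deg_pred q) hj (deg_pred _) e6 e7).
rewrite (tpureDr (N := lres phi N)) (tpureZr (N := lres phi N)).
by rewrite scalerDr scalerA -ksgnD e addrA.
Qed.

Definition rind : rdgmod S.
Proof.
refine (@RDgMod K S (tens_cx P RS) (fun i j k h t s => rindact (N := lregular S) h s t)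
  _ _ _ _ _).
- by move=> i j k h s a t t'; rewrite linearP.
- by move=> i j k h t; apply: (rindact_linr (N := lregular S)).
- by move=> a b c ab bc abc h1 h2 h3 h4 t r s; apply: (rindactA (N := lregular S)).
- by move=> i h t; apply: rindact1.
- move=> i j k i' j' k' h hi hj hk h1 h2 t s.
  exact: (rindact_leibniz (N := lregular S)).
Defined.

Lemma rind_tpureE i j n (h : i + j = n) (x : P i) (s : S j) :
  @tpure _ _ P RS n i j h x s =
  ract rind h (@tpure _ _ P RS i i 0 (addr0 i) x (dga_one S)) s.
Proof.
by rewrite /= (rindact_tpure (N := lregular S) _ _ _ (add0r j) h) /= dga_mul1l.
Qed.

Section AssocMap.
Variable N : ldgmod S.
Let b i j n (h : i + j = n) (t : rind i) (y : N j) : tens_cx P (lres phi N) n :=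
  rindact h y t.
Let b_linl i j n (h : i + j = n) y : linear (fun t => b h t y).
Proof. by move=> a t t'; rewrite /b linearP. Qed.
Let b_linr i j n (h : i + j = n) t : linear (b h t).
Proof. exact: rindact_linr. Qed.
Let b_bal n i p j ip pj (h1 : i + p = ip) (h2 : ip + j = n)
    (h3 : p + j = pj) (h4 : i + pj = n) t s y :
  b h2 (ract rind h1 t s) y = b h4 t (lact N h3 s y).
Proof. by rewrite /b /= (rindactA h1 h2). Qed.
Let b_d i j k i' j' k' (h : i + j = k)
    (hi : i' + 1 = i) (hj : j' + 1 = j) (hk : k' + 1 = k)
    (h1 : i' + j = k') (h2 : i + j' = k') t y :
  cx_d (tens_cx P (lres phi N)) hk (b h t y) =
    b h1 (cx_d rind hi t) y + ksgn K i *: b h2 t (cx_d N hj y).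
Proof. exact: rindact_leibniz. Qed.
Definition rind_assoc : cmap (tens_cx rind N) (tens_cx P (lres phi N)) :=
  @tens_lift K S rind N (tens_cx P (lres phi N)) b b_linl b_linr b_bal b_d.
Lemma rind_assoc_tpure i j n (h : i + j = n) t y :
  rind_assoc n (tpure h t y) = rindact h y t.
Proof. exact: tens_lift_tpure. Qed.

Section Inverse.
Variable n : int.
Let c i j (h : i + j = n) (x : P i) (y : lres phi N j) : tens rind N n :=
  @tpure _ _ rind N n i j h (@tpure _ _ P RS i i 0 (addr0 i) x (dga_one S)) y.
Let c_linl i j (h : i + j = n) y : linear (fun x => c h x y).
Proof. by move=> a x x'; rewrite /c tpure_linl (tpure_linl (M := rind)). Qed.
Let c_linr i j (h : i + j = n) x : linear (c h x).
Proof. by move=> a y y'; rewrite /c (tpure_linr (N := N)). Qed.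
Let c_bal i p j ip pj (h1 : i + p = ip) (h2 : ip + j = n)
    (h3 : p + j = pj) (h4 : i + pj = n) x r y :
  c h2 (ract P h1 x r) y = c h4 x (lact (lres phi N) h3 r y).
Proof.
rewrite /c -(tpure_bal (M := rind) h1 h2 h3 h4); congr tpure.
rewrite (tpure_bal (N := RS) h1 (addr0 ip) (addr0 p) h1) /=.
rewrite (rindact_tpure (N := lregular S) _ _ _ (add0r p) h1) /=.
by rewrite dga_mul1l dga_mul1r.
Qed.
Definition rind_assoc_inv : {linear tens P (lres phi N) n -> tens rind N n} :=
  @tlift K R P (lres phi N) n _ c c_linl c_linr c_bal.
Lemma rind_assoc_inv_tpure i j (h : i + j = n) x y :
  rind_assoc_inv (tpure h x y) =
  @tpure _ _ rind N n i j h (@tpure _ _ P RS i i 0 (addr0 i) x (dga_one S)) y.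
Proof. exact: tlift_pure. Qed.
End Inverse.

(** Associativity, [(P (x)_R S) (x)_S N = P (x)_R N]: the route by which a statement about the
    regular module reaches other modules [N]. *)
Lemma rind_assoc_qi : quasi_iso rind_assoc.
Proof.
apply: (@qi_iso _ _ _ rind_assoc rind_assoc_inv) => n; last first.
  apply: (tens_ext (f := rind_assoc n \o rind_assoc_inv n) (g := idfun)).
  move=> i j h x y; rewrite -[LHS]/(rind_assoc n (rind_assoc_inv n _)).
  rewrite rind_assoc_inv_tpure rind_assoc_tpure.
  by rewrite (rindact_tpure _ _ _ (add0r j) h) lact1.
apply: (tens_ext (f := rind_assoc_inv n \o rind_assoc n) (g := idfun)).
move=> i j h t y; rewrite -[LHS]/(rind_assoc_inv n (rind_assoc n _)).
rewrite rind_assoc_tpure.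
elim/tens_ind: t => [|u v IHu IHv|d u IHu|p q e x s].
- by rewrite (tpure0l rind) !linear0.
- by rewrite !linearD /= IHu IHv (tpureDl (M := rind)).
- by rewrite !linearZZ /= IHu (tpureZl (M := rind)).
have e1 : p + (q + j) = n by lia.
rewrite (rindact_tpure _ _ _ erefl e1) rind_assoc_inv_tpure.
by rewrite -(tpure_bal (M := rind) e h erefl e1) -rind_tpureE.
Qed.
End AssocMap.
End RightInduction.
End Induction.

(** * Morphisms out of K-projective modules in the derived category *)

Section DerivedCategory.
Variables (K : comPzRingType) (R : dga K).

(** As [w] is invertible in the derived category, equality of morphisms can be tested after
    replacing the source by a K-projective resolution. *)
Lemma deq_cancel_qi (M M' N : ldgmod R) (w : ldg_hom M' M) (x y : dmor M N) :
  quasi_iso w -> deq (DComp x (DHom w)) (DComp y (DHom w)) -> deq x y.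
Proof.
move=> qw xy.
have cancel z : deq z (DComp (DComp z (DHom w)) (DInv qw)).
  apply: deq_trans (deq_sym (deq_idr z)) _.
  apply: deq_trans (deq_assoc _ _ _).
  apply: deq_comp (deq_refl _) (deq_sym (deq_invr qw)).
refine (deq_trans (cancel _ x) _); refine (deq_trans _ (deq_sym (cancel _ y))).
exact: (deq_comp xy (deq_refl _)).
Qed.

Variable P : ldgmod R.
Hypothesis projP : Kprojective P.

(** Each formal inverse met along [f] is removed by lifting through the quasi-isomorphism, which
    K-projectivity of [P] permits. *)
Lemma dmor_of_Kproj (M N : ldgmod R) (f : dmor M N) (a : ldg_hom P M) :
  exists h : ldg_hom P N, deq (DComp f (DHom a)) (DHom h).
Proof.
elim: f a => {M N} [M N f|M N q hq|M N L g IHg f IHf] a.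
- by exists (lh_comp f a); apply/deq_sym/deq_hom_comp.
- have [h qh] := Kproj_lift a projP hq; exists h.
  apply: deq_trans (deq_comp (deq_refl _) (deq_sym (deq_homotopic qh))) _.
  apply: deq_trans (deq_comp (deq_refl _) (deq_hom_comp _ _)) _.
  apply: deq_trans (deq_assoc _ _ _) _.
  apply: deq_trans (deq_comp (deq_invl hq) (deq_refl _)) _.
  exact: deq_idl.
have [b fb] := IHf a; have [c gc] := IHg b; exists c.
apply: deq_trans (deq_sym (deq_assoc _ _ _)) _.
exact: deq_trans (deq_comp (deq_refl _) fb) gc.
Qed.

(* The graph of the map [P, M] -> [P, N] between homotopy classes of maps induced
   by a morphism of the derived category. *)
Fixpoint dgraph (M N : ldgmod R) (f : dmor M N) :
    ldg_hom P M -> ldg_hom P N -> Prop :=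
  match f with
  | DHom _ _ f => fun a b => homotopic (lh_comp f a) b
  | DInv _ _ q _ => fun a b => homotopic (lh_comp q b) a
  | DComp _ _ _ g f => fun a c => exists b, dgraph f a b /\ dgraph g b c
  end.

Lemma dgraph_homotopic (M N : ldgmod R) (f : dmor M N) a a' b b' :
  homotopic a a' -> homotopic b b' -> dgraph f a b -> dgraph f a' b'.
Proof.
elim: f a a' b b' => {M N} [M N f|M N q hq|M N L g IHg f IHf] a a' b b' aa bb /=.
- move=> fab; apply: homotopic_trans bb; apply: homotopic_trans fab.
  by apply: homotopic_compl; apply: homotopic_sym.
- move=> qba; apply: homotopic_trans aa; apply: homotopic_trans qba.
  by apply: homotopic_compl; apply: homotopic_sym.
move=> [c [fac gcb]]; exists c; split.
  by apply: (IHf a a' c c) => //; apply: homotopic_refl.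
by apply: (IHg c c b b') => //; apply: homotopic_refl.
Qed.

(** Checked relation by relation. It makes the graph an invariant of morphisms in the derived
    category, although the graph itself is defined on formal composites. *)
Lemma dgraph_deq (M N : ldgmod R) (f g : dmor M N) :
  deq f g -> forall a b, dgraph f a b <-> dgraph g a b.
Proof.
elim=> {M N f g} /=.
- by [].
- by move=> M N f g _ fg a b; split=> /fg.
- by move=> M N f g h _ fg _ gh a b; split=> [/fg /gh|/gh /fg].
- move=> M N L g g' f f' _ gg _ ff a c; split=> -[b [fab gbc]]; exists b.
    by split; [apply/ff|apply/gg].
  by split; [apply/ff|apply/gg].
- move=> M N L Q h g f a d; split.
    by move=> [c [[b [fab gbc]] hcd]]; exists b; split=> //; exists c.
  by move=> [b [fab [c [gbc hcd]]]]; exists c; split=> //; exists b.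
- move=> M N f a c; split=> [[b [fab bc]]|fac].
    apply: dgraph_homotopic (homotopic_refl _) _ fab.
    exact: homotopic_ext bc.
  by exists c; split=> //; apply: homotopic_eq.
- move=> M N f a c; split=> [[b [ab fbc]]|fac].
    apply: dgraph_homotopic _ (homotopic_refl _) fbc.
    by apply: homotopic_sym; apply: homotopic_ext ab.
  by exists a; split=> //; apply: homotopic_eq.
- move=> M N L g f a c; split=> [gfac|[b [fab gbc]]].
    exists (lh_comp f a); split; first exact: homotopic_refl.
    exact: homotopic_ext gfac.
  apply: homotopic_trans gbc; apply: homotopic_trans (homotopic_compl g fab).
  exact: homotopic_eq.
- move=> M N f g fg a b; split=> h.
    exact: homotopic_trans (homotopic_compr a (homotopic_sym fg)) h.
  exact: homotopic_trans (homotopic_compr a fg) h.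
(* This inverse law rests on uniqueness of lifts up to homotopy; the other one, treated next, on
   their existence. *)
- move=> M N q hq a c; split=> [[b [qab qcb]]|ac].
    apply: (homotopic_ext (f := a) (g := c)) => //.
    apply: (Kproj_lift_uniq projP hq).
    exact: homotopic_trans qab (homotopic_sym qcb).
  exists (lh_comp q a); split; first exact: homotopic_refl.
  by apply: homotopic_compl; apply: homotopic_sym; apply: homotopic_ext ac.
- move=> M N q hq a c; split=> [[b [qba qbc]]|ac].
    apply: (homotopic_ext (f := a) (g := c)) => //.
    exact: homotopic_trans (homotopic_sym qba) qbc.
  have [b qb] := Kproj_lift a projP hq; exists b; split=> //.
  by apply: homotopic_trans qb _; apply: homotopic_ext ac.
Qed.

(** At the identity of [P], the graph of [DHom a] consists of the maps homotopic to [a]. *)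
Lemma deq_hom_Kproj (N : ldgmod R) (a b : ldg_hom P N) :
  deq (DHom a) (DHom b) -> homotopic a b.
Proof.
move=> /dgraph_deq /(_ (lh_id P) a) [ab _].
apply: homotopic_sym; apply: homotopic_ext (ab _) => //.
exact: homotopic_eq.
Qed.
End DerivedCategory.

(** * The regular module: tensoring with [S] and mapping out of [S] *)

Section Regular.
Variables (K : comPzRingType) (S : dga K).

Section RegMap.
Variable G : ldgmod S.
Let b i j n (h : i + j = n) (s : rregular S i) (g : G j) : G n :=
  lact G h (s : S i) g.
Let b_linl i j n (h : i + j = n) g : linear (fun s => b h s g).
Proof. exact: lact_linl. Qed.
Let b_linr i j n (h : i + j = n) s : linear (b h s).
Proof. exact: lact_linr. Qed.
Let b_bal n i p j ip pj (h1 : i + p = ip) (h2 : ip + j = n)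
    (h3 : p + j = pj) (h4 : i + pj = n) s r g :
  b h2 (ract (rregular S) h1 s r) g = b h4 s (lact G h3 r g).
Proof. by rewrite /b (lactA h1 h2 h3 h4). Qed.
Let b_d i j k i' j' k' (h : i + j = k)
  (hi : i' + 1 = i) (hj : j' + 1 = j) (hk : k' + 1 = k)
  (h1 : i' + j = k') (h2 : i + j' = k') s g :
  cx_d G hk (b h s g) =
    b h1 (cx_d S hi s) g + ksgn K i *: b h2 s (cx_d G hj g).
Proof. exact: lact_leibniz. Qed.
Definition reg_map : cmap (tens_cx (rregular S) G) G :=
  @tens_lift K S (rregular S) G G b b_linl b_linr b_bal b_d.
Lemma reg_map_tpure i j n (h : i + j = n) (s : S i) g :
  reg_map n (@tpure _ _ (rregular S) G n i j h s g) = lact G h s g.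
Proof. exact: tens_lift_tpure. Qed.

Lemma reg_map_qi : quasi_iso reg_map.
Proof.
apply: (@qi_iso _ _ _ reg_map
  (fun n g => @tpure _ _ (rregular S) G n 0 n (add0r n) (dga_one S) g)) => n x.
  elim/tens_ind: x => [|x y IHx IHy|a x IHx|i j h s g].
  - by rewrite linear0 (tpure0r (M := rregular S)).
  - by rewrite linearD (tpureDr (M := rregular S)) IHx IHy.
  - by rewrite linearZZ (tpureZr (M := rregular S)) IHx.
  rewrite reg_map_tpure -(tpure_bal (M := rregular S) (add0r i) h h (add0r n)).
  by rewrite /= dga_mul1l.
by rewrite reg_map_tpure lact1.
Qed.
End RegMap.

Section RegHom.
Variable M : ldgmod S.

Definition reg_hom_fun n (m : M n) : ghom (lregular S) M n.
Proof.
refine (@GHom K S (lregular S) M n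
  (fun i j h (s : S i) => ksgn K (n * i) *: lact M h s m) _ _).
- by move=> i j h a x y; rewrite lact_linl scalerDr !scalerA mulrC.
- move=> p i j k l h1 h2 h3 h4 r x.
  rewrite /= -(lactA h1 h3 h2 h4) lactZr !scalerA.
  by rewrite -ksgnD -mulrDr -h1.
Defined.
Lemma reg_hom_linear n : linear (@reg_hom_fun n).
Proof.
move=> a x y; apply: ghomP => i j h p /=.
by rewrite lact_linr scalerDr !scalerA mulrC.
Qed.
HB.instance Definition _ n :=
  GRing.isLinear.Build K (M n) (ghom (lregular S) M n) *:%R (@reg_hom_fun n)
    (@reg_hom_linear n).
Lemma reg_hom_d i j (h : j + 1 = i) m :
  reg_hom_fun (cx_d M h m) = cx_d (hom_cx (lregular S) M) h (reg_hom_fun m).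
Proof.
apply: ghomP => k l e p.
have e1 : k + i = l + 1 by lia.
have e2 : k - 1 + i = l by lia.
rewrite (ghom_dE _ _ _ e1 e2 (deg_pred k) erefl) /= linearZZ.
rewrite (lact_leibniz e1 (deg_pred k) h erefl e2 e) scalerDr !scalerA.
have -> : ksgn K i * ksgn K (i * (k - 1)) = ksgn K (i * k).
  by rewrite mulrBr mulr1 ksgnD ksgnN mulrCA ksgnK mulr1.
rewrite addrAC subrr add0r; congr (_ *: _).
by rewrite -[X in ksgn K (X * k) * _]h mulrDl mul1r ksgnD -mulrA ksgnK mulr1.
Qed.
Definition reg_hom : cmap M (hom_cx (lregular S) M) :=
  @CMap K M (hom_cx (lregular S) M) (fun n => @reg_hom_fun n) reg_hom_d.

Lemma reg_hom_qi : quasi_iso reg_hom.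
Proof.
apply: (@qi_iso _ _ _ reg_hom
  (fun n u => gh_fun u (add0r n) (dga_one S))) => n u.
  by rewrite /= mulr0 /ksgn expr0 scale1r lact1.
apply: ghomP => i j h s /=.
rewrite -(gh_act u (addr0 i) (add0r n) h h) /= dga_mul1r; exact: gh_irr.
Qed.

(** [f s - g s] is [s (f 1 - g 1)], so the difference of the two maps is the image of a boundary
    under the chain map [reg_hom]. *)
Lemma reg_homotopic (f g : ldg_hom (lregular S) M) :
  boundary (f 0 (dga_one S) - g 0 (dga_one S)) -> homotopic f g.
Proof.
move=> b; apply/homotopicP; move: (boundary_map reg_hom b); congr boundary.
apply: ghomP => i j h s; rewrite /= mul0r /ksgn expr0 scale1r scaleN1r.
move: (deg0 h) => e; case: j / e h => h; rewrite lactBr.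
have E (k : ldg_hom (lregular S) M) : lact M h s (k 0 (dga_one S)) = k i s.
  by rewrite -(lh_act k h) /= dga_mul1r.
by rewrite !E.
Qed.

Section Cycle.
Variables (m : M 0) (cm : cycle m).
Definition rmul_fun i (s : S i) : M i := lact M (addr0 i) s m.
Lemma rmul_linear i : linear (@rmul_fun i).
Proof. exact: lact_linl. Qed.
HB.instance Definition _ i :=
  GRing.isLinear.Build K (S i) (M i) *:%R (@rmul_fun i) (@rmul_linear i).
Lemma rmul_d i j (h : j + 1 = i) (s : S i) :
  rmul_fun (cx_d S h s) = cx_d M h (rmul_fun s).
Proof.
have e : i - 1 + 1 = i by lia.
have e1 : i + -1 = j by lia.
rewrite /rmul_fun (lact_leibniz (addr0 i) h (addNr 1) h (addr0 j) e1).
by rewrite cm lact0r scaler0 addr0.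
Qed.
Lemma rmul_act i j k (h : i + j = k) (r : S i) (s : S j) :
  rmul_fun (dga_mul S h r s) = lact M h r (rmul_fun s).
Proof. by rewrite /rmul_fun (lactA h (addr0 k) (addr0 j) h). Qed.
Definition rmul : ldg_hom (lregular S) M :=
  @LDgHom K S (lregular S) M (@CMap K (lregular S) M (fun i => @rmul_fun i) rmul_d)
    rmul_act.
End Cycle.
End RegHom.

Lemma reg_Kproj : Kprojective (lregular S).
Proof.
move=> A acyA n u cu; have [m [cm bm]] := qi_surj (reg_hom_qi A) cu.
have := boundary_map (reg_hom A) (acyA n m cm).
move=> bm'; rewrite -[u](subKr (reg_hom A n m)).
exact: (boundaryB (C := hom_cx (lregular S) A)).
Qed.
End Regular.

Definition semifree_fres (K : comPzRingType) (R : dga K) (X : ldgmod R) :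
  Kflat_res X := KFlatRes (@semifree_Kflat K R X) (@semifree_qi K R X).
Definition semifree_pres (K : comPzRingType) (R : dga K) (X : ldgmod R) :
  Kproj_res X := KProjRes (@semifree_Kprojective K R X) (@semifree_qi K R X).

Lemma qi_congr (K : comPzRingType) (C D : cplx K) (f g : cmap C D) :
  (forall i (x : C i), cycle x -> boundary (f i x - g i x)) ->
  quasi_iso f -> quasi_iso g.
Proof.
move=> fg qf i; split=> [x cx b|y cy].
  by apply: (qi_inj qf cx); rewrite -(subrK (g i x) (f i x)); apply: boundaryD; auto.
have [x [cx b]] := qi_surj qf cy; exists x; split=> //.
have -> : g i x - y = (f i x - y) - (f i x - g i x).
  by rewrite opprB [RHS]addrC addrA subrK.
by apply: boundaryB; auto.
Qed.

(** The lift [u] of [q] through [p] is a quasi-isomorphism by cancellation, as [p u] and [q] agree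
    on homology; between K-projective modules it has a homotopy inverse. *)
Lemma Kproj_res_unique (K : comPzRingType) (R : dga K) (X P Q : ldgmod R)
    (p : ldg_hom P X) (q : ldg_hom Q X) :
  Kprojective P -> Kprojective Q -> quasi_iso p -> quasi_iso q ->
  exists (u : ldg_hom Q P) (v : ldg_hom P Q),
    homotopic (lh_comp p u) q /\ homotopy_inverse u v.
Proof.
move=> pP pQ qp qq; have [u pu] := Kproj_lift q pQ qp.
suff qu : quasi_iso u.
  by have [v uv] := Kproj_homotopy_inverse pQ pP qu; exists u, v.
apply: (qi_cancel_l qp); apply: qi_congr qq => i x cx.
exact: (homotopic_boundary (homotopic_sym pu) cx).
Qed.

(** * The equivalent conditions *)

Section Implications.
Variables (K : comPzRingType) (R S : dga K) (phi : dga_hom R S).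
Local Notation SR := (rres phi (rregular S)).
Local Notation RS := (lres phi (lregular S)).

(** The resolution is universally quantified here, so that the property can be applied when [N] is
    itself a resolution over [S] and [q] resolves its restriction. *)
Definition action_always_qi : Prop :=
  forall (N : ldgmod S) (F : ldgmod R) (q : ldg_hom F (lres phi N)),
    Kflat F -> quasi_iso q -> quasi_iso (action_map q).

Section RightResolution.
Variables (P : rdgmod R) (p : rdg_hom P SR).
Hypotheses (flatP : rflat P) (qip : quasi_iso p).

(** The left factor [S] is resolved instead of the right one, so that a single [P] serves all
    modules [N] at once. *)
Definition right_action (N : ldgmod S) : cmap (tens_cx P (lres phi N)) N :=
  cmap_comp (reg_map N) (cmap_comp
    (base_change_map (rregular S) (lh_id (lres phi N)))
    (tens_map p (lh_id (lres phi N)))).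

Lemma right_action_tpure (N : ldgmod S) i j n (h : i + j = n) x (y : N j) :
  right_action N n (@tpure _ _ P (lres phi N) n i j h x y) =
  lact N h (p i x : S i) y.
Proof.
rewrite /right_action /=.
rewrite -[LHS]/(reg_map N n (base_change_map (rregular S) (lh_id (lres phi N)) n
  (tens_map p (lh_id (lres phi N)) n _))).
by rewrite tens_map_tpure base_change_map_tpure reg_map_tpure.
Qed.

(** Balancing of the derived tensor product: [P (x) F] maps quasi-isomorphically to [S (x) F], by
    K-flatness of [F], and to [P (x) N], by flatness of [P]; the two action maps agree on it. *)
Lemma right_action_qi (N : ldgmod S) (F : ldgmod R) (q : ldg_hom F (lres phi N)) :
  Kflat F -> quasi_iso q ->
  (quasi_iso (action_map q) <-> quasi_iso (right_action N)).
Proof.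
move=> fF qq.
have q1 := flatP qq; have q2 := Kflat_qi fF qip.
have sq n t : cmap_comp (action_map q) (tens_map p (lh_id F)) n t =
    cmap_comp (right_action N) (tens_map (rh_id P) q) n t.
  move: t; apply: (tens_ext (f := action_map q n \o tens_map p (lh_id F) n)
    (g := right_action N n \o tens_map (rh_id P) q n)) => i j h x f.
  rewrite -[LHS]/(action_map q n (tens_map p (lh_id F) n _)).
  rewrite -[RHS]/(right_action N n (tens_map (rh_id P) q n _)).
  by rewrite !tens_map_tpure action_map_tpure right_action_tpure.
split=> qa.
  by apply: (qi_cancel_r q1); apply: qi_ext sq _; apply: qi_comp.
apply: (qi_cancel_r q2); apply: (qi_ext (fun n t => esym (sq n t))).
exact: qi_comp.
Qed.

Lemma right_action_act i j k (h : i + j = k) (t : rind phi P i) (s : S j) :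
  right_action (lregular S) k (ract (rind phi P) h t s) =
  dga_mul S h (right_action (lregular S) i t : S i) s.
Proof.
elim/tens_ind: t => [|x y IHx IHy|a x IHx|p' q e x t].
- by rewrite ract0l !linear0 dmul0l.
- by rewrite ractDl !linearD dmulDl IHx IHy.
- rewrite ractZl.
  by rewrite ![right_action _ _ (_ *: _)]linearZZ dmulZl IHx.
have e1 : p' + (q + j) = k by lia.
rewrite [ract _ h _ _](rindact_tpure (N := lregular S) _ _ _ erefl e1).
rewrite (right_action_tpure (N := lregular S) e1).
by rewrite (right_action_tpure (N := lregular S) e) /= (dga_mulA e h).
Qed.

Definition right_action_hom : rdg_hom (rind phi P) (rregular S) :=
  @RDgHom K S (rind phi P) (rregular S) (right_action (lregular S)) right_action_act.

Lemma right_action_reg :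
  quasi_iso (right_action (lregular S)) -> forall N, quasi_iso (right_action N).
Proof.
move=> qS.
have flat_case (G : ldgmod S) : Kflat G -> quasi_iso (right_action G).
  move=> fG; apply: (qi_cancel_r (rind_assoc_qi phi P G)).
  have q1 := Kflat_qi (f := right_action_hom) fG qS.
  apply: qi_ext (qi_comp (reg_map_qi G) q1) => n.
  apply: (tens_ext (f := reg_map G n \o tens_map right_action_hom (lh_id G) n)
    (g := right_action G n \o rind_assoc phi P G n)) => i j h t g.
  rewrite -[LHS]/(reg_map G n (tens_map right_action_hom (lh_id G) n _)).
  rewrite -[RHS]/(right_action G n (rind_assoc phi P G n _)).
  rewrite tens_map_tpure reg_map_tpure rind_assoc_tpure.
  elim/tens_ind: t => [|x y IHx IHy|a x IHx|p' q e x t].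
  - by rewrite !linear0 lact0l.
  - by rewrite !linearD lactDl IHx IHy.
  - by rewrite [right_action_hom _ _]linearZZ lactZl IHx !linearZZ.
  have e1 : p' + (q + j) = n by lia.
  rewrite (rindact_tpure _ _ _ erefl e1) right_action_tpure.
  by rewrite [right_action_hom _ _]right_action_tpure (lactA e h erefl e1).
(* Flatness of [P] over [R] reduces an arbitrary [N] to a K-flat resolution over [S]. *)
move=> N; pose G := semifree_fres N.
have q1 := flatP (f := lh_res phi (fres_map G)) (fres_qis G).
apply: (qi_cancel_r q1).
have qG := qi_comp (fres_qis G) (flat_case G (@fres_flat _ _ _ G)).
refine (qi_ext _ qG) => n.
apply: (tens_ext (f := fres_map G n \o right_action G n)
  (g := right_action N n \o tens_map (rh_id P) (lh_res phi (fres_map G)) n)).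
move=> i j h x g.
rewrite -[LHS]/(fres_map G n (right_action G n _)).
rewrite -[RHS]/(right_action N n (tens_map (rh_id P) (lh_res phi (fres_map G)) n _)).
by rewrite tens_map_tpure !right_action_tpure lh_act.
Qed.
End RightResolution.

(** The given resolution and an arbitrary one are compared through the right action of one and the
    same [P]. *)
Lemma regular_action_always_qi (F : Kflat_res RS) :
  quasi_iso (action_map (fres_map F)) -> action_always_qi.
Proof.
move=> q1 N G q fG qq; have [P [p [fP qp]]] := rflat_resolution SR.
apply/(right_action_qi fP qp fG qq)/right_action_reg => //.
exact/(right_action_qi fP qp (@fres_flat _ _ _ F) (fres_qis F)).
Qed.

Lemma base_change_qi_of_action : action_always_qi ->
  forall (M : rdgmod S) (N : ldgmod S),
    exists (G : Kflat_res N) (F : Kflat_res (lres phi G)),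
      quasi_iso (base_change_map M (fres_map F)).
Proof.
move=> act M N; exists (semifree_fres N); set G := semifree_fres N.
exists (semifree_fres (lres phi G)); set F := semifree_fres (lres phi G).
set q := fres_map F; pose e := ind_hom q.
have qe : quasi_iso e := act _ _ q (@fres_flat _ _ _ F) (fres_qis F).
have [P [p [fP qp]]] := rflat_resolution M.
have fI := @ind_Kflat _ _ _ phi F (@fres_flat _ _ _ F).
(* [M] is arbitrary, but [G] and the induced module are K-flat over [S]: on both sides [M] may be
   replaced by its flat resolution [P], which preserves the quasi-isomorphism [e]. *)
have qM : quasi_iso (tens_map (rh_id M) e).
  apply: (qi_cancel_r (Kflat_qi fI qp)).
  apply: qi_ext (qi_comp (Kflat_qi (@fres_flat _ _ _ G) qp) (fP _ _ e qe)) => n.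
  apply: (tens_ext (f := tens_map p (lh_id G) n \o tens_map (rh_id P) e n)
    (g := tens_map (rh_id M) e n \o tens_map p (lh_id (ind phi F)) n)).
  move=> i j h x y.
  rewrite -[LHS]/(tens_map p (lh_id G) n (tens_map (rh_id P) e n _)).
  rewrite -[RHS]/(tens_map (rh_id M) e n (tens_map p (lh_id (ind phi F)) n _)).
  by rewrite !tens_map_tpure.
apply: qi_ext (qi_comp qM (base_change_unit_qi phi F M)) => n.
apply: (tens_ext (f := tens_map (rh_id M) e n \o base_change_map M (ind_unit phi F) n)
  (g := base_change_map M q n)) => i j h x y.
rewrite -[LHS]/(tens_map (rh_id M) e n (base_change_map M (ind_unit phi F) n _)).
by rewrite !base_change_map_tpure tens_map_tpure ind_hom_unit.
Qed.

(** At [M = S], base change followed by [S (x)_S G = G] and the resolution map to [S] is the action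
    map of the composite resolution from [F] through [G] to [S]. *)
Lemma action_qi_of_base_change (G : Kflat_res (lregular S))
    (F : Kflat_res (lres phi G)) :
  quasi_iso (base_change_map (rregular S) (fres_map F)) ->
  exists F' : Kflat_res RS, quasi_iso (action_map (fres_map F')).
Proof.
move=> qb.
have qq : quasi_iso (lh_comp (lh_res phi (fres_map G)) (fres_map F)).
  exact: (qi_comp (g := lh_res phi (fres_map G)) (fres_qis G) (fres_qis F)).
exists (KFlatRes (@fres_flat _ _ _ F) qq) => /=.
apply: qi_ext (qi_comp (qi_comp (fres_qis G) (reg_map_qi G)) qb) => n.
set q := lh_comp _ _.
apply: (tens_ext (f := (fres_map G n \o reg_map G n) \o
  base_change_map (rregular S) (fres_map F) n) (g := action_map q n)) => i j h s x.
rewrite -[LHS]/(fres_map G n (reg_map G n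
  (base_change_map (rregular S) (fres_map F) n _))).
by rewrite base_change_map_tpure reg_map_tpure action_map_tpure lh_act.
Qed.

Lemma restrict_qi_of_action : action_always_qi ->
  forall M M' : ldgmod S,
    exists (P : Kproj_res M) (Q : Kproj_res (lres phi P)),
      quasi_iso (restrict_map M' (pres_map Q)).
Proof.
move=> act M M'; exists (semifree_pres M); set P := semifree_pres M.
exists (semifree_pres (lres phi P)); set Q := semifree_pres (lres phi P).
set q := pres_map Q; pose e := ind_hom q.
(* [Q] was chosen as a K-projective resolution; being semi-free it is also K-flat, as the hypothesis
   on actions demands. *)
have qe : quasi_iso e := act _ _ q (@semifree_Kflat _ _ _) (pres_qis Q).
have [s es] := Kproj_homotopy_inverse (@ind_Kproj _ _ _ phi Q (@pres_proj _ _ _ Q))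
  (@pres_proj _ _ _ P) qe.
apply: qi_ext (qi_comp (restrict_unit_qi phi Q M') (hom_pre_qi M' es)) => n u.
apply: ghomP => i j h x.
by rewrite -[LHS]/(gh_fun u h (e i (ind_unit phi Q i x))) ind_hom_unit.
Qed.

(** [S] is K-projective over itself, so its resolution [P] is homotopy equivalent to it and
    [Hom_S(P, M)] is [M] up to quasi-isomorphism. Restriction then becomes the unit map of the
    composite resolution from [Q] through [P] to [S]. *)
Lemma unit_qi_of_restrict (M : ldgmod S) (P : Kproj_res (lregular S))
    (Q : Kproj_res (lres phi P)) :
  quasi_iso (restrict_map M (pres_map Q)) ->
  exists Q' : Kproj_res RS, quasi_iso (unit_map M (pres_map Q')).
Proof.
move=> qr.
have qq : quasi_iso (lh_comp (lh_res phi (pres_map P)) (pres_map Q)).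
  exact: (qi_comp (g := lh_res phi (pres_map P)) (pres_qis P) (pres_qis Q)).
exists (KProjRes (@pres_proj _ _ _ Q) qq) => /=.
have [s es] := Kproj_homotopy_inverse (@pres_proj _ _ _ P) (@reg_Kproj _ S)
  (pres_qis P).
apply: qi_ext (qi_comp qr (qi_comp (hom_pre_qi M es) (reg_hom_qi M))) => n m.
exact: ghomP.
Qed.

(* [s] is a homotopy inverse of the action map, by the argument of the Yoneda lemma. *)
Lemma action_map_qi_of_section (Q : ldgmod R) (q : ldg_hom Q RS)
    (s : ldg_hom (lregular S) (ind phi Q)) :
  homotopic (lh_comp (lh_res phi s) q) (ind_unit phi Q) ->
  homotopic (lh_comp (ind_hom q) s) (lh_id (lregular S)) ->
  quasi_iso (action_map q).
Proof.
move=> sq es; apply: (@homotopy_inverse_qi _ _ _ _ (ind_hom q) s); split=> //.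
apply: ind_homotopic; apply: homotopic_ext sq => // i x.
by rewrite -[RHS]/(s i (ind_hom q i (ind_unit phi Q i x))) ind_hom_unit.
Qed.

(** Condition (4) may provide a different resolution for each [M], while the Yoneda argument needs a
    fixed [Q] both at the module induced from [Q] and at [S]. *)
Lemma unit_map_indep (M : ldgmod S) (P Q : Kproj_res RS) :
  quasi_iso (unit_map M (pres_map P)) -> quasi_iso (unit_map M (pres_map Q)).
Proof.
move=> qP.
have [u [v [pu uv]]] := Kproj_res_unique (@pres_proj _ _ _ P) (@pres_proj _ _ _ Q)
  (pres_qis P) (pres_qis Q).
apply: qi_congr (qi_comp (hom_pre_qi (lres phi M) uv) qP) => n m cm.
(* Right multiplication by [m], as a cycle of [Hom_R(S, M)]. Precomposing it with the homotopic maps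
   [p u] and [q] gives the two maps to be compared. *)
have cU := cycle_map (unit_map M (lh_id RS)) cm.
move: (hom_pre_homotopic pu cU); congr boundary.
by congr (_ - _); apply: ghomP.
Qed.

Lemma action_qi_of_unit :
  (forall M : ldgmod S, exists P : Kproj_res RS,
     quasi_iso (unit_map M (pres_map P))) ->
  exists F : Kflat_res RS, quasi_iso (action_map (fres_map F)).
Proof.
move=> c4; exists (semifree_fres RS); pose Q := semifree_pres RS.
have qU M : quasi_iso (unit_map M (pres_map Q)).
  by have [P qP] := c4 M; apply: unit_map_indep qP.
set q : ldg_hom Q RS := pres_map Q; rewrite -[fres_map _]/q.
(* Surjectivity at the induced module: its unit is homotopic to [q] followed by right multiplication
   by a cycle [m] of degree 0. This multiplication is the candidate inverse. *)
have [m [cm bm]] := qi_surj (qU (ind phi Q)) (gh_of_cycle (ind_unit phi Q)).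
have sq : homotopic (lh_comp (lh_res phi (rmul cm)) q) (ind_unit phi Q).
  apply/homotopicP; move: bm; congr boundary; congr (_ - _).
  apply: ghomP => i j h x /=; rewrite mul0r /ksgn expr0 scale1r.
  move: (deg0 h) => e; case: j / e h => h.
  by rewrite cxcast_id /rmul_fun (eq_irrelevance h (addr0 i)).
apply: (action_map_qi_of_section sq); apply: reg_homotopic.
rewrite -/q; set e := ind_hom q.
have cy : cycle (e 0 m - dga_one S : S 0).
  apply: (cycleB (C := S)); first exact: (cycle_map e).
  by move=> j h; apply: d_one.
have -> : lh_comp e (rmul cm) 0 (dga_one S) = e 0 m.
  by rewrite -[LHS]/(e 0 (lact (ind phi Q) (addr0 0) (dga_one S) m)) lact1.
(* Injectivity at [S]: the unit map sends [e m - 1] to the difference of [e s q] and [q], with [s]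
   right multiplication by [m]. It is null-homotopic, because [s q] is homotopic to the unit of
   induction, which [e] carries to [q]. *)
apply: (qi_inj (qU (lregular S)) cy).
have /homotopicP := homotopic_compl (lh_res phi e) sq; congr boundary.
apply: ghomP => i j h x.
rewrite -[RHS]/(gh_fun (unit_fun q (e 0 m - dga_one S : lregular S 0)) h x).
transitivity (cxcast (deg0 h) (e i (lact (ind phi Q) (addr0 i) (q i x) m))
  - cxcast (deg0 h) (e i (ind_unit phi Q i x))).
  by rewrite -[in RHS]scaleN1r.
rewrite lh_act ind_hom_unit /= mul0r /ksgn expr0 scale1r.
move: (deg0 h) => d; case: j / d h => h; rewrite !cxcast_id.
rewrite dmulBr dga_mul1r.
by rewrite (eq_irrelevance h (addr0 i)).
Qed.

Lemma action_qi_of_dres : dres_full phi -> dres_faithful phi ->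
  exists F : Kflat_res RS, quasi_iso (action_map (fres_map F)).
Proof.
move=> full faithful; exists (semifree_fres RS); pose Q := semifree_pres RS.
set q : ldg_hom Q RS := pres_map Q; rewrite -[fres_map _]/q.
have pQ : Kprojective Q := @pres_proj _ _ _ Q.
have pS := @reg_Kproj _ S; have qq : quasi_iso q := pres_qis Q.
(* Over [R] the unit of induction composed with the inverse of [q] goes from [S] to the induced
   module; fullness makes it [S]-linear in the derived category, and K-projectivity of [S]
   represents it by an honest map. *)
have [f fE] := full (lregular S) (ind phi Q)
  (DComp (DHom (ind_unit phi Q)) (DInv qq)).
have [s sE] := dmor_of_Kproj pS f (lh_id _).
have {}sE : deq f (DHom s) := deq_trans (deq_sym (deq_idr f)) sE.
have sq : homotopic (lh_comp (lh_res phi s) q) (ind_unit phi Q).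
  apply: (deq_hom_Kproj pQ).
  apply: deq_trans (deq_hom_comp _ _) _.
  apply: deq_trans (deq_comp (deq_sym (dres_deq phi sE)) (deq_refl _)) _.
  apply: deq_trans (deq_comp fE (deq_refl _)) _.
  apply: deq_trans (deq_sym (deq_assoc _ _ _)) _.
  apply: deq_trans (deq_comp (deq_refl _) (deq_invl qq)) _.
  exact: deq_idr.
apply: (action_map_qi_of_section sq).
(* Faithfulness allows the identity to be checked over [R], and cancelling [q] allows it to be
   checked on [Q], where both sides become [q]. *)
apply: (deq_hom_Kproj pS); apply: faithful.
apply: (deq_cancel_qi qq) => /=.
apply: deq_trans (deq_sym (deq_hom_comp _ _)) _.
apply: deq_trans _ (deq_hom_comp _ _); apply: deq_homotopic.
apply: homotopic_ext (homotopic_compl (lh_res phi (ind_hom q)) sq) => // i x.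
by rewrite -[LHS]/(ind_hom q i (ind_unit phi Q i x)) ind_hom_unit.
Qed.

(** On degree-zero homology the restriction map compares homotopy classes out of [P] over [S] with
    those out of [Q] over [R], that is, morphisms in the two derived categories. Surjectivity gives
    fullness and injectivity faithfulness. *)
Lemma dres_fully_faithful_of_restrict :
  (forall M M' : ldgmod S,
    exists (P : Kproj_res M) (Q : Kproj_res (lres phi P)),
      quasi_iso (restrict_map M' (pres_map Q))) ->
  dres_full phi /\ dres_faithful phi.
Proof.
move=> c5; split=> [M N g|M N f g fg].
  have [P [Q qr]] := c5 M N; pose p := pres_map P; pose q := pres_map Q.
  have qp : quasi_iso p := pres_qis P.
  have qw : quasi_iso (lh_comp (lh_res phi p) q).
    exact: (qi_comp (g := lh_res phi p) (pres_qis P) (pres_qis Q)).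
  (* [g] becomes an honest [R]-linear map [h] on [Q], which is then the restriction, up to homotopy,
     of an [S]-linear map on [P]; dividing the latter by [p] gives the preimage of [g]. *)
  have [h gh] := dmor_of_Kproj (@pres_proj _ _ _ Q) g (lh_comp (lh_res phi p) q).
  have [u [cu bu]] := qi_surj qr (gh_of_cycle h).
  exists (DComp (DHom (hom_of cu)) (DInv qp)).
  apply: (deq_cancel_qi qw); apply: deq_trans _ (deq_sym gh) => /=.
  apply: deq_trans (deq_comp (deq_refl _) (deq_hom_comp _ _)) _.
  apply: deq_trans (deq_assoc _ _ _) _.
  apply: deq_trans (deq_comp (deq_sym (deq_assoc _ _ _)) (deq_refl _)) _.
  apply: deq_trans (deq_comp (deq_comp (deq_refl _)
    (deq_invl (q := lh_res phi p) qp)) (deq_refl _)) _.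
  apply: deq_trans (deq_comp (deq_idr _) (deq_refl _)) _.
  apply: deq_trans (deq_sym (deq_hom_comp _ _)) _.
  apply/deq_homotopic/homotopicP; move: bu; congr boundary; congr (_ - _).
  by apply: ghomP => i j e x /=; rewrite gh_cast.
have [P [Q qr]] := c5 M N; pose p := pres_map P; pose q := pres_map Q.
have [a fa] := dmor_of_Kproj (@pres_proj _ _ _ P) f p.
have [b gb] := dmor_of_Kproj (@pres_proj _ _ _ P) g p.
apply: (deq_cancel_qi (pres_qis P)).
refine (deq_trans fa _); refine (deq_trans _ (deq_sym gb)).
apply/deq_homotopic/homotopicP; apply: (qi_inj qr).
  by apply: (cycleB (C := hom_cx P N)); apply: gh_of_cycle.
have ab : deq (DHom (lh_res phi a)) (DHom (lh_res phi b)).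
  apply: deq_trans (deq_sym (dres_deq phi fa)) _.
  apply: deq_trans _ (dres_deq phi gb).
  exact: deq_comp fg (deq_refl _).
have : homotopic (lh_comp (lh_res phi a) q) (lh_comp (lh_res phi b) q).
  apply: (deq_hom_Kproj (@pres_proj _ _ _ Q)).
  apply: deq_trans (deq_hom_comp _ _) _.
  apply: deq_trans _ (deq_sym (deq_hom_comp _ _)).
  exact: deq_comp ab (deq_refl _).
by move=> /homotopicP; congr boundary; apply: ghomP.
Qed.

End Implications.

Theorem theorem3p9 (K : comPzRingType) (R S : dga K) (phi : dga_hom R S) :
  [<-> exists F : Kflat_res (lres phi (lregular S)),
         quasi_iso (action_map (fres_map F));
       forall M : ldgmod S, exists F : Kflat_res (lres phi M),
         quasi_iso (action_map (fres_map F));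
       forall (M : rdgmod S) (N : ldgmod S),
         exists (G : Kflat_res N) (F : Kflat_res (lres phi G)),
           quasi_iso (base_change_map M (fres_map F));
       forall M : ldgmod S, exists P : Kproj_res (lres phi (lregular S)),
         quasi_iso (unit_map M (pres_map P));
       forall M M' : ldgmod S,
         exists (P : Kproj_res M) (Q : Kproj_res (lres phi P)),
           quasi_iso (restrict_map M' (pres_map Q));
       dres_full phi /\ dres_faithful phi].
Proof.
(* (4) is obtained from the case of (5) whose first module is [S]. *)
have unit_qi (act : action_always_qi phi) M :
  exists P : Kproj_res (lres phi (lregular S)),
    quasi_iso (unit_map M (pres_map P)).
  have [P [Q qr]] := restrict_qi_of_action act (lregular S) M.
  exact: unit_qi_of_restrict qr.
tfae.
- move=> [F qF] M; exists (semifree_fres (lres phi M)).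
  exact: (regular_action_always_qi qF (@semifree_Kflat _ _ _) (@semifree_qi _ _ _)).
- move=> c2; have [F qF] := c2 (lregular S).
  exact: base_change_qi_of_action (regular_action_always_qi qF).
- move=> c3; have [G [F qb]] := c3 (rregular S) (lregular S).
  have [F' qF] := action_qi_of_base_change qb.
  exact: unit_qi (regular_action_always_qi qF).
(* The way from (4) to (5) returns to (1) by the Yoneda argument. *)
- move=> /action_qi_of_unit[F qF].
  exact: restrict_qi_of_action (regular_action_always_qi qF).
- exact: dres_fully_faithful_of_restrict.
- by move=> [full faithful]; apply: action_qi_of_dres.
Qed.
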